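(* Let $(R,\mathfrak{m}_R,k)$ be a commutative noetherian local ring. Assume that $\mathfrak{m}_R=I\oplus J$, where $I$ and $J$ are non-zero ideals of $R$ minimally generated by sequences $\mathbf{x}_1$ of length $t$ and $\mathbf{x}_2$ of length $s$, respectively. Then there is an isomorphism $$ A_R^+ \cong \left(\left(\bigwedge k^{t}\otimes_k A^+_{R/I}\right)\times \left(A^+_{R/J}\otimes_k \bigwedge k^{s}\right)\right)\ltimes W $$ of $k$-algebras (without unity), with $$ W=\Sigma^{-1}\left(\frac{\bigwedge k^{t}\otimes_k\bigwedge k^{s}}{k\otimes_k\bigwedge k^{s}+\bigwedge k^{t}\otimes_k k}\right), $$ where the algebra $\left(\bigwedge k^{t}\otimes_k A^+_{R/I}\right)\times \left(A^+_{R/J}\otimes_k \bigwedge k^{s}\right)$ acts on $W$ by zero. This isomorphism determines the algebra structure of $A_R$ via the equality $A_R=k\oplus A_R^+$.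
   Context: Tor algebra: for a commutative noetherian local ring $(S,\mathfrak{m}_S,k)$ with $\mathfrak m_S$ minimally generated by $n$ elements, let $\widehat{S}\cong Q/\mathfrak{a}$ be a minimal Cohen presentation, i.e., $(Q,\mathfrak{m}_Q,k)$ is a complete regular local ring of Krull dimension $n$ and $\mathfrak{a}\subseteq\mathfrak{m}_Q^2$ is an ideal. The Tor algebra of $S$ is $A_S:=\operatorname{Tor}^Q(k,\widehat{S})$, a finite-dimensional graded-commutative $k$-algebra (a DG $k$-algebra with zero differential). It is identified, via an isomorphism of DG $k$-algebras, with the homology algebra $\operatorname{H}(K^S(\mathbf{y}))$ of the Koszul complex on a minimal generating sequence $\mathbf{y}$ of $\mathfrak{m}_S$. Notation: for a non-negatively graded algebra $A$, $A^+=\bigoplus_{n\geq 1}A_n$. The exterior algebra $\bigwedge k^n$ is graded with $k^n$ in degree $1$, and $k=(\bigwedge k^n)_0$ inside $\bigwedge k^n$. Tensor products of graded algebras are graded tensor products (with the usual Koszul sign rule); $\times$ is the product of algebras with componentwise operations. $k$-algebras are not required to have a unity. The shift $\Sigma^i L$ of a graded module $L$ is given by $(\Sigma^i L)_j=L_{j-i}$. For a graded algebra $A$ (possibly without unity) and a graded $A$-module $L$, the trivial extension $A\ltimes L$ is $A\oplus L$ with product $(a,l)(a',l')=(aa',\,al'+(-1)^{|l||a'|}a'l)$ for homogeneous elements $a,a'\in A$ and $l,l'\in L$. *)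

(* Defs.v *)
From HB Require Import structures.
From mathcomp Require Import all_boot all_algebra.
From mathcomp Require Import boolp.
Set Implicit Arguments.
Unset Strict Implicit.
Unset Printing Implicit Defensive.
Import GRing.Theory.
Local Open Scope ring_scope.
Local Open Scope quotient_scope.

(* [gm_comp i x] is the component of degree [i] of [x]; the laws say that the
   module is the direct sum of the images of the projections [gm_comp i]. *)
Record grmod (K : comNzRingType) := GrMod {
  gm_sort :> lmodType K;
  gm_comp : nat -> {linear gm_sort -> gm_sort};
  gm_compK : forall i j x,
    gm_comp i (gm_comp j x) = if i == j then gm_comp j x else 0;
  gm_sum : forall x, exists N, x = \sum_(i < N) gm_comp i x }.

Definition bilin (K : comNzRingType) (U V W : lmodType K) (f : U -> V -> W) :=
  (forall v, linear (f^~ v)) /\ (forall u, linear (f u)).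

(* Not required to have a unity. *)
Record gralg (K : comNzRingType) := GrAlg {
  ga_mod :> grmod K;
  ga_mul : ga_mod -> ga_mod -> ga_mod;
  ga_bilin : bilin ga_mul;
  ga_mulA : associative ga_mul;
  ga_deg : forall i j a b, gm_comp ga_mod i a = a -> gm_comp ga_mod j b = b ->
    gm_comp ga_mod (i + j) (ga_mul a b) = ga_mul a b }.

Definition gralg_iso (K : comNzRingType) (A B : gralg K) : Prop :=
  exists f : {linear A -> B},
    [/\ bijective f,
        forall a b, f (ga_mul a b) = ga_mul (f a) (f b)
      & forall i a, f (gm_comp A i a) = gm_comp B i (f a)].

Section Bilin.
Variables (K : comNzRingType) (U V W : lmodType K) (f : U -> V -> W).
Hypothesis bf : bilin f.

Lemma bilinDl u u' v : f (u + u') v = f u v + f u' v.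
Proof. by have := bf.1 v 1 u u'; rewrite !scale1r. Qed.
Lemma bilinDr u v v' : f u (v + v') = f u v + f u v'.
Proof. by have := bf.2 u 1 v v'; rewrite !scale1r. Qed.
Lemma bilin0l v : f 0 v = 0.
Proof. by apply: (addrI (f 0 v)); rewrite -bilinDl !addr0. Qed.
Lemma bilin0r u : f u 0 = 0.
Proof. by apply: (addrI (f u 0)); rewrite -bilinDr !addr0. Qed.
Lemma bilinZl c u v : f (c *: u) v = c *: f u v.
Proof. by have := bf.1 v c u 0; rewrite !addr0 bilin0l addr0. Qed.
Lemma bilinZr c u v : f u (c *: v) = c *: f u v.
Proof. by have := bf.2 u c v 0; rewrite !addr0 bilin0r addr0. Qed.
Lemma bilin_suml I (r : seq I) P (F : I -> U) v :
  f (\sum_(i <- r | P i) F i) v = \sum_(i <- r | P i) f (F i) v.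
Proof. exact: (big_morph (f^~ v) (fun x y => bilinDl x y v) (bilin0l v)). Qed.
Lemma bilin_sumr I (r : seq I) P (F : I -> V) u :
  f u (\sum_(i <- r | P i) F i) = \sum_(i <- r | P i) f u (F i).
Proof. exact: (big_morph (f u) (bilinDr u) (bilin0r u)). Qed.
End Bilin.

Lemma linear_at0 (K : comNzRingType) (U V : lmodType K) (f : U -> V) :
  linear f -> f 0 = 0.
Proof. by move=> lf; have := lf (-1) 0 0; rewrite addr0 !scaleN1r oppr0 addNr. Qed.

Section GrMod.
Variables (K : comNzRingType) (A : grmod K).

Definition gm_bound (x : A) : nat := projT1 (cid (gm_sum x)).

Lemma gm_boundP x : x = \sum_(i < gm_bound x) gm_comp A i x.
Proof. exact: (projT2 (cid (gm_sum x))). Qed.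

Lemma gm_comp_gt x i : (gm_bound x <= i)%N -> gm_comp A i x = 0.
Proof.
move=> le; rewrite {1}(gm_boundP x) linear_sum big1 // => j _ /=.
by rewrite gm_compK; case: eqP => // ij; move: le; rewrite ij leqNgt ltn_ord.
Qed.

Definition gsum (V : lmodType K) (F : nat -> A -> V) (x : A) : V :=
  \sum_(i < gm_bound x) F i (gm_comp A i x).

Lemma gsumE (V : lmodType K) (F : nat -> A -> V) (x : A) N :
  (forall i, linear (F i)) -> (gm_bound x <= N)%N ->
  gsum F x = \sum_(i < N) F i (gm_comp A i x).
Proof.
move=> lF le; rewrite /gsum (big_ord_widen _ (fun i => F i (gm_comp A i x)) le).
rewrite big_mkcond /=; apply: eq_bigr => i _; case: ltnP => // lei.
by rewrite gm_comp_gt // linear_at0.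
Qed.

Lemma gsum_linear (V : lmodType K) (F : nat -> A -> V) :
  (forall i, linear (F i)) -> linear (gsum F).
Proof.
move=> lF c x y.
pose N := maxn (gm_bound (c *: x + y)) (maxn (gm_bound x) (gm_bound y)).
have [h1 h2 h3] : [/\ gm_bound (c *: x + y) <= N, gm_bound x <= N & gm_bound y <= N]%N.
  by rewrite /N !leq_max !leqnn !orbT.
rewrite !(gsumE lF h1, gsumE lF h2, gsumE lF h3) scaler_sumr -big_split /=.
by apply: eq_bigr => i _; rewrite linearP lF.
Qed.

Lemma gsum_linear_param (V W : lmodType K) (F : W -> nat -> A -> V) x :
  (forall i y, linear (fun w => F w i y)) -> linear (fun w => gsum (F w) x).
Proof.
move=> lF c w w'; rewrite /gsum scaler_sumr -big_split /=.
by apply: eq_bigr => i _; rewrite lF.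
Qed.

Lemma gsum_hom (V : lmodType K) (F : nat -> A -> V) i x :
  (forall i, linear (F i)) -> gm_comp A i x = x -> gsum F x = F i x.
Proof.
move=> lF hx; have F0 j : F j 0 = 0 by exact: linear_at0.
rewrite (gsumE lF (leq_maxl _ i.+1)).
rewrite (bigD1 (Ordinal (leq_maxr (gm_bound x) i.+1))) //= hx big1 ?addr0 //.
move=> j; rewrite -val_eqE /= => /negPf ji.
by have := gm_compK j i x; rewrite hx ji => ->.
Qed.
End GrMod.

(* [U (x) V] is the set of formal sums of pairs, two of them being identified
   when every bilinear map takes the same value on both. *)
Section Tensor.
Variables (K : comNzRingType) (U V : lmodType K).

Definition tens_eval (W : lmodType K) (f : U -> V -> W) (s : seq (U * V)) : W :=
  \sum_(p <- s) f p.1 p.2.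

Definition tens_rel : rel (seq (U * V)) := fun s t =>
  `[< forall (W : lmodType K) (f : U -> V -> W), bilin f ->
      tens_eval f s = tens_eval f t >].

Lemma tens_rel_equiv : equiv_class_of tens_rel.
Proof.
split=> [s|s t|s t u].
- exact/asboolP.
- by apply/asboolP/asboolP => h W f /h ->.
- by move=> /asboolP h1 /asboolP h2; apply/asboolP=> W f bf; rewrite h1 ?h2.
Qed.
Canonical tens_equiv := EquivRelPack tens_rel_equiv.
Canonical tens_encModRel := defaultEncModRel tens_rel.

Definition tens := {eq_quot tens_rel}.
HB.instance Definition _ := Choice.on tens.
HB.instance Definition _ : EqQuotient _ tens_rel tens := EqQuotient.on tens.

Definition tens_pi (s : seq (U * V)) : tens := \pi_tens s.

Definition tlift (W : lmodType K) (f : U -> V -> W) (x : tens) : W :=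
  tens_eval f (repr x).

Lemma tliftE W f s : bilin f -> @tlift W f (tens_pi s) = tens_eval f s.
Proof.
move=> bf; rewrite /tlift.
by have /eqmodP/asboolP -> // := reprK (\pi_tens s).
Qed.

Lemma tens_ext (x y : tens) :
  (forall W f, bilin f -> @tlift W f x = tlift f y) -> x = y.
Proof.
move=> h; rewrite -[x]reprK -[y]reprK; apply/eqmodP/asboolP => W f bf.
exact: h.
Qed.

Definition tens_zero : tens := tens_pi [::].
Definition tens_add (x y : tens) : tens := tens_pi (repr x ++ repr y).
Definition tens_scale (c : K) (x : tens) : tens :=
  tens_pi [seq (c *: p.1, p.2) | p <- repr x].
Definition tens_opp (x : tens) := tens_scale (-1) x.

Lemma tlift0 W f : bilin f -> @tlift W f tens_zero = 0.
Proof. by move=> bf; rewrite tliftE // /tens_eval big_nil. Qed.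
Lemma tliftD W f x y : bilin f ->
  @tlift W f (tens_add x y) = tlift f x + tlift f y.
Proof. by move=> bf; rewrite tliftE // /tens_eval big_cat. Qed.
Lemma tliftZ W f c x : bilin f -> @tlift W f (tens_scale c x) = c *: tlift f x.
Proof.
move=> bf; rewrite tliftE // /tens_eval big_map scaler_sumr.
by apply: eq_bigr => p _; rewrite bilinZl.
Qed.

Let tE := (tliftD, tlift0, tliftZ).

Fact tens_addA : associative tens_add.
Proof. by move=> x y z; apply: tens_ext => W f bf; rewrite !tE // addrA. Qed.
Fact tens_addC : commutative tens_add.
Proof. by move=> x y; apply: tens_ext => W f bf; rewrite !tE // addrC. Qed.
Fact tens_add0 : left_id tens_zero tens_add.
Proof. by move=> x; apply: tens_ext => W f bf; rewrite !tE // add0r. Qed.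
Fact tens_addN : left_inverse tens_zero tens_opp tens_add.
Proof. by move=> x; apply: tens_ext => W f bf; rewrite !tE // scaleN1r addNr. Qed.

HB.instance Definition _ :=
  GRing.isZmodule.Build tens tens_addA tens_addC tens_add0 tens_addN.

Fact tens_scaleA a b v : tens_scale a (tens_scale b v) = tens_scale (a * b) v.
Proof. by apply: tens_ext => W f bf; rewrite !tE // scalerA. Qed.
Fact tens_scale1 : left_id 1 tens_scale.
Proof. by move=> x; apply: tens_ext => W f bf; rewrite !tE // scale1r. Qed.
Fact tens_scaleDr : right_distributive tens_scale +%R.
Proof. by move=> c x y; apply: tens_ext => W f bf; rewrite !tE // scalerDr. Qed.
Fact tens_scaleDl v : {morph tens_scale^~ v : a b / a + b}.
Proof. by move=> a b; apply: tens_ext => W f bf; rewrite !tE // scalerDl. Qed.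

HB.instance Definition _ := GRing.Zmodule_isLmodule.Build K tens
  tens_scaleA tens_scale1 tens_scaleDr tens_scaleDl.

Definition pure (u : U) (v : V) : tens := tens_pi [:: (u, v)].

Lemma tlift_pure W f u v : bilin f -> @tlift W f (pure u v) = f u v.
Proof. by move=> bf; rewrite tliftE // /tens_eval big_seq1. Qed.

Lemma tlift_linear W f : bilin f -> linear (@tlift W f).
Proof. by move=> bf c x y; rewrite [LHS]tliftD // tliftZ. Qed.

Lemma pure_bilin : bilin pure.
Proof.
split=> w c x y; apply: tens_ext => W f bf;
by rewrite tlift_linear // !tlift_pure // (bf.1, bf.2).
Qed.

Lemma tens_ind (P : tens -> Prop) :
  P 0 -> (forall x y, P x -> P y -> P (x + y)) -> (forall u v, P (pure u v)) ->
  forall x, P x.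
Proof.
move=> P0 PD Pp x; rewrite -[x]reprK -/(tens_pi _); elim: (repr x) => [//|[u v] s IH].
suff -> : tens_pi ((u, v) :: s) = pure u v + tens_pi s by exact: PD.
by apply: tens_ext => W f bf; rewrite [RHS]tliftD // tlift_pure // !tliftE //
  /tens_eval big_cons.
Qed.

End Tensor.

Lemma tlift_param (K : comNzRingType) (U V W X : lmodType K)
    (f : X -> U -> V -> W) (x : tens U V) :
  (forall u v, linear (fun z => f z u v)) -> linear (fun z => tlift (f z) x).
Proof.
move=> lf c z z'; rewrite /tlift /tens_eval scaler_sumr -big_split /=.
by apply: eq_bigr => p _; rewrite lf.
Qed.

Section GrTensor.
Variables (K : comNzRingType) (A B : grmod K).

Definition gtens_comp0 (n : nat) (a : A) (b : B) : tens A B :=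
  \sum_(i < n.+1) pure (gm_comp A i a) (gm_comp B (n - i) b).

Fact gtens_comp0_bilin n : bilin (gtens_comp0 n).
Proof.
split=> w c x y; rewrite /gtens_comp0 scaler_sumr -big_split /=;
by apply: eq_bigr => i _; rewrite linearP ((pure_bilin _ _).1, (pure_bilin _ _).2).
Qed.

Definition gtens_compf n : tens A B -> tens A B := tlift (gtens_comp0 n).

Fact gtens_compf_linear n : linear (gtens_compf n).
Proof. exact: tlift_linear (gtens_comp0_bilin n). Qed.
HB.instance Definition _ n := GRing.isLinear.Build K (tens A B) (tens A B) _
  (gtens_compf n) (gtens_compf_linear n).
Definition gtens_comp n : {linear tens A B -> tens A B} := gtens_compf n.

Lemma gtens_ind (P : tens A B -> Prop) :
  P 0 -> (forall x y, P x -> P y -> P (x + y)) ->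
  (forall i j a b, gm_comp A i a = a -> gm_comp B j b = b -> P (pure a b)) ->
  forall x, P x.
Proof.
move=> P0 PD Pp; apply: tens_ind => // a b.
rewrite (gm_boundP a) (gm_boundP b) (bilin_suml (pure_bilin _ _)).
apply: (big_ind P) => // i _; rewrite (bilin_sumr (pure_bilin _ _)).
apply: (big_ind P) => // j _.
by apply: (Pp i j); rewrite gm_compK eqxx.
Qed.

Lemma gtens_comp_pure n i j a b : gm_comp A i a = a -> gm_comp B j b = b ->
  gtens_comp n (pure a b) = if n == (i + j)%N then pure a b else 0.
Proof.
move=> ha hb; rewrite /= /gtens_compf tlift_pure; last exact: gtens_comp0_bilin.
rewrite /gtens_comp0 -{1}ha -{1}hb.
have E l : pure (gm_comp A l (gm_comp A i a)) (gm_comp B (n - l) (gm_comp B j b))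
    = if (l == i) && (n - l == j)%N then pure a b else 0.
  rewrite !gm_compK; case: eqP => [_|_] /=; last by rewrite (bilin0l (pure_bilin _ _)).
  by case: eqP => _; rewrite ?ha ?hb // (bilin0r (pure_bilin _ _)).
under eq_bigr do rewrite E.
case: eqP => [->|ne].
  have hi : (i < (i + j).+1)%N by rewrite ltnS leq_addr.
  rewrite (bigD1 (Ordinal hi)) //= eqxx addKn eqxx big1 ?addr0 //.
  by move=> l; rewrite -val_eqE /= => /negPf ->.
rewrite big1 // => l _; case: ifP => // /andP[/eqP li /eqP lj].
by case: ne; rewrite -li -lj subnKC // -ltnS.
Qed.

Fact gtens_compK i j x :
  gtens_comp i (gtens_comp j x) = if i == j then gtens_comp j x else 0.
Proof.
elim/gtens_ind: x => [|x y hx hy|p q a b ha hb].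
- by rewrite !linear0; case: eqP.
- by rewrite !linearD hx hy; case: eqP; rewrite ?addr0.
- rewrite !(gtens_comp_pure _ ha hb); case: (j =P _) => [->|_].
    by rewrite (gtens_comp_pure _ ha hb).
  by rewrite linear0; case: eqP.
Qed.

Fact gtens_sum x : exists N, x = \sum_(i < N) gtens_comp i x.
Proof.
suff [N hN] : exists N, forall M, (N <= M)%N -> x = \sum_(i < M) gtens_comp i x.
  by exists N; apply: hN.
elim/gtens_ind: x => [|x y [N hN] [N' hN']|p q a b ha hb].
- by exists 0%N => M _; rewrite big1 // => i _; rewrite linear0.
- exists (maxn N N') => M; rewrite geq_max => /andP[h h'].
  rewrite {1}(hN M h) {1}(hN' M h') -big_split; apply: eq_bigr => i _.
  by rewrite linearD.
- exists (p + q).+1 => M h; rewrite (bigD1 (Ordinal h)) //=.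
  rewrite [gtens_compf _ _](gtens_comp_pure _ ha hb) eqxx big1 ?addr0 //.
  move=> i; rewrite -val_eqE /= [gtens_compf _ _](gtens_comp_pure _ ha hb).
  by move=> /negPf ->.
Qed.

Definition gtens_mod : grmod K := GrMod gtens_compK gtens_sum.
End GrTensor.

Section GrTensorAlg.
Variables (K : comNzRingType) (A B : gralg K).

(* (a (x) b)(a' (x) b') is the sum over p, q of
   (-1)^(p q) (a a'_p) (x) (b_q b'). *)
Definition gtens_mul0 (a : A) (b : B) (a' : A) (b' : B) : tens A B :=
  gsum (fun p a'p =>
    gsum (fun q bq =>
      (-1) ^+ (p * q) *: pure (ga_mul a a'p) (ga_mul bq b')) b) a'.

Definition gtens_mul (x y : tens A B) : tens A B :=
  tlift (fun a b => tlift (gtens_mul0 a b) y) x.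

Let bA := ga_bilin A.
Let bB := ga_bilin B.
Let pbl := bilinDl (@pure_bilin K A B).
Let pbr := bilinDr (@pure_bilin K A B).
Let pzl := bilinZl (@pure_bilin K A B).
Let pzr := bilinZr (@pure_bilin K A B).

Let gin p a a'p b' : forall q : nat, linear (fun bq : B =>
  (-1) ^+ (p * q) *: pure (ga_mul a a'p) (ga_mul bq b') : tens A B).
Proof.
move=> q c x y; rewrite (bilinDl bB) (bilinZl bB) pbr pzr scalerDr.
by rewrite !scalerA mulrC.
Qed.

Let gout a b b' : forall p : nat, linear (fun a'p : A =>
  gsum (fun q bq =>
      (-1) ^+ (p * q) *: pure (ga_mul a a'p) (ga_mul bq b') : tens A B) b).
Proof.
move=> p; apply: gsum_linear_param => q y c u v.
rewrite (bilinDr bA) (bilinZr bA) pbl pzl scalerDr.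
by rewrite !scalerA mulrC.
Qed.

Fact gtens_mul0_bilin a b : bilin (gtens_mul0 a b).
Proof.
split=> [b'|a']; first exact: gsum_linear (gout a b b').
apply: gsum_linear_param => p y; apply: gsum_linear_param => q z c u v.
rewrite (bilinDr bB) (bilinZr bB) pbr pzr scalerDr.
by rewrite !scalerA mulrC.
Qed.

Fact gtens_mul0_bilin' a' b' : bilin (fun a b => gtens_mul0 a b a' b').
Proof.
split=> [b|a].
  apply: gsum_linear_param => p y; apply: gsum_linear_param => q z c u v.
  rewrite (bilinDl bA) (bilinZl bA) pbl pzl scalerDr.
  by rewrite !scalerA mulrC.
apply: gsum_linear_param => p y; exact: gsum_linear (gin p a y b').
Qed.

Fact gtens_mul1_bilin y : bilin (fun a b => tlift (gtens_mul0 a b) y).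
Proof.
split=> [b|a]; apply: tlift_param => u v.
  exact: (gtens_mul0_bilin' u v).1.
exact: (gtens_mul0_bilin' u v).2.
Qed.

Fact gtens_mul_bilin : bilin gtens_mul.
Proof.
split=> [y|x]; first exact: tlift_linear (gtens_mul1_bilin y).
move=> c y y'; rewrite /gtens_mul /tlift /tens_eval scaler_sumr -big_split /=.
by apply: eq_bigr => p _; exact: (tlift_linear (gtens_mul0_bilin _ _)).
Qed.

Lemma gtens_mul_pure q p a b a' b' :
  gm_comp B q b = b -> gm_comp A p a' = a' ->
  gtens_mul (pure a b) (pure a' b')
  = (-1) ^+ (p * q) *: pure (ga_mul a a') (ga_mul b b').
Proof.
move=> hb ha'; rewrite /gtens_mul tlift_pure; last exact: gtens_mul1_bilin.
rewrite tlift_pure; last exact: gtens_mul0_bilin.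
rewrite /gtens_mul0 (gsum_hom (gout a b b') ha').
by rewrite (gsum_hom (gin p a a' b') hb).
Qed.

Fact gtens_mulA : associative gtens_mul.
Proof.
have bm := gtens_mul_bilin.
move=> x y z.
elim/gtens_ind: x => [|x x' hx hx'|p q a b ha hb].
- by rewrite !(bilin0l bm).
- by rewrite !(bilinDl bm) hx hx'.
elim/gtens_ind: y => [|y y' hy hy'|p' q' a' b' ha' hb'].
- by rewrite !(bilin0l bm, bilin0r bm).
- by rewrite !(bilinDl bm, bilinDr bm) hy hy'.
elim/gtens_ind: z => [|z z' hz hz'|p2 q2 a2 b2 ha2 hb2].
- by rewrite !(bilin0r bm).
- by rewrite !(bilinDr bm) hz hz'.
rewrite (gtens_mul_pure _ _ hb ha') (gtens_mul_pure _ _ hb' ha2).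
rewrite (bilinZl bm) (bilinZr bm).
rewrite (gtens_mul_pure _ _ hb (ga_deg ha' ha2)).
rewrite (gtens_mul_pure _ _ (ga_deg hb hb') ha2).
rewrite !scalerA !ga_mulA -!exprD; congr (_ ^+ _ *: _).
by rewrite mulnDl mulnDr addnC -addnA.
Qed.

Fact gtens_deg i j x y :
  gm_comp (gtens_mod A B) i x = x -> gm_comp (gtens_mod A B) j y = y ->
  gm_comp (gtens_mod A B) (i + j) (gtens_mul x y) = gtens_mul x y.
Proof.
have bm := gtens_mul_bilin.
move=> <- <-; elim/gtens_ind: x => [|x x' hx hx'|p q a b ha hb].
- by rewrite !linear0 !(bilin0l bm) linear0.
- by rewrite !linearD !(bilinDl bm) linearD hx hx'.
elim/gtens_ind: y => [|y y' hy hy'|p' q' a' b' ha' hb'].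
- by rewrite !linear0 !(bilin0r bm) linear0.
- by rewrite ![gm_comp _ j (_ + _)]linearD !(bilinDr bm) linearD hy hy'.
rewrite [gm_comp _ i _](gtens_comp_pure _ ha hb).
rewrite [gm_comp _ j _](gtens_comp_pure _ ha' hb').
case: eqP => [->|_]; last by rewrite !(bilin0l bm) linear0.
case: eqP => [->|_]; last by rewrite !(bilin0r bm) linear0.
rewrite (gtens_mul_pure _ _ hb ha') linearZ /=; congr (_ *: _).
rewrite [LHS](gtens_comp_pure _ (ga_deg ha ha') (ga_deg hb hb')).
by rewrite addnACA eqxx.
Qed.

Definition gtens : gralg K := @GrAlg K (gtens_mod A B) gtens_mul gtens_mul_bilin gtens_mulA gtens_deg.
End GrTensorAlg.

(* [f] stands for the sum of the [f A *: e_A], where, for A = {a1 < ... < ap},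
   [e_A] is e_a1 /\ ... /\ e_ap. *)
Section Exterior.
Variables (K : comNzRingType) (n : nat).

Definition ext := {ffun {set 'I_n} -> K^o}.
HB.instance Definition _ := GRing.Lmodule.on ext.

(* e_A /\ e_B = (-1)^(inv A B) e_(A u B) when A and B are disjoint. *)
Definition inv (A B : {set 'I_n}) : nat :=
  \sum_(i in A) \sum_(j in B) (j < i)%N.

Definition ext_mul (f g : ext) : ext :=
  [ffun C : {set 'I_n} => \sum_(A : {set 'I_n} | A \subset C)
     (-1) ^+ inv A (C :\: A) * (f A * g (C :\: A))].

Definition ext_compf (p : nat) (f : ext) : ext :=
  [ffun A : {set 'I_n} => if #|A| == p then f A else 0].

Fact ext_compf_linear p : linear (ext_compf p).
Proof.
by move=> c f g; apply/ffunP => A; rewrite !ffunE; case: eqP; rewrite // scaler0 addr0.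
Qed.
HB.instance Definition _ p :=
  GRing.isLinear.Build K ext ext _ (ext_compf p) (ext_compf_linear p).
Definition ext_comp p : {linear ext -> ext} := ext_compf p.

Fact ext_compK i j x : ext_comp i (ext_comp j x) = if i == j then ext_comp j x else 0.
Proof.
apply/ffunP => A; case: eqP => [->|ne]; rewrite !ffunE; first by case: eqP.
by case: eqP => // ->; case: eqP.
Qed.

Fact ext_sum (x : ext) : exists N, x = \sum_(i < N) ext_comp i x.
Proof.
exists n.+1; apply/ffunP => A; rewrite sum_ffunE.
have h : (#|A| < n.+1)%N by rewrite ltnS -[X in (_ <= X)%N](card_ord n) max_card.
rewrite (bigD1 (Ordinal h)) //= !ffunE eqxx big1 ?addr0 // => i.
by rewrite -val_eqE ffunE /= eq_sym => /negPf ->.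
Qed.

Definition ext_mod : grmod K := GrMod ext_compK ext_sum.

Fact ext_mul_bilin : bilin (ext_mul : ext_mod -> ext_mod -> ext_mod).
Proof.
split=> h c f g; apply/ffunP => C; rewrite !ffunE /GRing.scale /= mulr_sumr -big_split /=;
apply: eq_bigr => A _; rewrite !ffunE /GRing.scale /=.
  by rewrite mulrDl mulrDr -mulrA mulrCA.
by rewrite !mulrDr (mulrCA (h _)) (mulrCA _ c).
Qed.

Lemma invUl (A B C : {set 'I_n}) : [disjoint A & B] ->
  inv (A :|: B) C = (inv A C + inv B C)%N.
Proof.
by move=> d; rewrite /inv -(bigU _ _ _ d); apply: eq_bigl => i; rewrite !inE.
Qed.

Lemma invUr (A B C : {set 'I_n}) : [disjoint A & B] ->
  inv C (A :|: B) = (inv C A + inv C B)%N.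
Proof.
move=> d; rewrite /inv -big_split; apply: eq_bigr => i _; rewrite /= -(bigU _ _ _ d).
by apply: eq_bigl => j; rewrite !inE.
Qed.

Lemma subset_setUD (A D : {set 'I_n}) : A \subset D -> A :|: D :\: A = D.
Proof.
move=> s; apply/setP=> i; rewrite !inE.
by case: (boolP (i \in A)) => //= /(subsetP s) ->.
Qed.

Fact ext_mulA : associative (ext_mul : ext_mod -> ext_mod -> ext_mod).
Proof.
move=> f g h; apply/ffunP => D; rewrite !ffunE.
pose F (A B : {set 'I_n}) : K :=
  (-1) ^+ (inv A B + inv A (D :\: (A :|: B)) + inv B (D :\: (A :|: B)))
  * (f A * g B * h (D :\: (A :|: B))).
transitivity (\sum_(A : {set 'I_n} | A \subset D)
    \sum_(B : {set 'I_n} | B \subset D :\: A) F A B).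
  apply: eq_bigr => A sA; rewrite ffunE mulr_sumr mulr_sumr; apply: eq_bigr => B sB.
  rewrite /F setDDl.
  have -> : D :\: A = B :|: (D :\: (A :|: B)).
    by rewrite -setDDl subset_setUD.
  rewrite invUr; last first.
    by rewrite disjoint_sym disjoints_subset; apply/subsetP=> i;
       rewrite !inE => /andP[/norP[_]].
  rewrite !exprD; rewrite -!mulrA; congr (_ * (_ * _)).
  by rewrite mulrCA.
rewrite [RHS](eq_bigr (fun C : {set 'I_n} => \sum_(A : {set 'I_n} | A \subset C)
    (-1) ^+ inv C (D :\: C) * ((-1) ^+ inv A (C :\: A) *
      (f A * g (C :\: A)) * h (D :\: C)))); last first.
  by move=> C _; rewrite ffunE mulr_suml mulr_sumr.
rewrite [RHS](exchange_big_dep (fun A : {set 'I_n} => A \subset D)) /=; last first.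
  by move=> C A sC sA; apply: subset_trans sA sC.
apply: eq_bigr => A sA.
rewrite [RHS](reindex_onto (fun B => A :|: B) (fun C => C :\: A)) /=; last first.
  by move=> C /andP[_ sC]; rewrite subset_setUD.
apply: eq_big => [B|B sB].
  rewrite subUset sA subsetUl /= andbT setDUl setDv set0U.
  rewrite subsetD disjoint_sym; congr (_ && _).
  apply/idP/eqP => [d|<-].
    by apply/setDidPl; rewrite disjoint_sym.
  by rewrite disjoints_subset; apply/subsetP=> i iA; rewrite !inE iA.
have dAB : [disjoint A & B] by move: sB; rewrite subsetD disjoint_sym => /andP[].
have -> : (A :|: B) :\: A = B.
  by rewrite setDUl setDv set0U; apply/setDidPl; rewrite disjoint_sym.
rewrite /F (invUl _ dAB) [RHS]mulrA [in RHS]mulrA -!exprD -!mulrA.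
by congr (_ ^+ _ * _); rewrite -addnA addnC.
Qed.

Fact ext_deg i j (a b : ext_mod) : gm_comp ext_mod i a = a ->
  gm_comp ext_mod j b = b -> gm_comp ext_mod (i + j) (ext_mul a b) = ext_mul a b.
Proof.
move=> <- <-; apply/ffunP => C; rewrite ffunE; case: eqP => // ne.
apply/esym; rewrite ffunE big1 // => A sA; rewrite !ffunE.
case: eqP => [hA|]; last by rewrite mul0r mulr0.
case: eqP => [hB|]; last by rewrite !mulr0.
by case: ne; rewrite -hA -hB -(cardsID A C) (setIidPr sA).
Qed.

Definition exterior : gralg K := GrAlg ext_mul_bilin ext_mulA ext_deg.

Definition ext_one : exterior := [ffun A : {set 'I_n} => (A == set0)%:R] : ext.

(* d e_A is the alternating sum of the y_i e_(A - i) for i in A; the sign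
   exponent counts the elements of B = A - i below i. *)
Definition koszul_d (y : 'I_n -> K) (f : exterior) : exterior :=
  [ffun B : {set 'I_n} => \sum_(i | i \notin B)
     (-1) ^+ inv [set i] B * (y i * (f : ext) (i |: B))] : ext.

End Exterior.

Section Positive.
Variables (K : comNzRingType) (A : gralg K).

Definition pos_pred : {pred A} := fun x => gm_comp A 0 x == 0.
Fact pos_submod : submod_closed pos_pred.
Proof.
split=> [|c x y]; rewrite !unfold_in ?linear0 // => /eqP hx /eqP hy.
by rewrite linearP hx hy scaler0 addr0.
Qed.
HB.instance Definition _ := GRing.isSubmodClosed.Build K A pos_pred pos_submod.

Record pos_sort := Pos { pos_val : A; _ : pos_pred pos_val }.
HB.instance Definition _ := [isSub for pos_val].
HB.instance Definition _ := [Choice of pos_sort by <:].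
HB.instance Definition _ := [SubChoice_isSubLmodule of pos_sort by <:].

Fact pos_val_linear : linear pos_val.
Proof. by move=> c x y; rewrite [LHS](linearP (val : pos_sort -> A)). Qed.

Fact pos_comp_subproof i (x : pos_sort) : pos_pred (gm_comp A i (pos_val x)).
Proof.
case: x => x /= /eqP hx; rewrite /pos_pred gm_compK.
by case: (0%N =P i) => [<-|_]; rewrite ?hx.
Qed.
Definition pos_compf i (x : pos_sort) : pos_sort := Pos (pos_comp_subproof i x).
Fact pos_compf_linear i : linear (pos_compf i).
Proof.
move=> c x y; apply: val_inj.
change (gm_comp A i (pos_val (c *: x + y))
        = pos_val (c *: pos_compf i x + pos_compf i y)).
by rewrite !pos_val_linear linearP.
Qed.
HB.instance Definition _ i := GRing.isLinear.Build K pos_sort pos_sort _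
  (pos_compf i) (pos_compf_linear i).
Definition pos_comp i : {linear pos_sort -> pos_sort} := pos_compf i.

Fact pos_compK i j x : pos_comp i (pos_comp j x) = if i == j then pos_comp j x else 0.
Proof. by apply: val_inj; rewrite /= gm_compK; case: (i =P j). Qed.
Lemma pos_val_sum N (F : 'I_N -> pos_sort) :
  pos_val (\sum_i F i) = \sum_i pos_val (F i).
Proof. exact: (linear_sum (val : {linear pos_sort -> A})). Qed.
Fact pos_sum x : exists N, x = \sum_(i < N) pos_comp i x.
Proof.
exists (gm_bound (pos_val x)); apply: val_inj.
by rewrite /= pos_val_sum; exact: gm_boundP.
Qed.
Definition pos_mod : grmod K := GrMod pos_compK pos_sum.

Fact pos_mul_subproof (x y : pos_sort) : pos_pred (ga_mul (pos_val x) (pos_val y)).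
Proof.
case: x y => x /= /eqP hx [y /= _]; apply/eqP; have bA := ga_bilin A.
rewrite (gm_boundP x) (gm_boundP y) (bilin_suml bA) linear_sum big1 // => i _.
rewrite (bilin_sumr bA) linear_sum big1 // => j _.
have [i0|ip] := posnP i; first by rewrite i0 hx (bilin0l bA) linear0.
rewrite -(@ga_deg _ A i j) ?gm_compK ?eqxx // .
by rewrite eq_sym addn_eq0 eqn0Ngt ip.
Qed.
Definition pos_mul (x y : pos_sort) : pos_sort := Pos (pos_mul_subproof x y).

Fact pos_mul_bilin : bilin (pos_mul : pos_mod -> pos_mod -> pos_mod).
Proof.
have bA := ga_bilin A.
split=> z c x y; apply: val_inj; rewrite [RHS]pos_val_linear /=.
  by rewrite [X in ga_mul X _]pos_val_linear bA.1.
by rewrite [X in ga_mul _ X]pos_val_linear bA.2.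
Qed.
Fact pos_mulA : associative (pos_mul : pos_mod -> pos_mod -> pos_mod).
Proof. by move=> x y z; apply: val_inj; exact: ga_mulA. Qed.
Fact pos_deg i j (a b : pos_mod) : gm_comp pos_mod i a = a ->
  gm_comp pos_mod j b = b -> gm_comp pos_mod (i + j) (pos_mul a b) = pos_mul a b.
Proof.
by move=> ha hb; apply: val_inj; apply: ga_deg; [rewrite -{2}ha | rewrite -{2}hb].
Qed.

Definition pos : gralg K := GrAlg pos_mul_bilin pos_mulA pos_deg.
End Positive.

Section Product.
Variables (K : comNzRingType) (A B : grmod K).
Definition prod_compf i (x : A * B) : A * B := (gm_comp A i x.1, gm_comp B i x.2).
Fact prod_compf_linear i : linear (prod_compf i).
Proof. by move=> c x y; rewrite /prod_compf !linearP. Qed.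
HB.instance Definition _ i := GRing.isLinear.Build K (A * B)%type (A * B)%type _
  (prod_compf i) (prod_compf_linear i).
Definition prod_comp i : {linear (A * B)%type -> (A * B)%type} := prod_compf i.
Fact prod_compK i j x : prod_comp i (prod_comp j x) = if i == j then prod_comp j x else 0.
Proof. by rewrite /= /prod_compf /= !gm_compK; case: eqP. Qed.
Fact prod_sum x : exists N, x = \sum_(i < N) prod_comp i x.
Proof.
exists (maxn (gm_bound x.1) (gm_bound x.2)).
have h1 := gsumE (F := fun _ => id) (fun _ => fun _ _ _ => erefl) (leq_maxl (gm_bound x.1) (gm_bound x.2)).
have h2 := gsumE (F := fun _ => id) (fun _ => fun _ _ _ => erefl) (leq_maxr (gm_bound x.1) (gm_bound x.2)).
case: x h1 h2 => x y /= h1 h2.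
rewrite [RHS]surjective_pairing; congr (_, _).
  by rewrite (linear_sum fst) /= -h1; exact: gm_boundP.
by rewrite (linear_sum snd) /= -h2; exact: gm_boundP.
Qed.
Definition prod_mod : grmod K := GrMod prod_compK prod_sum.
End Product.

Section ProductAlg.
Variables (K : comNzRingType) (A B : gralg K).
Definition gprod_mul (x y : prod_mod A B) : prod_mod A B :=
  (ga_mul x.1 y.1, ga_mul x.2 y.2).
Fact gprod_mul_bilin : bilin gprod_mul.
Proof.
have bA := ga_bilin A; have bB := ga_bilin B.
by split=> z c x y; rewrite /gprod_mul /= (bA.1, bA.2) (bB.1, bB.2).
Qed.
Fact gprod_mulA : associative gprod_mul.
Proof. by move=> x y z; rewrite /gprod_mul /= !ga_mulA. Qed.
Fact gprod_deg i j (a b : prod_mod A B) : gm_comp (prod_mod A B) i a = a ->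
  gm_comp (prod_mod A B) j b = b ->
  gm_comp (prod_mod A B) (i + j) (gprod_mul a b) = gprod_mul a b.
Proof.
case: a b => a a' [b b'] [ha ha'] [hb hb'].
by rewrite /= /prod_compf /= !ga_deg.
Qed.
Definition gprod : gralg K := GrAlg gprod_mul_bilin gprod_mulA gprod_deg.
End ProductAlg.

Section Quotient.
Variables (K : comNzRingType) (L : grmod K) (P : L -> Prop).
Hypothesis P0 : P 0.
Hypothesis Plin : forall c x y, P x -> P y -> P (c *: x + y).
Hypothesis Pcomp : forall i x, P x -> P (gm_comp L i x).

Definition gquot_rel : rel L := fun x y => `[< P (x - y) >].

Fact gquot_rel_equiv : equiv_class_of gquot_rel.
Proof.
have PN x y : P (x - y) -> P (y - x).
  by move=> h; have := Plin (-1) h P0; rewrite addr0 scaleN1r opprB.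
split=> [x|x y|y x z]; first by apply/asboolP; rewrite subrr.
- by apply/asboolP/asboolP; exact: PN.
- move=> /asboolP h1 /asboolP h2; apply/asboolP.
  by have := Plin 1 h1 h2; rewrite scale1r addrA subrK.
Qed.
Canonical gquot_equiv := EquivRelPack gquot_rel_equiv.
Canonical gquot_encModRel := defaultEncModRel gquot_rel.

Definition gquot_sort := {eq_quot gquot_rel}.
HB.instance Definition _ := Choice.on gquot_sort.
HB.instance Definition _ : EqQuotient _ gquot_rel gquot_sort :=
  EqQuotient.on gquot_sort.

Definition gquot_pi (x : L) : gquot_sort := \pi_gquot_sort x.

Lemma gquot_piP x y : gquot_pi x = gquot_pi y <-> P (x - y).
Proof. by split=> [/eqmodP/asboolP|h] //; apply/eqmodP/asboolP. Qed.
Lemma gquot_reprK (x : gquot_sort) : gquot_pi (repr x) = x.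
Proof. exact: reprK. Qed.
Lemma gquot_surj x : exists v, x = gquot_pi v.
Proof. by exists (repr x); rewrite gquot_reprK. Qed.

Definition gquot_add (x y : gquot_sort) := gquot_pi (repr x + repr y).
Definition gquot_scale (c : K) (x : gquot_sort) := gquot_pi (c *: repr x).
Definition gquot_opp := gquot_scale (-1).

Lemma gquot_reprP x : P (repr (gquot_pi x) - x).
Proof. by apply/gquot_piP; rewrite gquot_reprK. Qed.
Lemma gquot_addE x y : gquot_add (gquot_pi x) (gquot_pi y) = gquot_pi (x + y).
Proof.
apply/gquot_piP; rewrite opprD addrACA.
by have := Plin 1 (gquot_reprP x) (gquot_reprP y); rewrite scale1r.
Qed.
Lemma gquot_scaleE c x : gquot_scale c (gquot_pi x) = gquot_pi (c *: x).
Proof.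
apply/gquot_piP; rewrite -scalerBr.
by have := Plin c (gquot_reprP x) P0; rewrite addr0.
Qed.

Fact gquot_addA : associative gquot_add.
Proof.
move=> x y z; have [u ->] := gquot_surj x; have [v ->] := gquot_surj y.
by have [w ->] := gquot_surj z; rewrite !gquot_addE addrA.
Qed.
Fact gquot_addC : commutative gquot_add.
Proof. by move=> x y; rewrite /gquot_add addrC. Qed.
Fact gquot_add0 : left_id (gquot_pi 0) gquot_add.
Proof. by move=> x; have [u ->] := gquot_surj x; rewrite gquot_addE add0r. Qed.
Fact gquot_addN : left_inverse (gquot_pi 0) gquot_opp gquot_add.
Proof.
move=> x; have [u ->] := gquot_surj x.
by rewrite [gquot_opp _]gquot_scaleE gquot_addE scaleN1r addNr.
Qed.
HB.instance Definition _ :=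
  GRing.isZmodule.Build gquot_sort gquot_addA gquot_addC gquot_add0 gquot_addN.

Lemma gquot_piD x y : gquot_pi (x + y) = gquot_pi x + gquot_pi y.
Proof. by rewrite -gquot_addE. Qed.

Fact gquot_scaleA a b v : gquot_scale a (gquot_scale b v) = gquot_scale (a * b) v.
Proof. by have [u ->] := gquot_surj v; rewrite !gquot_scaleE scalerA. Qed.
Fact gquot_scale1 : left_id 1 gquot_scale.
Proof. by move=> v; have [u ->] := gquot_surj v; rewrite gquot_scaleE scale1r. Qed.
Fact gquot_scaleDr : right_distributive gquot_scale +%R.
Proof.
move=> c v w; have [u ->] := gquot_surj v; have [u' ->] := gquot_surj w.
by rewrite -gquot_piD !gquot_scaleE scalerDr gquot_piD.
Qed.
Fact gquot_scaleDl v : {morph gquot_scale^~ v : a b / a + b}.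
Proof.
by move=> a b; have [u ->] := gquot_surj v; rewrite !gquot_scaleE scalerDl gquot_piD.
Qed.
HB.instance Definition _ := GRing.Zmodule_isLmodule.Build K gquot_sort
  gquot_scaleA gquot_scale1 gquot_scaleDr gquot_scaleDl.

Lemma gquot_pi_linear : linear gquot_pi.
Proof. by move=> c x y; rewrite gquot_piD -gquot_scaleE. Qed.
HB.instance Definition _ :=
  GRing.isLinear.Build K L gquot_sort _ gquot_pi gquot_pi_linear.

Definition gquot_compf i (x : gquot_sort) : gquot_sort :=
  gquot_pi (gm_comp L i (repr x)).
Lemma gquot_compE i x : gquot_compf i (gquot_pi x) = gquot_pi (gm_comp L i x).
Proof.
by apply/gquot_piP; rewrite -linearB; apply: Pcomp; exact: gquot_reprP.
Qed.
Fact gquot_compf_linear i : linear (gquot_compf i).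
Proof.
move=> c v w; have [u ->] := gquot_surj v; have [u' ->] := gquot_surj w.
by rewrite -gquot_pi_linear !gquot_compE !linearP.
Qed.
HB.instance Definition _ i := GRing.isLinear.Build K gquot_sort gquot_sort _
  (gquot_compf i) (gquot_compf_linear i).
Definition gquot_comp i : {linear gquot_sort -> gquot_sort} := gquot_compf i.
Fact gquot_compK i j x : gquot_comp i (gquot_comp j x) = if i == j then gquot_comp j x else 0.
Proof.
have [u ->] := gquot_surj x; rewrite /= !gquot_compE gm_compK.
by case: eqP => _ //; rewrite linear0.
Qed.
Fact gquot_sum x : exists N, x = \sum_(i < N) gquot_comp i x.
Proof.
have [u ->] := gquot_surj x; exists (gm_bound u).
rewrite {1}(gm_boundP u) linear_sum; apply: eq_bigr => i _.
by rewrite /= gquot_compE.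
Qed.
Definition gquot : grmod K := GrMod gquot_compK gquot_sum.
End Quotient.

(* The shift (Sigma^-1 L)_i = L_(i+1); it is again non-negatively graded when
   L_0 = 0. *)
Section Desuspension.
Variables (K : comNzRingType) (L : grmod K).
Hypothesis L0 : forall x, gm_comp L 0 x = 0.
Fact desusp_compK i j x : gm_comp L i.+1 (gm_comp L j.+1 x)
  = if i == j then gm_comp L j.+1 x else 0.
Proof. by rewrite gm_compK eqSS. Qed.
Fact desusp_sum x : exists N, x = \sum_(i < N) gm_comp L i.+1 x.
Proof.
exists (gm_bound x).
have h := gsumE (F := fun _ => id) (fun _ => fun _ _ _ => erefl) (leqnSn (gm_bound x)).
by rewrite {1}(gm_boundP x) [LHS]h big_ord_recl /= L0 add0r.
Qed.
Definition desusp : grmod K :=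
  @GrMod K L (fun i => gm_comp L i.+1) desusp_compK desusp_sum.
End Desuspension.

Section TrivialExtension.
Variables (K : comNzRingType) (A : gralg K) (L : grmod K).

(* (a, l)(a', l') = (a a', a l' + (-1)^(|l||a'|) a' l), extended bilinearly *)
Definition trivext_mul (act : A -> L -> L) (x y : prod_mod A L) : prod_mod A L :=
  (ga_mul x.1 y.1,
   act x.1 y.2 +
   gsum (fun p a' => gsum (fun q l => (-1) ^+ (q * p) *: act a' l) x.2) y.1).

Let mul0 := trivext_mul (fun _ _ => 0).
Let mul0E x y : mul0 x y = (ga_mul x.1 y.1, 0).
Proof.
rewrite /mul0 /trivext_mul add0r; congr (_, _); rewrite /gsum big1 // => i _.
by rewrite big1 // => j _; rewrite scaler0.
Qed.
Fact trivext0_bilin : bilin mul0.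
Proof.
have bA := ga_bilin A.
by split=> z c x y; rewrite !mul0E (bA.1, bA.2); congr (_, _); rewrite /= scaler0 addr0.
Qed.
Fact trivext0_mulA : associative mul0.
Proof. by move=> x y z; rewrite !mul0E /= ga_mulA. Qed.
Fact trivext0_deg i j (a b : prod_mod A L) : gm_comp (prod_mod A L) i a = a ->
  gm_comp (prod_mod A L) j b = b -> gm_comp (prod_mod A L) (i + j) (mul0 a b) = mul0 a b.
Proof.
case: a b => a a' [b b'] [ha ha'] [hb hb']; rewrite mul0E.
by rewrite /= /prod_compf /= ga_deg // linear0.
Qed.

(* A |x L, where A acts on L by zero *)
Definition trivext0 : gralg K := GrAlg trivext0_bilin trivext0_mulA trivext0_deg.
End TrivialExtension.

Section W.
Variables (k : fieldType) (t s : nat).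
Let T := gtens_mod (exterior k t) (exterior k s).

(* k (x) /\k^s + /\k^t (x) k *)
Definition W_sub (x : T) : Prop :=
  exists (u : exterior k t) (v : exterior k s),
    x = pure (ext_one k t) v + pure u (ext_one k s).

Let bp := @pure_bilin k (exterior k t) (exterior k s).

Fact W_sub0 : W_sub 0.
Proof. by exists 0, 0; rewrite (bilin0l bp) (bilin0r bp) addr0. Qed.
Fact W_sub_lin c x y : W_sub x -> W_sub y -> W_sub (c *: x + y).
Proof.
move=> [u [v ->]] [u' [v' ->]]; exists (c *: u + u'), (c *: v + v').
by rewrite bp.1 bp.2 scalerDr addrACA.
Qed.

Lemma ext_one_comp n i : gm_comp (exterior k n) i (ext_one k n)
  = if i == 0 then ext_one k n else 0.
Proof.
apply/ffunP => A; rewrite !ffunE; case: (i =P 0%N) => [->|ne].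
  by rewrite cards_eq0; case: eqP => [->|]; rewrite !ffunE ?eqxx //; case: eqP.
rewrite !ffunE; case: eqP => // hA; case: eqP => // A0.
by case: ne; rewrite -hA A0 cards0.
Qed.

Fact W_comp i x : W_sub x -> W_sub (gm_comp T i x).
Proof.
move=> [u [v ->]].
exists (gm_comp (exterior k t) i u), (gm_comp (exterior k s) i v).
rewrite linearD /= /gtens_compf !(tlift_pure _ _ (gtens_comp0_bilin _ _ i)).
congr (_ + _); rewrite /gtens_comp0.
  rewrite big_ord_recl ext_one_comp eqxx subn0 big1 ?addr0 //.
  by move=> j _; rewrite ext_one_comp (bilin0l bp).
rewrite big_ord_recr ext_one_comp subnn eqxx big1 => [|j _].
  by rewrite [LHS]add0r.
by rewrite ext_one_comp subn_eq0 leqNgt /= ltn_ord (bilin0r bp).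
Qed.

Definition W_quot : grmod k := gquot W_sub0 W_sub_lin W_comp.

Fact W_quot0 x : gm_comp W_quot 0 x = 0.
Proof.
have [u ->] := gquot_surj x.
rewrite [LHS](gquot_compE _ _ W_comp); apply/gquot_piP; rewrite subr0.
elim/tens_ind: u => [|y z hy hz|a b]; first by rewrite linear0; exact: W_sub0.
  by rewrite linearD -[X in W_sub (X + _)]scale1r; exact: W_sub_lin.
exists 0, ((a : ext k t) set0 *: gm_comp (exterior k s) 0 b).
rewrite (bilin0l bp) addr0 (bilinZr bp) -(bilinZl bp).
rewrite /= /gtens_compf (tlift_pure _ _ (gtens_comp0_bilin _ _ _)) /gtens_comp0 big_ord1.
congr (pure _ _); apply/ffunP => A; rewrite !ffunE /GRing.scale /= cards_eq0.
by case: eqP => [->|_]; rewrite ?mulr1 ?mulr0.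
Qed.

Definition W : grmod k := desusp W_quot0.
End W.

Section Rings.
Variable S : comNzRingType.

Definition gen_ideal n (x : 'I_n -> S) (z : S) : Prop :=
  exists c : 'I_n -> S, z = \sum_i c i * x i.

(* x generates the ideal P, and no term of x can be removed *)
Definition min_gen (P : S -> Prop) n (x : 'I_n -> S) : Prop :=
  (forall z, P z <-> gen_ideal x z) /\
  (forall i, ~ exists2 c : 'I_n -> S, c i = 0 & x i = \sum_j c j * x j).

(* the n-th power of the ideal generated by P *)
Definition ideal_pow (P : S -> Prop) n (z : S) : Prop :=
  exists N (c : 'I_N -> S) (a : 'I_N -> 'I_n -> S),
    (forall i j, P (a i j)) /\ z = \sum_i c i * \prod_j a i j.

Definition noetherian : Prop :=
  forall I : idealr S, exists n (x : 'I_n -> S), forall z, z \in I <-> gen_ideal x z.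

(* S is complete and separated for the (P)-adic topology *)
Definition adic_complete (P : S -> Prop) : Prop :=
  (forall z, (forall n, ideal_pow P n z) -> z = 0) /\
  (forall u : nat -> S, (forall n, ideal_pow P n (u n.+1 - u n)) ->
     exists l, forall n, ideal_pow P n (u n - l)).

Definition krull_dim (n : nat) : Prop :=
  let chain m (p : 'I_m.+1 -> prime_idealr S) :=
    forall i j : 'I_m.+1, (i < j)%N ->
      {subset p i <= p j} /\ ~ {subset p j <= p i} in
  (exists p, chain n p) /\ (forall p, ~ chain n.+1 p).

Variables (k : fieldType) (rho : {rmorphism S -> k}).

Definition max_ideal (x : S) : Prop := rho x = 0.

(* (S, ker rho, k) is a noetherian local ring with residue map rho *)
Definition noetherian_local : Prop :=
  [/\ forall c, exists x, rho x = c,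
      forall x, rho x <> 0 -> exists y, x * y = 1
    & noetherian].

Definition regular_local (n : nat) : Prop :=
  [/\ noetherian_local, krull_dim n
    & exists x : 'I_n -> S, forall z, max_ideal z <-> gen_ideal x z].

End Rings.

(* c : S -> S' is the completion of S at its maximal ideal: S' is complete for
   the topology defined by the extension of the maximal ideal, c has dense image
   and the topology induced on S is the original one. *)
Definition is_completion (S S' : comNzRingType) (k : fieldType)
    (rho : {rmorphism S -> k}) (c : {rmorphism S -> S'}) : Prop :=
  let M y := exists2 x, max_ideal rho x & y = c x in
  [/\ adic_complete M,
      forall n y, exists x, ideal_pow M n (y - c x)
    & forall n x, ideal_pow M n (c x) <-> ideal_pow (max_ideal rho) n x].

(* The graded k-algebra A is the homology algebra of the DG B-algebra (E, d),
   with k acting through pi : Q -> B and the surjection rho : Q -> k. The map cl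
   sends a cycle to its class; its values outside cycles are irrelevant. *)
Definition is_homology (B : comNzRingType) (E : gralg B) (d : E -> E)
    (Q : comNzRingType) (k : fieldType) (pi : {rmorphism Q -> B})
    (rho : {rmorphism Q -> k}) (A : gralg k) : Prop :=
  exists cl : E -> A,
  [/\ forall a, exists2 z, d z = 0 & cl z = a,
      forall z, d z = 0 -> (cl z = 0 <-> exists w, z = d w),
      forall q z w, d z = 0 -> d w = 0 ->
        cl (pi q *: z + w) = rho q *: cl z + cl w,
      forall z w, d z = 0 -> d w = 0 -> cl (ga_mul z w) = ga_mul (cl z) (cl w)
    & forall i z, d z = 0 -> cl (gm_comp E i z) = gm_comp A i (cl z)].

(* The Koszul complex of x over Q is a resolution of k: H_0 = Q/(x) is k and the
   homology vanishes in positive degrees. *)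
Definition koszul_resolution (Q : comNzRingType) (k : fieldType)
    (rho : {rmorphism Q -> k}) n (x : 'I_n -> Q) : Prop :=
  (forall z, max_ideal rho z <-> gen_ideal x z) /\
  (forall i z, (0 < i)%N -> gm_comp (exterior Q n) i z = z ->
     koszul_d x z = 0 -> exists w, z = koszul_d x w).

(* A is Tor^Q(k, B) for a Q-algebra B. It is computed with a resolution of k by
   a Koszul complex K, which exists when Q is regular local; this is a DG
   algebra resolution, so that Tor^Q(k, B) is the algebra H(K (x)_Q B), and
   K (x)_Q B is the Koszul complex over B of the image of x. *)
Definition is_Tor (Q : comNzRingType) (k : fieldType) (rho : {rmorphism Q -> k})
    (B : comNzRingType) (pi : {rmorphism Q -> B}) (A : gralg k) : Prop :=
  exists n (x : 'I_n -> Q), koszul_resolution rho x /\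
    is_homology (koszul_d (pi \o x)) pi rho A.

(* c : S -> S' is the completion of S and pi : Q -> S' is onto, with Q a complete
   regular local ring of dimension the embedding dimension of S, and kernel
   contained in the square of the maximal ideal of Q; the residue fields of S and
   Q are identified through c and pi. *)
Definition minimal_Cohen_presentation (S S' Q : comNzRingType) (k : fieldType)
    (rho : {rmorphism S -> k}) (c : {rmorphism S -> S'})
    (rhoQ : {rmorphism Q -> k}) (pi : {rmorphism Q -> S'}) : Prop :=
  is_completion rho c /\
  exists n (y : 'I_n -> S),
  [/\ min_gen (max_ideal rho) y,
      regular_local rhoQ n /\ adic_complete (max_ideal rhoQ),
      forall z, exists q, pi q = z,
      forall q, pi q = 0 -> ideal_pow (max_ideal rhoQ) 2 q
    & forall x q, c x = pi q -> rho x = rhoQ q].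

(* A is (a model of) the Tor algebra A_S of the local ring S. *)
Definition is_Tor_algebra (S : comNzRingType) (k : fieldType)
    (rho : {rmorphism S -> k}) (A : gralg k) : Prop :=
  exists (S' Q : comNzRingType) (c : {rmorphism S -> S'})
    (rhoQ : {rmorphism Q -> k}) (pi : {rmorphism Q -> S'}),
  minimal_Cohen_presentation rho c rhoQ pi /\ is_Tor rhoQ pi A.

(* A = k (+) A^+, where k = k u for a unity u of A, of degree 0 *)
Definition connected (k : fieldType) (A : gralg k) : Prop :=
  exists u : A,
  [/\ forall a, ga_mul u a = a /\ ga_mul a u = a,
      gm_comp A 0 u = u
    & forall a, exists! p : k * pos A, a = p.1 *: u + pos_val p.2].

(* Main.v *)
(* By Artin-Rees, completion does not change Koszul homology, and two minimal
   generating sequences of the maximal ideal give isomorphic Koszul complexes; so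
   A_S is the homology of the Koszul complex of any minimal generating sequence of
   the maximal ideal of S.

   Let K be the Koszul complex of y = (x1, x2) over R, with basis the e_C, where C is
   the union of A in {1..t} and B in {1..s}. A cycle z of positive degree has
   coefficients in m = I (+) J, and IJ = 0. Modulo I, where x1 vanishes, it becomes a
   cycle of /\k^t (x) K(x2; R/I), and modulo J a cycle of K(x1; R/J) (x) /\k^s; the
   two classes give the components in the product.

   The component in W compares two retractions of the differential. If l is in C,
   the coordinate on y_l of the class in m/m^2 of the coefficient of e_(C - l) in d w
   is, up to sign, the residue of the coefficient w_C. Applied to a cycle z, this
   coordinate depends only on z mod I if l indexes x2, and only on z mod J if l
   indexes x1. For A and B nonempty, the difference of a retraction of the first
   kind and one of the second kind vanishes on boundaries, and on products of cycles
   since their coefficients are in m^2; this is why the extension by W splits as an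
   extension of algebras. If all three components of z vanish then z is d v modulo I
   and d v' modulo J with v_C = v'_C in k for A and B nonempty, so that v and v' can
   be glued to some w with z = d w. *)
From HB Require Import structures.
From mathcomp Require Import all_boot all_algebra.
From mathcomp Require Import boolp.
From mathcomp Require Import ring.
Require Import Defs.
Set Implicit Arguments.
Unset Strict Implicit.
Unset Printing Implicit Defensive.
Import GRing.Theory.
Local Open Scope ring_scope.
Local Open Scope quotient_scope.

(** * Exterior algebras and Koszul complexes *)

(** Two transfers shape the argument. From the completion back to [S], a cycle over [S'] can only be
    approximated, and the approximation over [S] is no longer a cycle. Its boundary is small, so
    Artin-Rees for the submodule of boundaries provides a small correction that restores the cycle
    condition; the two cycles then differ by a small cycle. Since multiplication by each [y i] is
    null-homotopic, the maximal ideal annihilates homology, and Artin-Rees for the submodule of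
    cycles turns small cycles into boundaries. From R/I and R/J to R, everything rests on R being
    the fiber product of the quotients over k: it embeds in their product, and elements with the
    same residue have a common lift. Elements of residue 0 lift independently, which realises the
    three components separately. Primitives over R/I and R/J glue only where their residues agree,
    and W is that obstruction. Only pairs of nonempty sets count: over R/I the differential does not
    see the coefficients w_C with C disjoint from the indices of x2, and likewise over R/J for
    x1. *)

Lemma mulr_sign_sign (K : comNzRingType) m (a b : K) :
  (-1) ^+ m * (a * ((-1) ^+ m * b)) = a * b.
Proof. by rewrite mulrCA [X in _ * X]mulrA -exprD addnn -signr_odd odd_double mul1r. Qed.

Arguments ga_mul : simpl never.
Arguments gm_comp : simpl never.

Section ExteriorCalculus.
Variables (K : comNzRingType) (n : nat).
Implicit Types (f g h : exterior K n) (A B C : {set 'I_n}).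

Definition ext_coef A f : K^o := (f : ext K n) A.

Fact ext_coef_linear A : linear (ext_coef A).
Proof. by move=> c f g; rewrite /ext_coef !ffunE. Qed.
HB.instance Definition _ A :=
  GRing.isLinear.Build K (exterior K n) K^o _ (ext_coef A) (ext_coef_linear A).

Lemma ext_coefP f g : (forall A, ext_coef A f = ext_coef A g) -> f = g.
Proof. by move=> h; apply/ffunP. Qed.

Definition ext_of (F : {set 'I_n} -> K) : exterior K n := [ffun A => F A] : ext K n.

Lemma coef_ext_of F A : ext_coef A (ext_of F) = F A.
Proof. by rewrite /ext_coef ffunE. Qed.

Definition ext_basis A : exterior K n := ext_of (fun B => (B == A)%:R).

Lemma coef_basis A B : ext_coef B (ext_basis A) = (B == A)%:R.
Proof. exact: coef_ext_of. Qed.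

Lemma ext_expand f : f = \sum_A ext_coef A f *: ext_basis A.
Proof.
apply: ext_coefP => B; rewrite linear_sum (bigD1 B) //= linearZ /= coef_basis eqxx.
rewrite [X in X + _]mulr1 big1 ?addr0 // => A ne; rewrite linearZ /= coef_basis.
by rewrite eq_sym (negPf ne); exact: mulr0.
Qed.

Lemma coef_comp A p f :
  ext_coef A (gm_comp (exterior K n) p f) = if #|A| == p then ext_coef A f else 0.
Proof. by rewrite /ext_coef ffunE. Qed.

Lemma coef_mul C f g : ext_coef C (ga_mul f g) =
  \sum_(A : {set 'I_n} | A \subset C)
    (-1) ^+ inv A (C :\: A) * (ext_coef A f * ext_coef (C :\: A) g).
Proof. by rewrite /ext_coef ffunE. Qed.

Lemma coef_koszul y B f : ext_coef B (koszul_d y f) =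
  \sum_(i | i \notin B) (-1) ^+ inv [set i] B * (y i * ext_coef (i |: B) f).
Proof. by rewrite /ext_coef ffunE. Qed.

Lemma ext_one_basis : ext_one K n = ext_basis set0.
Proof. by []. Qed.

Lemma inv0l B : inv set0 B = 0%N :> nat.
Proof. by rewrite /inv big_set0. Qed.
Lemma inv0r A : inv A set0 = 0%N :> nat.
Proof. by rewrite /inv big1 // => i _; rewrite big_set0. Qed.
Lemma inv1l i B : inv [set i] B = (\sum_(j in B) (j < i))%N.
Proof. by rewrite /inv big_set1. Qed.

Lemma coef_mul_basis C A g : ext_coef C (ga_mul (ext_basis A) g) =
  if A \subset C then (-1) ^+ inv A (C :\: A) * ext_coef (C :\: A) g else 0.
Proof.
rewrite coef_mul; case: ifP => sA.
  rewrite (bigD1 A) //= coef_basis eqxx mul1r big1 ?addr0 // => B /andP[_ ne].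
  by rewrite coef_basis (negPf ne) mul0r mulr0.
rewrite big1 // => B sB; rewrite coef_basis.
by case: eqP sA => [<-|_ _]; rewrite ?sB // mul0r mulr0.
Qed.

Lemma ext_mul1 f : ga_mul (ext_one K n) f = f.
Proof.
by apply: ext_coefP => C; rewrite ext_one_basis coef_mul_basis sub0set setD0 inv0l mul1r.
Qed.

Lemma ext_mulr1 f : ga_mul f (ext_one K n) = f.
Proof.
apply: ext_coefP => C; rewrite coef_mul (bigD1 C) //= setDv inv0r mul1r.
rewrite ext_one_basis coef_basis eqxx mulr1 big1 ?addr0 // => B /andP[sB ne].
rewrite coef_basis setD_eq0; case: (boolP (C \subset B)) => sC; last by rewrite !mulr0.
by move: ne; rewrite eqEsubset sB sC.
Qed.

Lemma comp_basis A : gm_comp (exterior K n) #|A| (ext_basis A) = ext_basis A.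
Proof.
apply: ext_coefP => B; rewrite coef_comp coef_basis.
by case: (B =P A) => [->|_]; rewrite ?eqxx ?if_same.
Qed.

Lemma comp_one p : gm_comp (exterior K n) p (ext_one K n) = if p == 0%N then ext_one K n else 0.
Proof.
apply: ext_coefP => A; rewrite coef_comp ext_one_basis coef_basis.
case: (p =P 0%N) => [->|/eqP ne]; rewrite ?coef_basis ?linear0 ?cards_eq0.
  by case: eqP.
by case: (A =P set0) => [->|_]; rewrite ?cards0 1?eq_sym ?(negPf ne) //; case: eqP.
Qed.

(** Left multiplication by generators reaches every basis element from 1, up to sign. Identities
    about derivations and algebra maps then need checking only on 1 and on a product by one
    generator. *)
Lemma ext_ind (P : exterior K n -> Prop) :
  P 0 -> (forall c f g, P f -> P g -> P (c *: f + g)) -> P (ext_one K n) ->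
  (forall i f, P f -> P (ga_mul (ext_basis [set i]) f)) -> forall f, P f.
Proof.
move=> P0 Plin P1 Pe f; rewrite (ext_expand f).
apply: (big_ind P) => // [a b ha hb|A _].
  by rewrite -[a]scale1r; exact: Plin.
rewrite -[_ *: _]addr0; apply: (Plin) => //.
move: {2}(#|A|) (erefl #|A|) => p; elim: p A => [|p IH] A hA.
  by move/eqP: hA; rewrite cards_eq0 => /eqP ->.
have [i iA] : exists i, i \in A by apply/set0Pn; rewrite -cards_eq0 hA.
have cA : #|A :\ i| = p by move: hA; rewrite (cardsD1 i) iA => -[].
have := Pe i _ (IH _ cA); move/(Plin ((-1) ^+ inv [set i] (A :\ i)))/(_ P0).
rewrite addr0; congr P; apply: ext_coefP => C; rewrite linearZ /= coef_mul_basis.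
rewrite sub1set !coef_basis; case: (C =P A) => [->|ne].
  by rewrite iA eqxx mulr1 /GRing.scale /= -exprD addnn -signr_odd odd_double.
case: ifP => iC; last exact: mulr0.
case: eqP => [h|_]; last by rewrite mulr0; exact: mulr0.
by case: ne; rewrite -(setD1K iC) h setD1K.
Qed.

Variable y : 'I_n -> K.
Local Notation d := (koszul_d y).

Fact koszul_linear : linear d.
Proof.
move=> c f g; apply: ext_coefP => B; rewrite linearP /= !coef_koszul.
rewrite /GRing.scale /= mulr_sumr -big_split; apply: eq_bigr => i _ /=.
by rewrite linearP /= /GRing.scale /= !mulrDr (mulrCA (y i)) (mulrCA _ c).
Qed.

HB.instance Definition _ :=
  GRing.isLinear.Build K (exterior K n) (exterior K n) _ (koszul_d y) koszul_linear.

Lemma inv_anticomm (i j : 'I_n) : i != j ->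
  (inv [set i] [set j] + inv [set j] [set i] = 1)%N.
Proof. by rewrite !inv1l !big_set1 -val_eqE; case: ltngtP. Qed.

(** The Leibniz rule for one generator, from which [koszul_sq] and [koszul_mul] follow by [ext_ind].
    At B not containing i only the term of i survives. At B containing i, the term of i in [d f]
    cancels [y i *: f], and the other terms change sign by [inv_anticomm]. *)
Lemma koszul_gen_mul i f :
  d (ga_mul (ext_basis [set i]) f) = y i *: f - ga_mul (ext_basis [set i]) (d f).
Proof.
apply: ext_coefP => B; rewrite linearB linearZ /= coef_koszul !coef_mul_basis sub1set.
have [iB|iB] := boolP (i \in B); last first.
  rewrite subr0 (bigD1 i) //= coef_mul_basis sub1set setU11 setU1K //.
  rewrite mulr_sign_sign big1 ?addr0 //.
  move=> j /andP[jB ji]; rewrite coef_mul_basis sub1set in_setU1 eq_sym (negPf ji).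
  by rewrite (negPf iB) !mulr0.
rewrite coef_koszul [in RHS](bigD1 i) ?setD11 //= setD1K // mulrDr.
rewrite signrMK opprD addrA [X in X - _]addrN sub0r -mulrN -sumrN mulr_sumr.
apply: eq_big => [j|j jB].
  by rewrite !inE; case: (j =P i) => [->|_]; rewrite ?iB ?andbT ?andbF.
have ij : i != j by apply: contraNneq jB => <-.
rewrite coef_mul_basis sub1set in_setU1 iB orbT.
have -> : (j |: B) :\ i = j |: (B :\ i).
  by apply/setP=> l; rewrite !inE; case: (l =P i) => // ->; rewrite (negPf ij).
rewrite -{1}(setD1K iB) invUr; last by rewrite disjoints_subset sub1set !inE eqxx.
rewrite invUr; last by rewrite disjoints_subset sub1set !inE (negPf jB) andbF.
have := congr1 (fun m => (-1) ^+ m : K) (inv_anticomm ij); rewrite !exprD expr1 => h.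
transitivity ((-1) ^+ inv [set i] [set j] * (-1) ^+ inv [set j] [set i]
  * ((-1) ^+ inv [set i] (B :\ i) * ((-1) ^+ inv [set j] (B :\ i)
    * (y j * ext_coef (j |: B :\ i) f)))); first by ring.
by rewrite h; ring.
Qed.

Lemma koszul_one : d (ext_one K n) = 0.
Proof.
apply: ext_coefP => B; rewrite coef_koszul linear0 big1 // => i iB.
rewrite ext_one_basis coef_basis; case: eqP => [/setP/(_ i)|]; first by rewrite setU11 inE.
by rewrite !mulr0.
Qed.

Lemma koszul_sq f : d (d f) = 0.
Proof.
elim/ext_ind: f => [|c f g hf hg||i f hf].
- by rewrite !linear0.
- by rewrite !linearP /= hf hg scaler0 addr0.
- by rewrite koszul_one linear0.
- rewrite koszul_gen_mul linearB linearZ /= koszul_gen_mul hf.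
  by rewrite (bilin0r (ga_bilin _)) subr0 subrr.
Qed.

(** The sign of moving an element of degree p past f; p = 1 gives the involution of the graded
    Leibniz rule. *)
Definition ext_sign p f : exterior K n := ext_of (fun A => (-1) ^+ (p * #|A|) * ext_coef A f).

Lemma coef_sign p f A : ext_coef A (ext_sign p f) = (-1) ^+ (p * #|A|) * ext_coef A f.
Proof. exact: coef_ext_of. Qed.

Fact ext_sign_linear p : linear (ext_sign p).
Proof.
move=> c f g; apply: ext_coefP => A; rewrite linearP /= !coef_sign linearP /=.
by rewrite /GRing.scale /= mulrDr mulrCA.
Qed.
HB.instance Definition _ p :=
  GRing.isLinear.Build K (exterior K n) (exterior K n) _ (ext_sign p) (ext_sign_linear p).

Lemma ext_sign_gen f i :
  ext_sign 1 (ga_mul (ext_basis [set i]) f) = - ga_mul (ext_basis [set i]) (ext_sign 1 f).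
Proof.
apply: ext_coefP => A; rewrite linearN /= coef_sign !coef_mul_basis sub1set.
case: ifP => iA; last by rewrite mulr0 oppr0.
by rewrite coef_sign !mul1n (cardsD1 i A) iA exprD expr1; ring.
Qed.

Lemma ext_sign_one p : ext_sign p (ext_one K n) = ext_one K n.
Proof.
apply: ext_coefP => A; rewrite coef_sign ext_one_basis coef_basis.
by case: eqP => [->|_]; rewrite ?mulr0 // cards0 muln0 mul1r.
Qed.

Lemma koszul_mul f g :
  d (ga_mul f g) = ga_mul (d f) g + ga_mul (ext_sign 1 f) (d g).
Proof.
have bm := ga_bilin (exterior K n).
elim/ext_ind: f => [|c f f' hf hf'||i f hf].
- by rewrite !linear0 !(bilin0l bm) linear0 addr0.
- by rewrite linearP /= !bm.1 !linearP /= hf hf' bm.1 scalerDr addrACA.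
- by rewrite koszul_one ext_sign_one !ext_mul1 (bilin0l bm) add0r.
- rewrite -ga_mulA !koszul_gen_mul hf ext_sign_gen -!scaleN1r !(bilinDl bm, bilinDr bm).
  rewrite !(bilinZl bm, bilinZr bm) scalerDr !ga_mulA addrA.
  by [].
Qed.

Lemma koszul_gen i : d (ext_basis [set i]) = y i *: ext_one K n.
Proof.
by rewrite -[ext_basis _]ext_mulr1 koszul_gen_mul koszul_one (bilin0r (ga_bilin _)) subr0.
Qed.

Lemma koszul_gen_boundary i f : d f = 0 -> y i *: f = d (ga_mul (ext_basis [set i]) f).
Proof. by move=> h; rewrite koszul_gen_mul h (bilin0r (ga_bilin _)) subr0. Qed.

Lemma koszul_comp p f : d (gm_comp (exterior K n) p.+1 f) = gm_comp (exterior K n) p (d f).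
Proof.
apply: ext_coefP => B; rewrite coef_comp !coef_koszul.
case: eqP => hB; last first.
  by apply: big1 => i iB; rewrite coef_comp cardsU1 iB add1n eqSS; case: eqP; rewrite ?mulr0.
by apply: eq_bigr => i iB; rewrite coef_comp cardsU1 iB add1n eqSS hB eqxx.
Qed.

Lemma koszul_comp0 f : d (gm_comp (exterior K n) 0 f) = 0.
Proof.
apply: ext_coefP => B; rewrite coef_koszul linear0 big1 // => i iB.
by rewrite coef_comp cardsU1 iB !mulr0.
Qed.

End ExteriorCalculus.

Section ExteriorVectors.
Variables (K : comNzRingType) (n : nat).
Local Notation E := (exterior K n).
Implicit Types (v w : 'I_n -> K).
Let bE := ga_bilin E.

Definition ext_vec v : E := \sum_j v j *: ext_basis K [set j].

Lemma ext_basis_sq i : ga_mul (ext_basis K [set i]) (ext_basis K [set i]) = 0 :> E.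
Proof.
apply: ext_coefP => C; rewrite coef_mul_basis linear0 coef_basis sub1set.
case: ifP => // iC; case: eqP => [/setP/(_ i)|]; last by rewrite mulr0.
by rewrite !inE eqxx.
Qed.

Lemma ext_basis_anticomm i j : ga_mul (ext_basis K [set i]) (ext_basis K [set j])
  = - ga_mul (ext_basis K [set j]) (ext_basis K [set i]) :> E.
Proof.
have [->|ij] := eqVneq i j; first by rewrite ext_basis_sq oppr0.
have key (a b : 'I_n) (C : {set 'I_n}) : a != b ->
    (a \in C) && (C :\ a == [set b]) = (C == [set a; b]).
  move=> ab; apply/andP/eqP => [[aC /eqP h]|->].
    by rewrite -(setD1K aC) h.
  rewrite !inE eqxx; split=> //; apply/eqP/setP=> l; rewrite !inE.
  by case: (l =P a) => // ->; rewrite (negPf ab).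
have coefE (a b : 'I_n) C : a != b ->
    ext_coef C (ga_mul (ext_basis K [set a]) (ext_basis K [set b]) : E)
    = (-1) ^+ inv [set a] [set b] * (C == [set a; b])%:R.
  move=> ab; rewrite coef_mul_basis sub1set coef_basis -(key a b C ab).
  case: (a \in C) => /=; last by rewrite mulr0.
  by case: eqP => [->|_]; rewrite ?mulr0.
apply: ext_coefP => C; rewrite linearN /= coefE // coefE 1?[j == i]eq_sym // setUC.
rewrite -mulNr; congr (_ * _); move: (inv_anticomm ij).
by case: (inv [set i] [set j]) (inv [set j] [set i]) => [|[|?]] [|[|?]] //= _;
   rewrite ?expr0 ?expr1 ?opprK.
Qed.

Lemma ext_vec_anticomm v w : ga_mul (ext_vec v) (ext_vec w)
  = - ga_mul (ext_vec w) (ext_vec v) :> E.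
Proof.
rewrite /ext_vec !(bilin_suml bE) -sumrN.
under eq_bigr do rewrite (bilin_sumr bE).
under [RHS]eq_bigr do rewrite (bilin_sumr bE) -sumrN.
rewrite exchange_big; apply: eq_bigr => i _; apply: eq_bigr => j _.
rewrite !(bilinZl bE, bilinZr bE) ext_basis_anticomm !scalerN !scalerA.
by rewrite mulrC.
Qed.

(** Anticommutativity alone gives only that twice the square is zero, which says nothing in
    characteristic 2; hence the induction on the summands. *)
Lemma ext_vec_sq v : ga_mul (ext_vec v) (ext_vec v) = 0 :> E.
Proof.
rewrite /ext_vec; elim: (index_enum _) => [|j r IH].
  by rewrite big_nil (bilin0l bE).
rewrite big_cons !(bilinDl bE, bilinDr bE) IH addr0.
rewrite !(bilinZl bE, bilinZr bE) ext_basis_sq !scaler0 add0r.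
rewrite (bilin_suml bE) (bilin_sumr bE) -scalerDr -big_split big1 ?scaler0 //.
move=> i _; rewrite /= !(bilinZl bE, bilinZr bE) [in X in X + _]ext_basis_anticomm.
by rewrite scalerN addNr.
Qed.

Lemma ext_vec_unit i : ext_vec (fun j => (i == j)%:R) = ext_basis K [set i].
Proof.
rewrite /ext_vec (bigD1 i) //= eqxx scale1r big1 ?addr0 // => j ne.
by rewrite eq_sym (negPf ne) scale0r.
Qed.

Lemma koszul_vec_mul y v (f : E) : koszul_d y (ga_mul (ext_vec v) f)
  = (\sum_j v j * y j) *: f - ga_mul (ext_vec v) (koszul_d y f).
Proof.
rewrite /ext_vec !(bilin_suml bE) linear_sum scaler_suml -sumrB.
apply: eq_bigr => j _; rewrite !(bilinZl bE) linearZ /= koszul_gen_mul.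
by rewrite scalerBr scalerA.
Qed.

Lemma comp_vec_mul p v (f : E) :
  gm_comp E p.+1 (ga_mul (ext_vec v) f) = ga_mul (ext_vec v) (gm_comp E p f).
Proof.
rewrite /ext_vec !(bilin_suml bE) linear_sum; apply: eq_bigr => j _.
rewrite !(bilinZl bE) linearZ /=; congr (_ *: _).
apply: ext_coefP => C; rewrite coef_comp !coef_mul_basis sub1set coef_comp.
have [jC|jC] := boolP (j \in C); last by case: eqP.
by rewrite (cardsD1 j C) jC add1n eqSS; case: eqP; rewrite ?mulr0.
Qed.

Lemma comp0_vec_mul v (f : E) : gm_comp E 0 (ga_mul (ext_vec v) f) = 0.
Proof.
rewrite /ext_vec (bilin_suml bE) linear_sum big1 // => j _.
rewrite (bilinZl bE) linearZ /=.
apply: ext_coefP => C; rewrite linearZ /= coef_comp coef_mul_basis sub1set linear0.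
case: eqP => [/eqP|_]; last by rewrite scaler0.
by rewrite cards_eq0 => /eqP ->; rewrite inE scaler0.
Qed.

End ExteriorVectors.

(** * Algebra maps of exterior algebras induced by a matrix *)

Section ExteriorMap.
Variables (K : comNzRingType) (n : nat).
Local Notation E := (exterior K n).
Let bE := ga_bilin E.
Variables (m : nat) (M : 'I_m -> 'I_n -> K).
Local Notation F := (exterior K m).

(** Recursion on the list s, rather than on the set, fixes the order of the factors and so the
    sign. *)
Fixpoint ext_prod (s : seq 'I_m) (A : {set 'I_m}) : E :=
  if s is j :: s' then
    if j \in A then ga_mul (ext_vec (M j)) (ext_prod s' A) else ext_prod s' A
  else ext_one K n.

Lemma ext_prod_eq s (A B : {set 'I_m}) : (forall l, l \in s -> (l \in A) = (l \in B)) ->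
  ext_prod s A = ext_prod s B.
Proof.
elim: s => //= j s IH h; rewrite h ?mem_head //.
by rewrite IH // => i si; apply: h; rewrite inE si orbT.
Qed.

(** The new vector moves past the factors of smaller index, each contributing a sign, to its place
    in the increasing order. There it either meets itself, and the square vanishes, or becomes a new
    factor. *)
Lemma ext_prod_insert s A i : sorted ltn (map val s) -> i \in s ->
  ga_mul (ext_vec (M i)) (ext_prod s A) =
  if i \in A then 0
  else (-1) ^+ (\sum_(j <- s | j \in A) (j < i)) *: ext_prod s (i |: A).
Proof.
elim: s => //= j s IH; rewrite path_sortedE; last exact: ltn_trans.
move=> /andP[/allP hj hs]; have {IH} IH := IH hs.
have hj' l : l \in s -> (j < l)%N by move=> ls; apply: hj; apply: map_f.
rewrite inE; case: (i =P j) => [-> {i IH}|/eqP ne] /=.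
  move=> _; case: ifP => jA; first by rewrite ga_mulA ext_vec_sq (bilin0l bE).
  rewrite big_cons jA big_seq_cond big1 => [|l /andP[/hj' jl _]]; last first.
    by rewrite ltnNge ltnW.
  rewrite setU11 expr0 scale1r; apply: congr1; apply: ext_prod_eq => l /hj' jl.
  by rewrite !inE -val_eqE; case: ltngtP jl.
move=> is_; have ji := hj' _ is_.
rewrite in_setU1 eq_sym (negPf ne) big_cons ji /=.
case: (boolP (j \in A)) => jA; last exact: IH.
rewrite ga_mulA ext_vec_anticomm -scaleN1r (bilinZl bE) -ga_mulA IH //.
case: ifP => iA; first by rewrite (bilin0r bE) scaler0.
by rewrite (bilinZr bE) scalerA exprD.
Qed.

(** The coefficients are the minors of M; writing them as products of rows lets multiplicativity be
    proved one generator at a time. *)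
Definition ext_map (f : F) : E :=
  \sum_A (ext_coef A f : K) *: ext_prod (enum 'I_m) A.

Fact ext_map_linear : linear ext_map.
Proof.
move=> c f g; rewrite /ext_map scaler_sumr -big_split; apply: eq_bigr => A _ /=.
by rewrite linearP /= scalerDl scalerA.
Qed.
HB.instance Definition _ := GRing.isLinear.Build K F E _ ext_map ext_map_linear.

Lemma ext_map_basis A : ext_map (ext_basis K A) = ext_prod (enum 'I_m) A.
Proof.
rewrite /ext_map (bigD1 A) //= coef_basis eqxx scale1r big1 ?addr0 // => B ne.
by rewrite coef_basis (negPf ne) scale0r.
Qed.

Lemma ext_map_one : ext_map (ext_one K m) = ext_one K n.
Proof.
rewrite ext_one_basis ext_map_basis; elim: (enum _) => //= j s ->.
by rewrite inE.
Qed.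

Lemma ext_map_gen i f : ext_map (ga_mul (ext_basis K [set i]) f)
  = ga_mul (ext_vec (M i)) (ext_map f).
Proof.
rewrite (ext_expand f) (bilin_sumr (ga_bilin F)) !linear_sum (bilin_sumr bE).
apply: eq_bigr => A _; rewrite (bilinZr (ga_bilin F)) !linearZ /= (bilinZr bE).
congr (_ *: _); rewrite ext_map_basis ext_prod_insert ?mem_enum //; last first.
  by rewrite val_enum_ord iota_ltn_sorted.
have -> : (\sum_(j <- enum 'I_m | j \in A) (j < i) = inv [set i] A)%N.
  by rewrite inv1l big_enum_cond; apply: eq_bigl => l; rewrite inE.
case: ifP => iA; last rewrite -ext_map_basis -linearZ; last congr ext_map.
  rewrite (_ : ga_mul _ _ = 0) ?linear0 //; apply: ext_coefP => C.
  rewrite coef_mul_basis coef_basis linear0 sub1set; case: ifP => // iC.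
  by case: eqP => [h|]; [move: iA; rewrite -h !inE eqxx | rewrite mulr0].
apply: ext_coefP => C; rewrite linearZ /= coef_mul_basis !coef_basis sub1set.
case: (C =P i |: A) => [->|ne].
  by rewrite setU11 setU1K ?iA // eqxx mulr1 /GRing.scale /= mulr1.
rewrite /GRing.scale /= mulr0; case: ifP => iC //.
by case: eqP => [h|]; [case: ne; rewrite -h setD1K | rewrite mulr0].
Qed.

Lemma ext_map_mul f g : ext_map (ga_mul f g) = ga_mul (ext_map f) (ext_map g).
Proof.
have bF := ga_bilin F.
elim/ext_ind: f => [|c f f' hf hf'||i f hf].
- by rewrite (bilin0l bF) linear0 (bilin0l bE).
- by rewrite bF.1 !linearP /= hf hf' bE.1.
- by rewrite ext_map_one !ext_mul1.
- by rewrite -ga_mulA !ext_map_gen hf ga_mulA.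
Qed.

Lemma ext_map_comp p f : ext_map (gm_comp F p f) = gm_comp E p (ext_map f).
Proof.
elim/ext_ind: f p => [|c f f' hf hf'||i f hf] p.
- by rewrite !linear0.
- by rewrite !linearP /= hf hf'.
- by rewrite ext_map_one !comp_one; case: eqP; rewrite ?ext_map_one ?linear0.
rewrite -[in LHS](ext_vec_unit K i) ext_map_gen.
case: p => [|p]; first by rewrite !comp0_vec_mul linear0.
by rewrite !comp_vec_mul ext_vec_unit ext_map_gen hf.
Qed.

Lemma ext_map_koszul (x : 'I_m -> K) (y : 'I_n -> K) f :
  (forall i, x i = \sum_j M i j * y j) ->
  koszul_d y (ext_map f) = ext_map (koszul_d x f).
Proof.
move=> xy; elim/ext_ind: f => [|c f f' hf hf'||i f hf].
- by rewrite !linear0.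
- by rewrite !linearP /= hf hf'.
- by rewrite ext_map_one !koszul_one linear0.
- by rewrite ext_map_gen koszul_vec_mul koszul_gen_mul hf linearB linearZ /= ext_map_gen xy.
Qed.
End ExteriorMap.

Lemma ext_map_vec (K : comNzRingType) m n (M : 'I_m -> 'I_n -> K) v f :
  ext_map M (ga_mul (ext_vec v) f)
  = ga_mul (ext_vec (fun j => \sum_i v i * M i j)) (ext_map M f).
Proof.
rewrite /ext_vec !(bilin_suml (ga_bilin _)) linear_sum /=.
under eq_bigr do rewrite (bilinZl (ga_bilin _)) linearZ /= ext_map_gen
  /ext_vec (bilin_suml (ga_bilin _)) scaler_sumr.
rewrite exchange_big; apply: eq_bigr => j _; rewrite (bilinZl (ga_bilin _)) scaler_suml.
by apply: eq_bigr => i _; rewrite (bilinZl (ga_bilin _)) scalerA.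
Qed.

Lemma ext_mapK (K : comNzRingType) m n (M : 'I_m -> 'I_n -> K) (N : 'I_n -> 'I_m -> K) :
  (forall i l, \sum_j M i j * N j l = (i == l)%:R) -> cancel (ext_map M) (ext_map N).
Proof.
move=> MN; elim/ext_ind => [|c f g hf hg||i f hf].
- by rewrite !linear0.
- by rewrite !linearP /= hf hg.
- by rewrite !ext_map_one.
- rewrite ext_map_gen ext_map_vec hf -[in RHS]ext_vec_unit; congr (ga_mul (ext_vec _) _).
  by apply: funext => l; rewrite MN.
Qed.

(** * Change of the coefficient ring *)

Section ExteriorBaseChange.
Variables (K L : comNzRingType) (c : {rmorphism K -> L}) (n : nat).
Implicit Types f g : exterior K n.

Definition ext_base f : exterior L n := ext_of (fun A => c (ext_coef A f)).

Lemma coef_base A f : ext_coef A (ext_base f) = c (ext_coef A f).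
Proof. exact: coef_ext_of. Qed.

Lemma ext_baseD f g : ext_base (f + g) = ext_base f + ext_base g.
Proof. by apply: ext_coefP => A; rewrite linearD /= !coef_base linearD rmorphD. Qed.

Lemma ext_baseZ a f : ext_base (a *: f) = c a *: ext_base f.
Proof. by apply: ext_coefP => A; rewrite linearZ /= !coef_base linearZ rmorphM. Qed.

Lemma ext_base0 : ext_base 0 = 0.
Proof. by apply: ext_coefP => A; rewrite coef_base !linear0 rmorph0. Qed.

Lemma ext_baseN f : ext_base (- f) = - ext_base f.
Proof. by rewrite -scaleN1r ext_baseZ rmorphN1 scaleN1r. Qed.

Lemma ext_base_mul f g : ext_base (ga_mul f g) = ga_mul (ext_base f) (ext_base g).
Proof.
apply: ext_coefP => C; rewrite coef_base !coef_mul rmorph_sum; apply: eq_bigr => A _.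
by rewrite !coef_base !rmorphM rmorph_sign.
Qed.

Lemma ext_base_sum I (r : seq I) (P : pred I) (F : I -> exterior K n) :
  ext_base (\sum_(i <- r | P i) F i) = \sum_(i <- r | P i) ext_base (F i).
Proof. exact: (big_morph _ ext_baseD ext_base0). Qed.

Lemma ext_base_sign p f : ext_base (ext_sign p f) = ext_sign p (ext_base f).
Proof.
by apply: ext_coefP => A; rewrite coef_base !coef_sign coef_base rmorphM rmorph_sign.
Qed.

Lemma ext_base_comp p f :
  ext_base (gm_comp (exterior K n) p f) = gm_comp (exterior L n) p (ext_base f).
Proof.
by apply: ext_coefP => A; rewrite coef_base !coef_comp coef_base; case: ifP; rewrite ?rmorph0.
Qed.

Lemma ext_base_koszul y f : ext_base (koszul_d y f) = koszul_d (c \o y) (ext_base f).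
Proof.
apply: ext_coefP => B; rewrite coef_base !coef_koszul rmorph_sum; apply: eq_bigr => i _.
by rewrite coef_base !rmorphM rmorph_sign.
Qed.
End ExteriorBaseChange.

(** * Noetherian modules and the Artin-Rees property *)

Lemma gen_mem (S : comNzRingType) n (x : 'I_n -> S) (P : S -> Prop) i :
  (forall z, P z <-> gen_ideal x z) -> P (x i).
Proof.
move=> Pgen; apply/Pgen; exists (fun j => (j == i)%:R).
by rewrite (bigD1 i) //= eqxx mul1r big1 ?addr0 // => j /negPf ->; rewrite mul0r.
Qed.

Section Noetherian.
Variables (S : comNzRingType) (V : lmodType S).
Implicit Types (B C : V -> Prop).

Definition submodule B := B 0 /\ forall c x y, B x -> B y -> B (c *: x + y).

Lemma submoduleZ B c x : submodule B -> B x -> B (c *: x).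
Proof. by move=> [B0 Bl] Bx; rewrite -[_ *: _]addr0; exact: Bl. Qed.
Lemma submoduleD B x y : submodule B -> B x -> B y -> B (x + y).
Proof. by move=> [B0 Bl] Bx; rewrite -[x]scale1r; exact: Bl. Qed.
Lemma submoduleB B x y : submodule B -> B x -> B y -> B (x - y).
Proof. by move=> sB Bx By; rewrite -scaleN1r; apply: submoduleD => //; exact: submoduleZ. Qed.
Lemma submodule_sum B I (r : seq I) (F : I -> V) :
  submodule B -> (forall i, B (F i)) -> B (\sum_(i <- r) F i).
Proof.
by move=> sB BF; apply: (big_ind B) => // [|x y Bx By]; [case: sB|exact: submoduleD].
Qed.

Definition acc := forall C : nat -> V -> Prop, (forall i, submodule (C i)) ->
  (forall i x, C i x -> C i.+1 x) -> exists N, forall i x, C i x -> C N x.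

Lemma acc_maximal (Phi : (V -> Prop) -> Prop) B : acc -> submodule B -> Phi B ->
  exists C, [/\ submodule C, Phi C, forall x, B x -> C x &
    forall C', submodule C' -> Phi C' -> (forall x, C x -> C' x) ->
      forall x, C' x -> C x].
Proof.
move=> accV sB PhiB; apply: contrapT => noC.
pose good C := [/\ submodule C, Phi C & forall x, B x -> C x].
have step (C : {C | good C}) : exists C' : {C | good C},
    (forall x, sval C x -> sval C' x) /\ exists2 x, sval C' x & ~ sval C x.
  case: C => C [sC PhiC BC] /=; apply: contrapT => no; apply: noC; exists C; split=> //.
  move=> C' sC' PhiC' CC' x C'x; apply: contrapT => Cx; apply: no.
  have gC' : good C' by split=> // z /BC/CC'.
  by exists (exist _ C' gC'); split=> //; exists x.
have [next nextP] := choice step.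
have gB : good B by [].
pose C i := sval (iter i next (exist _ B gB)).
have [N hN] : exists N, forall i x, C i x -> C N x.
  apply: accV => i; first by rewrite /C; case: (iter _ _ _) => ? [].
  by move=> x; exact: (nextP _).1.
by have [_ [x hx]] := nextP (iter N next (exist _ B gB)); apply; exact: (hN N.+1).
Qed.

Variables (n : nat) (y : 'I_n -> S).

Definition mul_ideal B x := exists2 b : 'I_n -> V, forall i, B (b i) & x = \sum_i y i *: b i.

Lemma mul_ideal_submodule B : submodule B -> submodule (mul_ideal B).
Proof.
move=> sB; split=> [|c x z [b Bb ->] [b' Bb' ->]].
  by exists (fun=> 0) => [|]; [case: sB|rewrite big1 // => i _; rewrite scaler0].
exists (fun i => c *: b i + b' i); first by move=> i; apply: sB.2.
rewrite scaler_sumr -big_split; apply: eq_bigr => i _ /=.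
by rewrite scalerDr !scalerA mulrC.
Qed.

Lemma mul_ideal_gen B i b : submodule B -> B b -> mul_ideal B (y i *: b).
Proof.
move=> sB Bb; exists (fun j => if j == i then b else 0).
  by move=> j; case: eqP => _ //; case: sB.
by rewrite (bigD1 i) //= eqxx big1 ?addr0 // => j /negPf ->; rewrite scaler0.
Qed.

Lemma mul_ideal_sub B x : submodule B -> mul_ideal B x -> B x.
Proof. by move=> sB [b Bb ->]; apply: submodule_sum => // i; exact: submoduleZ. Qed.

Definition mul_pow N B := iter N mul_ideal B.

Lemma mul_pow_submodule N B : submodule B -> submodule (mul_pow N B).
Proof. by move=> sB; elim: N => //= N IH; exact: mul_ideal_submodule. Qed.

Lemma mul_pow_leq N N' B x : submodule B -> (N <= N')%N -> mul_pow N' B x -> mul_pow N B x.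
Proof.
move=> sB /subnKC <-; rewrite addnC /mul_pow iterD.
elim: (N' - N)%N x => //= p IH x /mul_ideal_sub h; apply: IH; apply: h.
by rewrite -iterD; exact: mul_pow_submodule.
Qed.

Definition full : V -> Prop := fun=> True.
Lemma full_submodule : submodule full. Proof. by []. Qed.

Lemma prod_count (w : seq 'I_n) i j : (j <= count_mem i w)%N ->
  exists c, \prod_(l <- w) y l = c * y i ^+ j.
Proof.
elim: w j => [|l w IH] j /=.
  by rewrite leqn0 => /eqP ->; exists 1; rewrite big_nil mul1r.
rewrite big_cons; case: (l =P i) => [->|_]; last first.
  by rewrite add0n => /IH [c ->]; exists (y l * c); rewrite mulrA.
case: j => [|j]; first by move=> _; exists (y i * \prod_(j <- w) y j); rewrite mulr1.
by rewrite add1n ltnS => /IH [c ->]; exists c; rewrite exprS mulrCA.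
Qed.

Lemma sum_count (w : seq 'I_n) : size w = \sum_i count_mem i w.
Proof.
elim: w => [|l w IH] /=; first by rewrite big1.
rewrite big_split /= -IH (bigD1 l) //= eqxx big1 // => i ne.
by rewrite eq_sym (negPf ne).
Qed.

(** The factor p collects the letters already extracted, so that the induction on N can lengthen the
    word from the left. *)
Lemma mul_pow_words N C x p : submodule C ->
  (forall (w : seq 'I_n) v, size w = N -> C ((p * \prod_(l <- w) y l) *: v)) ->
  mul_pow N full x -> C (p *: x).
Proof.
move=> sC; elim: N x p => [|N IH] x p h /=.
  by move=> _; have := h [::] x erefl; rewrite big_nil mulr1.
move=> [b hb ->]; rewrite scaler_sumr; apply: submodule_sum => // i.
rewrite scalerA; apply: IH => // w v sw; have := h (i :: w) v.
by rewrite /= sw big_cons mulrA => /(_ erefl).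
Qed.

(* Choose C maximal among the submodules containing m B whose intersection with B
   is m B. For a generator a of m the chain (C : a^j) is stationary, which makes
   C + a^j V satisfy the same condition; hence C contains a^j V, and so m^N V for N
   large. *)
Lemma weak_artin_rees B : acc -> submodule B ->
  exists N, forall x, B x -> mul_pow N full x -> mul_ideal B x.
Proof.
move=> accV sB; have smB := mul_ideal_submodule sB.
have [||C [sC PhiC mBC Cmax]] :=
  @acc_maximal (fun C => forall b, B b -> C b -> mul_ideal B b) (mul_ideal B) accV.
- exact: smB.
- by [].
have powC i : exists j, forall v, C (y i ^+ j *: v).
  have [||j hj] := accV (fun j v => C (y i ^+ j *: v)).
  - move=> j; split=> [|c u v hu hv]; first by rewrite scaler0; case: sC.
    by rewrite scalerDr scalerA mulrC -scalerA; apply: sC.2.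
  - by move=> j v hv; rewrite exprS -scalerA; exact: submoduleZ.
  exists j; pose C' x := exists c v, C c /\ x = c + y i ^+ j *: v.
  suff C'C x : C' x -> C x.
    by move=> v; apply: C'C; exists 0, v; rewrite add0r; split=> //; case: sC.
  move: x; apply: Cmax => [|b Bb [c [v [Cc bE]]]|x Cx].
  - split=> [|a u v [c [u' [Cc ->]]] [c' [v' [Cc' ->]]]].
      by exists 0, 0; rewrite scaler0 addr0; split=> //; case: sC.
    exists (a *: c + c'), (a *: u' + v'); split; first exact: sC.2.
    by rewrite !scalerDr !scalerA addrACA [a * _]mulrC.
  (* Here a = [y i]. Both a b (in m B) and a c lie in C, hence so does a^(j+1) v; stationarity of
     the chain (C : a^j) then puts a^j v, and so b, in C. *)
  - apply: PhiC => //; rewrite bE; apply: submoduleD => //; apply: (hj j.+1).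
    have -> : y i ^+ j.+1 *: v = y i *: b - y i *: c.
      by rewrite bE scalerDr addrC addKr exprS scalerA.
    apply: submoduleB => //; last exact: submoduleZ.
    by apply: mBC; exact: mul_ideal_gen.
  - by exists x, 0; rewrite scaler0 addr0.
have [j hj] := choice powC.
exists (\sum_i j i).+1 => x Bx hx; apply: PhiC => //; rewrite -[x]scale1r.
apply: (mul_pow_words sC _ hx) => w v sw; rewrite mul1r.
(* Pigeonhole: a word longer than the sum of the [j i] contains some letter i at least [j i]
   times. *)
have [i hi] : exists i, (j i <= count_mem i w)%N.
  apply: contrapT => no; suff : (size w <= \sum_i j i)%N by rewrite sw ltnn.
  rewrite sum_count; apply: leq_sum => i _; case: leqP => // /ltnW le.
  by case: no; exists i.
have [c ->] := prod_count hi; rewrite -scalerA; exact: submoduleZ.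
Qed.

(** The weak form is applied successively to B, m B, m^2 B and so on; the exponent N depends on L in
    no prescribed way. *)
Lemma artin_rees B L : acc -> submodule B ->
  exists N, forall x, B x -> mul_pow N full x -> mul_pow L B x.
Proof.
move=> accV sB; elim: L => [|L [N hN]]; first by exists 0%N.
have [N' hN'] := weak_artin_rees accV (mul_pow_submodule L sB).
exists (maxn N N') => x Bx hx; apply: hN'.
  by apply: hN => //; apply: mul_pow_leq hx; rewrite ?leq_maxl.
by apply: mul_pow_leq hx; rewrite ?leq_maxr.
Qed.

(** Induction on a list of forms that separates the points of the chain: a chain of submodules is
    stationary once its intersection with the kernel of the first form and its image under that form
    both are. *)
Lemma acc_of_forms (T : finType) (l : T -> {linear V -> S^o}) :
  (forall C : nat -> S^o -> Prop,
     (forall i c x z, C i x -> C i z -> C i (c *: x + z)) -> (forall i, C i 0) ->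
     (forall i x, C i x -> C i.+1 x) -> exists N, forall i x, C i x -> C N x) ->
  (forall x, (forall t, l t x = 0) -> x = 0) -> acc.
Proof.
move=> accS linj; suff key (s : seq T) (C : nat -> V -> Prop) :
    (forall i, submodule (C i)) -> (forall i x, C i x -> C i.+1 x) ->
    (forall i x, C i x -> (forall t, t \in s -> l t x = 0) -> x = 0) ->
    exists N, forall i x, C i x -> C N x.
  move=> C sC incC; apply: (key (enum T)) => // i x _ h.
  by apply: linj => t; apply: h; rewrite mem_enum.
elim: s C => [|t s IH] C sC incC h.
  exists 0%N => i x /h ->; first by case: (sC 0%N).
  by [].
have mono i i' x : (i <= i')%N -> C i x -> C i' x.
  by move=> /subnKC <- Cx; elim: (i' - i)%N => [|p]; rewrite ?addn0 // addnS; exact: incC.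
have [|||N1 hN1] := IH (fun i x => C i x /\ l t x = 0).
- move=> i; have [C0 Cl] := sC i; split=> [|c x z [Cx lx] [Cz lz]].
    by rewrite linear0.
  by rewrite linearP lx lz /= scaler0 addr0; split=> //; exact: Cl.
- by move=> i x [/incC].
- move=> i x [Cx lx] hx; apply: (h i) => // t'; rewrite inE => /predU1P[-> //|].
  exact: hx.
have [||i a [x /incC Cx <-]|N2 hN2] := accS (fun i a => exists2 x, C i x & l t x = a).
- move=> i c a b [x Cx <-] [z Cz <-]; exists (c *: x + z); last exact: linearP.
  exact: (sC i).2.
- by move=> i; exists 0; [case: (sC i)|rewrite linear0].
- by exists x.
exists (maxn N1 N2) => i x Cx.
have [z Cz lz] : exists2 z, C N2 z & l t z = l t x by apply: (hN2 i); exists x.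
rewrite -(subrK z x); apply: submoduleD => //; last exact: mono (leq_maxr _ _) Cz.
apply: (mono N1); first exact: leq_maxl.
suff [] : C N1 (x - z) /\ l t (x - z) = 0 by [].
apply: (hN1 (maxn i N2)); split; last by rewrite linearB lz subrr.
apply: submoduleB => //; first exact: mono (leq_maxl _ _) Cx.
exact: mono (leq_maxr _ _) Cz.
Qed.

End Noetherian.

Section IdealOfPredicate.
Variables (S : comNzRingType) (U : S -> Prop).
Hypotheses (U0 : U 0) (U1 : ~ U 1) (Ul : forall a x z, U x -> U z -> U (a * x + z)).

Definition ideal_pred : S -> bool := fun z => `[< U z >].
Fact ideal_pred_closed : idealr_closed ideal_pred.
Proof.
split; [exact/asboolP|exact/asboolP|] => a x z /asboolP hx /asboolP hz.
by apply/asboolP; exact: Ul.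
Qed.
HB.instance Definition _ := isIdealr.Build S ideal_pred ideal_pred_closed.
Definition ideal_of : idealr S := ideal_pred.
Lemma mem_ideal_of z : (z \in ideal_of) <-> U z.
Proof. by split=> /asboolP. Qed.
End IdealOfPredicate.

Lemma noetherian_acc (S : comNzRingType) : noetherian S ->
  forall C : nat -> S^o -> Prop,
     (forall i c x z, C i x -> C i z -> C i (c *: x + z)) -> (forall i, C i 0) ->
     (forall i x, C i x -> C i.+1 x) -> exists N, forall i x, C i x -> C N x.
Proof.
move=> nS C Cl C0 incC.
have mono i i' x : (i <= i')%N -> C i x -> C i' x.
  by move=> /subnKC <- Cx; elim: (i' - i)%N => [|p]; rewrite ?addn0 // addnS; exact: incC.
pose U z := exists i, C i z.
(* An [idealr] is proper by definition, so a union that contains 1 is treated apart; some [C N] is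
   then the whole ring. *)
have [[N CN]|U1] := pselect (U 1).
  exists N => i x _; rewrite -[x]mulr1 -[_ * _]addr0; exact: Cl.
have Ul a x z : U x -> U z -> U (a * x + z).
  move=> [i Cx] [j Cz]; exists (maxn i j); apply: Cl.
    exact: mono (leq_maxl _ _) Cx.
  exact: mono (leq_maxr _ _) Cz.
have U0 : U 0 by exists 0%N.
have [n [x hx]] := nS (ideal_of U0 U1 Ul).
have xU i : U (x i) by apply/(mem_ideal_of U0 U1 Ul)/(gen_mem _ hx).
have [N hN] := choice xU; exists (\max_i N i)%N => i z Cz.
have : U z by exists i.
move=> /(mem_ideal_of U0 U1 Ul)/hx[c ->].
apply: (big_ind (C _)) => // [a b ha hb|j _]; first by rewrite -[a]scale1r; exact: Cl.
rewrite -[_ * _]addr0; apply: Cl => //.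
by apply: mono (hN j); rewrite (bigmax_sup j).
Qed.

Lemma noetherian_surj (S S' : comNzRingType) (f : {rmorphism S -> S'}) :
  (forall z, exists x, f x = z) -> noetherian S -> noetherian S'.
Proof.
move=> fs nS I; pose U x := f x \in I.
have U0 : U 0 by rewrite /U rmorph0 rpred0.
have U1 : ~ U 1 by rewrite /U rmorph1 idealr1.
have Ul a x z : U x -> U z -> U (a * x + z).
  by move=> hx hz; rewrite /U rmorphD rmorphM rpredD // idealMr.
have [n [x hx]] := nS (ideal_of U0 U1 Ul); exists n, (f \o x) => z; split=> [zI|[c ->]].
  have [u uz] := fs z; move: zI; rewrite -uz => /(mem_ideal_of U0 U1 Ul)/hx[c ->].
  by exists (f \o c); rewrite rmorph_sum; apply: eq_bigr => i _; rewrite rmorphM.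
apply: rpred_sum => i _; apply: idealMr.
by apply/(mem_ideal_of U0 U1 Ul)/(gen_mem _ hx).
Qed.

Lemma exterior_acc (S : comNzRingType) n : noetherian S -> acc (exterior S n).
Proof.
move=> nS; apply: (acc_of_forms (l := fun A : {set 'I_n} => ext_coef (K := S) A)).
  exact: noetherian_acc.
by move=> f h; apply: ext_coefP => A; rewrite h linear0.
Qed.

(** * Powers of an ideal and the adic filtration of an exterior algebra *)

Section IdealPowers.
Variables (S : comNzRingType) (P : S -> Prop) (n : nat) (y : 'I_n -> S).
Hypothesis Py : forall i, P (y i).
Hypothesis Pgen : forall z, P z -> gen_ideal y z.

Lemma ideal_pow0 N : ideal_pow P N 0.
Proof. by exists 0%N, (fun=> 0), (fun _ _ => 0); split=> [[]|] //; rewrite big_ord0. Qed.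

Lemma ideal_powD N u v : ideal_pow P N u -> ideal_pow P N v -> ideal_pow P N (u + v).
Proof.
move=> [p [c [a [Pa ->]]]] [q [c' [a' [Pa' ->]]]].
exists (p + q)%N, (fun i => match split i with inl j => c j | inr j => c' j end).
exists (fun i => match split i with inl j => a j | inr j => a' j end); split.
  by move=> i j; case: splitP.
rewrite big_split_ord; congr (_ + _); apply: eq_bigr => i _.
  by rewrite (unsplitK (inl i)).
by rewrite (unsplitK (inr i)).
Qed.

Lemma ideal_powN N u : ideal_pow P N u -> ideal_pow P N (- u).
Proof.
move=> [p [c [a [Pa ->]]]]; exists p, (fun i => - c i), a; split=> //.
by rewrite -sumrN; apply: eq_bigr => i _; rewrite mulNr.
Qed.

Lemma ideal_pow_sum N I (r : seq I) (F : I -> S) :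
  (forall i, ideal_pow P N (F i)) -> ideal_pow P N (\sum_(i <- r) F i).
Proof.
move=> h; apply: (big_ind (ideal_pow P N)) => // [|u v]; first exact: ideal_pow0.
exact: ideal_powD.
Qed.

Lemma ideal_powS N u i : ideal_pow P N u -> ideal_pow P N.+1 (y i * u).
Proof.
move=> [p [c [a [Pa ->]]]].
exists p, c, (fun l j => oapp (a l) (y i) (unlift ord0 j)); split.
  by move=> l j; case: unliftP => [j' _|_] /=.
rewrite mulr_sumr; apply: eq_bigr => l _.
rewrite big_ord_recl unlift_none /= mulrCA; congr (_ * (_ * _)).
by apply: eq_bigr => j _; rewrite liftK.
Qed.

Lemma coef_mul_pow m N (f : exterior S m) A :
  mul_pow y N (@full S (exterior S m)) f -> ideal_pow P N (ext_coef A f).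
Proof.
elim: N f => [|N IH] f /=.
  exists 1%N, (fun=> ext_coef A f), (fun _ _ => 0); split=> [? []//|].
  by rewrite big_ord1 big_ord0 mulr1.
move=> [b hb ->]; rewrite linear_sum; apply: (big_ind (ideal_pow P N.+1)).
- exact: ideal_pow0.
- exact: ideal_powD.
- by move=> i _; rewrite linearZ; apply: ideal_powS; exact: IH.
Qed.

Lemma mul_pow_basis m N u A : ideal_pow P N u ->
  mul_pow y N (@full S (exterior S m)) (u *: ext_basis S A).
Proof.
have sF p := mul_pow_submodule y p (full_submodule (exterior S m)).
move=> [p [c [a [Pa ->]]]]; rewrite scaler_suml; apply: submodule_sum => // i.
rewrite -scalerA; apply: submoduleZ => //; move: (a i) (Pa i) => {c a Pa} b Pb.
elim: N b Pb => [|N IH] b Pb //; rewrite big_ord_recl /=.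
have [e ->] := Pgen (Pb ord0); rewrite mulr_suml scaler_suml; apply: submodule_sum.
  exact: (sF N.+1).
move=> l; rewrite -mulrA -scalerA; apply: submoduleZ; first exact: (sF N.+1).
by rewrite -scalerA; apply: mul_ideal_gen => //; apply: IH => j; exact: Pb.
Qed.

Lemma mul_pow_coefs m N (f : exterior S m) : (forall A, ideal_pow P N (ext_coef A f)) ->
  mul_pow y N (@full S (exterior S m)) f.
Proof.
move=> h; rewrite (ext_expand f); apply: submodule_sum.
  exact: mul_pow_submodule (full_submodule _).
by move=> A; exact: mul_pow_basis.
Qed.
End IdealPowers.

Lemma mul_pow_base (S S' : comNzRingType) (c : {rmorphism S -> S'}) n (y : 'I_n -> S)
    m N (f : exterior S m) :
  mul_pow y N (@full S (exterior S m)) f ->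
  mul_pow (c \o y) N (@full S' (exterior S' m)) (ext_base c f).
Proof.
elim: N f => //= N IH f [b hb ->]; exists (fun i => ext_base c (b i)).
  by move=> i; exact: IH.
apply: (big_ind2 (fun f g => ext_base c f = g)) => [|f1 g1 f2 g2 <- <-|i _].
- exact: ext_base0.
- exact: ext_baseD.
- exact: ext_baseZ.
Qed.

(** * Cycles and boundaries in the adic filtration *)

Section KoszulCycles.
Variables (S : comNzRingType) (n : nat) (y : 'I_n -> S).
Local Notation E := (exterior S n).
Local Notation d := (koszul_d y).

Definition cycles (z : E) : Prop := d z = 0.
Definition boundaries (z : E) : Prop := exists w, z = d w.

Lemma cycles_submodule : submodule cycles.
Proof.
split=> [|c z w hz hw]; rewrite /cycles; first exact: linear0.
by rewrite linearP /= (hz : d z = 0) (hw : d w = 0) scaler0 addr0.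
Qed.
Lemma boundaries_submodule : submodule boundaries.
Proof.
split=> [|c z w [u ->] [v ->]]; first by exists 0; rewrite linear0.
by exists (c *: u + v); rewrite linearP.
Qed.
(** Multiplication by [e_i] is a homotopy from multiplication by [y i] to zero, so the ideal
    annihilates homology. After Artin-Rees, a cycle of high order is a boundary. *)
Lemma mul_ideal_cycles z : mul_ideal y cycles z -> boundaries z.
Proof.
move=> [b hb ->]; apply: submodule_sum => [|i]; first exact: boundaries_submodule.
by exists (ga_mul (ext_basis S [set i]) (b i)); exact: koszul_gen_boundary (hb i).
Qed.

(** By linearity m^N d(E) is d(m^N E): a boundary of this form has a primitive that is equally
    small. *)
Lemma mul_pow_boundaries N z : mul_pow y N boundaries z ->
  exists2 w, mul_pow y N (@full S E) w & z = d w.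
Proof.
elim: N z => [|N IH] z /=; first by move=> [w ->]; exists w.
move=> [b hb ->]; have h i : exists w, mul_pow y N (@full S E) w /\ b i = d w.
  by have [w hw bw] := IH _ (hb i); exists w.
have [w hw] := choice h.
exists (\sum_i y i *: w i); first by exists w => // i; exact: (hw i).1.
by rewrite linear_sum; apply: eq_bigr => i _; rewrite linearZ /= (hw i).2.
Qed.

Lemma mul_pow_koszul N w : mul_pow y N (@full S E) w -> mul_pow y N (@full S E) (d w).
Proof.
elim: N w => //= N IH w [b hb ->]; exists (d \o b) => [i|]; first exact: IH.
by rewrite linear_sum; apply: eq_bigr => i _; rewrite linearZ.
Qed.
End KoszulCycles.

(** * Tor algebras as Koszul homology *)

Section Independence.
Variables (S : comNzRingType) (k : fieldType) (rho : {rmorphism S -> k}).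
Variables (n : nat) (y : 'I_n -> S).

(** For generators of the maximal ideal m this is linear independence of the classes in m/m^2
    ([independent_sqr]), phrased through relations to avoid the quotient. *)
Definition independent := forall c : 'I_n -> S, \sum_i c i * y i = 0 -> forall i, rho (c i) = 0.

(** A relation with a unit coefficient could be solved for one of the generators. *)
Lemma min_gen_independent (P : S -> Prop) :
  (forall x, rho x <> 0 -> exists y, x * y = 1) -> min_gen P y -> independent.
Proof.
move=> unitS [_ ymin] c hc i; apply: contrapT => /unitS[u cu]; apply: (ymin i).
exists (fun j => if j == i then 0 else - (u * c j)); first by rewrite eqxx.
rewrite (bigD1 i) //= eqxx mul0r add0r.
transitivity (- (u * \sum_(j | j != i) c j * y j)); last first.
  rewrite mulr_sumr -sumrN; apply: eq_bigr => j /negPf ->.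
  by rewrite mulNr mulrA.
move: hc; rewrite (bigD1 i) //= => /eqP; rewrite addr_eq0 => /eqP h.
by rewrite -mulrN -h mulrA [u * _]mulrC cu mul1r.
Qed.

Hypothesis ygen : forall z, max_ideal rho z -> gen_ideal y z.

Lemma gen_ideal_sqr z : ideal_pow (max_ideal rho) 2 z ->
  exists2 m : 'I_n -> S, forall i, rho (m i) = 0 & z = \sum_i m i * y i.
Proof.
move=> [p [c [a [ha ->]]]].
apply: (big_ind (fun z => exists2 m : 'I_n -> S, forall i, rho (m i) = 0 & z = \sum_i m i * y i)).
- by exists (fun=> 0) => [i|]; rewrite ?rmorph0 // big1 // => i _; rewrite mul0r.
- move=> _ _ [m hm ->] [m' hm' ->]; exists (fun i => m i + m' i).
    by move=> i; rewrite rmorphD hm hm' addr0.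
  by rewrite -big_split; apply: eq_bigr => i _; rewrite mulrDl.
- move=> l _; rewrite !big_ord_recl big_ord0 mulr1.
  have [e he] := ygen (ha l (lift ord0 ord0)).
  exists (fun i => c l * a l ord0 * e i) => [i|].
    by rewrite !rmorphM (ha l ord0 : rho _ = 0) mulr0 mul0r.
  by rewrite he !mulr_sumr; apply: eq_bigr => i _; rewrite !mulrA.
Qed.

Lemma independent_sqr (c : 'I_n -> S) : independent ->
  ideal_pow (max_ideal rho) 2 (\sum_i c i * y i) -> forall i, rho (c i) = 0.
Proof.
move=> yind /gen_ideal_sqr[m hm hc] i.
have := yind (fun i => c i - m i); rewrite (eq_bigr (fun i => c i * y i - m i * y i)).
  by rewrite sumrB hc subrr => /(_ erefl i); rewrite rmorphB hm subr0.
by move=> j _; rewrite mulrBl.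
Qed.

Lemma coef_boundary_max (w : exterior S n) B : (forall i, rho (y i) = 0) ->
  rho (ext_coef B (koszul_d y w)) = 0.
Proof.
move=> hy; rewrite coef_koszul rmorph_sum big1 // => i _.
by rewrite !rmorphM hy mul0r mulr0.
Qed.
End Independence.

(** A relation among the x is a 1-cycle. Exactness makes it a boundary, and boundaries have
    coefficients in the maximal ideal. *)
Lemma koszul_resolution_independent (Q : comNzRingType) (k : fieldType)
    (rho : {rmorphism Q -> k}) n (x : 'I_n -> Q) :
  koszul_resolution rho x -> independent rho x.
Proof.
move=> [gen_x exact_x] c hc i.
have hx j : rho (x j) = 0 by exact: gen_mem j gen_x.
have [||w hw] := exact_x 1%N (ext_vec c) isT.
- by rewrite -[ext_vec c]ext_mulr1 comp_vec_mul comp_one.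
- by rewrite -[ext_vec c]ext_mulr1 koszul_vec_mul hc koszul_one scale0r
    (bilin0r (ga_bilin _)) subrr.
rewrite -(coef_boundary_max w [set i] hx) -hw; congr (rho _).
rewrite /ext_vec linear_sum (bigD1 i) //= linearZ /= coef_basis eqxx.
rewrite big1 ?addr0 => [|j ne]; first by rewrite [RHS]mulr1.
rewrite linearZ /= coef_basis; case: eqP => [/set1_inj ij|_]; last exact: mulr0.
by rewrite ij eqxx in ne.
Qed.

Lemma is_homology_ext_map (B Q : comNzRingType) (k : fieldType) (pi : {rmorphism Q -> B})
    (rho : {rmorphism Q -> k}) (A : gralg k) m n (x : 'I_m -> B) (y : 'I_n -> B)
    (M : 'I_n -> 'I_m -> B) (N : 'I_m -> 'I_n -> B) :
  (forall i l, \sum_j M i j * N j l = (i == l)%:R) ->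
  (forall j l, \sum_i N j i * M i l = (j == l)%:R) ->
  (forall i, y i = \sum_j M i j * x j) ->
  is_homology (koszul_d x) pi rho A -> is_homology (koszul_d y) pi rho A.
Proof.
move=> MN NM yE [cl [cl_surj cl_bd cl_lin cl_mul cl_comp]].
have xE j : x j = \sum_i N j i * y i.
  under eq_bigr do rewrite yE mulr_sumr.
  rewrite exchange_big (bigD1 j) //= -[LHS]mul1r.
  under eq_bigr do rewrite mulrA.
  rewrite -mulr_suml NM eqxx big1 ?addr0 // => l ne.
  under eq_bigr do rewrite mulrA.
  by rewrite -mulr_suml NM eq_sym (negPf ne) mul0r.
have cyc z : koszul_d y z = 0 -> koszul_d x (ext_map M z) = 0.
  by move=> hz; rewrite (ext_map_koszul _ yE) hz linear0.
have MK := ext_mapK MN; have NK := ext_mapK NM.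
exists (cl \o ext_map M); split=> /=.
- move=> a; have [z hz <-] := cl_surj a; exists (ext_map N z); last by rewrite NK.
  by rewrite (ext_map_koszul _ xE) hz linear0.
- move=> z hz; rewrite (cl_bd _ (cyc _ hz)); split=> [[w hw]|[w ->]].
    by exists (ext_map N w); rewrite (ext_map_koszul _ xE) -hw MK.
  by exists (ext_map M w); rewrite (ext_map_koszul _ yE).
- by move=> q z w hz hw; rewrite linearP /= cl_lin //; exact: cyc.
- by move=> z w hz hw; rewrite ext_map_mul cl_mul //; exact: cyc.
- by move=> i z hz; rewrite ext_map_comp cl_comp //; exact: cyc.
Qed.

(** * Comparison of generators through a minimal Cohen presentation *)

Section CohenPresentation.
Variables (S S' Q : comNzRingType) (k : fieldType) (rho : {rmorphism S -> k}).
Variables (c : {rmorphism S -> S'}) (rhoQ : {rmorphism Q -> k}) (pi : {rmorphism Q -> S'}).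
Hypothesis S_local : noetherian_local rho.
Hypothesis c_completion : is_completion rho c.
Hypothesis pi_surj : forall z, exists q, pi q = z.
Hypothesis rho_compat : forall x q, c x = pi q -> rho x = rhoQ q.
Variables (n : nat) (y : 'I_n -> S).
Hypothesis y_min : min_gen (max_ideal rho) y.

Let M z := exists2 x, max_ideal rho x & z = c x.

Let dens N z : exists x, ideal_pow M N (z - c x).
Proof. by case: c_completion => _ h _; exact: h. Qed.
Let topo N x : ideal_pow M N (c x) <-> ideal_pow (max_ideal rho) N x.
Proof. by case: c_completion => _ _; apply. Qed.
Let y_max i : max_ideal rho (y i).
Proof. exact: gen_mem i y_min.1. Qed.
Let cyM i : M ((c \o y) i). Proof. by exists (y i). Qed.
Let Mgen z : M z -> gen_ideal (c \o y) z.
Proof.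
move=> [x /y_min.1[e ->] ->]; exists (c \o e); rewrite rmorph_sum.
by apply: eq_bigr => i _; rewrite rmorphM.
Qed.

Let pow1_gen z : ideal_pow M 1 z -> gen_ideal (c \o y) z.
Proof.
move=> [p [e [a [Ma ->]]]].
have h i : gen_ideal (c \o y) (e i * \prod_j a i j).
  rewrite big_ord1; have [f ->] := Mgen (Ma i ord0).
  by exists (fun l => e i * f l); rewrite mulr_sumr; apply: eq_bigr => l _; rewrite mulrA.
have [f hf] := choice h; exists (fun l => \sum_i f i l).
under eq_bigr do rewrite hf.
by rewrite exchange_big; apply: eq_bigr => l _; rewrite mulr_suml.
Qed.

Let gen_lift z : gen_ideal (c \o y) z -> exists2 q, rhoQ q = 0 & z = pi q.
Proof.
move=> [e ->]; have [q hq] := choice (fun i => pi_surj (e i)).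
have [r hr] := choice (fun i => pi_surj (c (y i))).
exists (\sum_i q i * r i).
  rewrite rmorph_sum big1 // => i _; rewrite rmorphM -(rho_compat (x := y i) (q := r i)) ?hr //.
  by rewrite (y_max i : rho _ = 0) mulr0.
by rewrite rmorph_sum; apply: eq_bigr => i _; rewrite rmorphM hq hr.
Qed.

(** Density writes [pi q] as [c x] plus an element of m S'; that element lifts to residue 0 in Q, so
    compatibility of the residue maps places x in m. *)
Let max_gen q : rhoQ q = 0 -> gen_ideal (c \o y) (pi q).
Proof.
move=> q0; have [x hx] := dens 1%N (pi q).
have [e he] := pow1_gen hx; have [q' q'0 hq'] := gen_lift (pow1_gen hx).
have : rho x = 0.
  rewrite (rho_compat (q := q - q')) ?rmorphB ?q0 ?q'0 ?subrr // -hq'.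
  by rewrite opprB addrC subrK.
move=> /y_min.1[f hf]; exists (fun i => c (f i) + e i).
rewrite -[LHS](subrK (c x)) addrC he hf rmorph_sum -big_split.
by apply: eq_bigr => i _; rewrite mulrDl rmorphM.
Qed.

(** Each [pi (q i)] is approximated modulo m S' by some [c (r i)]. The sum of the [r i * y i] then
    maps into m^2 S', hence lies in m^2 because the topology of S is the induced one, and
    independence in m/m^2 applies to the [r i]. *)
Lemma completion_independent (q : 'I_n -> Q) :
  \sum_i pi (q i) * c (y i) = 0 -> forall i, rhoQ (q i) = 0.
Proof.
move=> hq; have [r hr] := choice (fun i => dens 1%N (pi (q i))).
have hr0 i : rho (r i) = rhoQ (q i).
  have [q' q'0 hq'] := gen_lift (pow1_gen (hr i)).
  rewrite (rho_compat (q := q i - q')) ?rmorphB ?q'0 ?subr0 // -hq'.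
  by rewrite opprB addrC subrK.
move=> i; rewrite -hr0; have [_ unitS _] := S_local.
apply: (independent_sqr (fun z => (y_min.1 z).1) (min_gen_independent unitS y_min)).
apply/topo.
have -> : c (\sum_i r i * y i) = - \sum_i c (y i) * (pi (q i) - c (r i)).
  rewrite -[LHS]subr0 -[X in _ - X]hq rmorph_sum.
  rewrite -sumrB -sumrN; apply: eq_bigr => j _.
  by rewrite rmorphM mulrBr opprB ![c (y j) * _]mulrC.
apply: ideal_powN; apply: ideal_pow_sum => j; apply: (ideal_powS cyM); exact: hr.
Qed.

(** The two sequences generate the same ideal of S', so matrices A and B express each through the
    other. Independence makes AB and BA the identity over k; for BA this uses that the kernel of
    [pi] lies in the square of the maximal ideal of Q. Hence the sizes agree and det A is a unit. *)
Lemma cohen_matrices m (x : 'I_m -> Q) :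
  (forall q, pi q = 0 -> ideal_pow (max_ideal rhoQ) 2 q) ->
  (forall q, rhoQ q <> 0 -> exists q', q * q' = 1) ->
  (forall q, max_ideal rhoQ q <-> gen_ideal x q) -> independent rhoQ x ->
  exists (U : 'I_n -> 'I_m -> S') (V : 'I_m -> 'I_n -> S'),
    [/\ forall i l, \sum_j U i j * V j l = (i == l)%:R,
        forall j l, \sum_i V j i * U i l = (j == l)%:R
      & forall i, (c \o y) i = \sum_j U i j * (pi \o x) j].
Proof.
move=> ker_pi unitQ genx indx.
have hx j : rhoQ (x j) = 0 by exact: gen_mem j genx.
have hM i : exists a : 'I_m -> Q, c (y i) = \sum_j pi (a j) * pi (x j).
  have [q q0 hq] : exists2 q, rhoQ q = 0 & c (y i) = pi q.
    by apply: gen_lift; apply: Mgen; exact: cyM.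
  have [a ha] := (genx q).1 q0; exists a; rewrite hq ha rmorph_sum.
  by apply: eq_bigr => j _; rewrite rmorphM.
have hN j : exists b : 'I_n -> Q, pi (x j) = \sum_i pi (b i) * c (y i).
  have [e he] := max_gen (hx j); have [b hb] := choice (fun i => pi_surj (e i)).
  by exists b; rewrite he; apply: eq_bigr => i _; rewrite hb.
have [a ha] := choice hM; have [b hb] := choice hN.
pose A : 'M[Q]_(n, m) := \matrix_(i, j) a i j.
pose B : 'M[Q]_(m, n) := \matrix_(i, j) b i j.
have AB : map_mx rhoQ A *m map_mx rhoQ B = 1%:M.
  rewrite -map_mxM; apply/matrixP => i l; rewrite mxE [RHS]mxE.
  have := completion_independent (q := fun l => (A *m B) i l - (i == l)%:R) _ l.
  rewrite rmorphB rmorph_nat => h; apply/eqP; rewrite -subr_eq0; apply/eqP/h.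
  under eq_bigr do rewrite rmorphB rmorph_nat mulrBl.
  rewrite sumrB [X in _ - X](bigD1 i) //= eqxx mul1r [X in _ - (_ + X)]big1 ?addr0; last first.
    by move=> j; rewrite eq_sym => /negPf ->; rewrite mul0r.
  rewrite ha; under [X in _ - X]eq_bigr do rewrite hb mulr_sumr.
  rewrite exchange_big -sumrB big1 // => j _ /=; rewrite mxE rmorph_sum mulr_suml.
  by rewrite -sumrB big1 // => j' _; rewrite !mxE rmorphM mulrA subrr.
have BA : map_mx rhoQ B *m map_mx rhoQ A = 1%:M.
  rewrite -map_mxM; apply/matrixP => j l; rewrite mxE [RHS]mxE.
  have := independent_sqr (fun z => (genx z).1) (c := fun l => (B *m A) j l - (j == l)%:R) indx _ l.
  rewrite rmorphB rmorph_nat => h; apply/eqP; rewrite -subr_eq0; apply/eqP/h.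
  apply: ker_pi; rewrite rmorph_sum.
  under eq_bigr do rewrite rmorphM rmorphB rmorph_nat mulrBl.
  rewrite sumrB [X in _ - X](bigD1 j) //= eqxx mul1r [X in _ - (_ + X)]big1 ?addr0; last first.
    by move=> j'; rewrite eq_sym => /negPf ->; rewrite mul0r.
  rewrite hb; under [X in _ - X]eq_bigr do rewrite ha mulr_sumr.
  rewrite exchange_big -sumrB big1 // => j' _ /=; rewrite mxE rmorph_sum mulr_suml.
  by rewrite -sumrB big1 // => i _; rewrite !mxE rmorphM mulrA subrr.
have mn : n = m by apply/eqP; rewrite eqn_leq (mulmx1_min AB) (mulmx1_min BA).
case: _ / mn in x genx indx hx a ha b hb A B AB BA {hM hN} *.
have [_ detA] : rhoQ (\det A) * rhoQ (\det B) = 1 /\ rhoQ (\det A) <> 0.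
  have h : rhoQ (\det A) * rhoQ (\det B) = 1 by rewrite -!det_map_mx -det_mulmx AB det1.
  by split=> // d0; move: h; rewrite d0 mul0r => /eqP; rewrite eq_sym oner_eq0.
have [u hu] := unitQ _ detA.
(* B inverts A only over k; the inverse over S' is the adjugate of A multiplied by the inverse u of
   its determinant. *)
exists (fun i j => pi (A i j)), (fun i j => pi (u * (\adj A) i j)); split.
- move=> i l; have := congr1 (fun X : 'M_n => pi (u * X i l)) (mul_mx_adj A).
  rewrite /= !mxE mulr_sumr rmorph_sum mulrnAr mulrC hu rmorphMn rmorph1 => <-.
  by apply: eq_bigr => j _; rewrite -rmorphM mulrCA.
- move=> i l; have := congr1 (fun X : 'M_n => pi (u * X i l)) (mul_adj_mx A).
  rewrite /= !mxE mulr_sumr rmorph_sum mulrnAr mulrC hu rmorphMn rmorph1 => <-.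
  by apply: eq_bigr => j _; rewrite -rmorphM mulrA.
- by move=> i; rewrite /= ha; apply: eq_bigr => j _; rewrite mxE.
Qed.

End CohenPresentation.

Lemma is_homology_completion (S S' Q : comNzRingType) (k : fieldType)
    (rho : {rmorphism S -> k}) (c : {rmorphism S -> S'}) (rhoQ : {rmorphism Q -> k})
    (pi : {rmorphism Q -> S'}) (n : nat) (y : 'I_n -> S) (A : gralg k) :
  noetherian S -> noetherian S' -> is_completion rho c ->
  (forall z, exists q, pi q = z) -> (forall x q, c x = pi q -> rho x = rhoQ q) ->
  (forall z, max_ideal rho z <-> gen_ideal y z) ->
  is_homology (koszul_d (c \o y)) pi rhoQ A -> is_homology (koszul_d y) idfun rho A.
Proof.
move=> nS nS' [_ dens topo] pi_surj compat ygen [cl [cl_surj cl_bd cl_lin cl_mul cl_comp]].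
set M := (fun _ => ex2 _ _) in dens topo.
have ymax i : max_ideal rho (y i) by exact: gen_mem i ygen.
have Mgen z : M z -> gen_ideal (c \o y) z.
  move=> [x /ygen[e ->] ->]; exists (c \o e); rewrite rmorph_sum.
  by apply: eq_bigr => i _; rewrite rmorphM.
have cyM i : M ((c \o y) i) by exists (y i).
have ext_dens N (w : exterior S' n) : exists w0 : exterior S n,
    mul_pow (c \o y) N (@full S' (exterior S' n)) (w - ext_base c w0).
  have [f hf] := choice (fun B => dens N (ext_coef B w)).
  exists (ext_of f); apply: (mul_pow_coefs Mgen) => B.
  by rewrite linearB /= coef_base coef_ext_of; exact: hf.
have ext_topo N (z : exterior S n) :
    mul_pow (c \o y) N (@full S' (exterior S' n)) (ext_base c z) ->
    mul_pow y N (@full S (exterior S n)) z.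
  move=> hz; apply: (mul_pow_coefs (fun z => (ygen z).1)) => B.
  by apply/topo; rewrite -coef_base; exact: (coef_mul_pow cyM).
have cyc (z : exterior S n) : koszul_d y z = 0 -> koszul_d (c \o y) (ext_base c z) = 0.
  by move=> hz; rewrite -ext_base_koszul hz ext_base0.
have accS := exterior_acc (n := n) nS; have accS' := exterior_acc (n := n) nS'.
exists (fun z => cl (ext_base c z)); split=> /=.
- move=> a; have [w hw <-] := cl_surj a.
  (* Cycles over S' in m^L are boundaries, and a boundary over S in m^N has a primitive in m^L. With
     w approximated to both orders by w0, the boundary of w0 lies in m^N and has a primitive u in
     m^L; the cycle w0 - u differs from w by a cycle in m^L. *)
  have [L hL] := weak_artin_rees (c \o y) accS' (cycles_submodule (c \o y)).
  have [N hN] := artin_rees y L accS (boundaries_submodule y).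
  have [w0 hw0] := ext_dens (maxn N L) w; set e := w - _ in hw0.
  have : mul_pow y N (@full S (exterior S n)) (koszul_d y w0).
    apply: ext_topo; rewrite ext_base_koszul.
    have -> : koszul_d (c \o y) (ext_base c w0) = (-1) *: koszul_d (c \o y) e.
      by rewrite /e linearB /= hw sub0r scaleN1r opprK.
    apply: submoduleZ; first exact: mul_pow_submodule (full_submodule _).
    by apply: mul_pow_koszul; apply: mul_pow_leq hw0; rewrite ?leq_maxl.
  move=> /(hN _ (ex_intro _ w0 erefl))/mul_pow_boundaries[u hu du].
  have hz : koszul_d y (w0 - u) = 0 by rewrite linearB /= du subrr.
  exists (w0 - u) => //.
  have [v hv] : boundaries (c \o y) (w - ext_base c (w0 - u)).
    apply: mul_ideal_cycles; apply: hL.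
      by rewrite /cycles linearB /= hw cyc // subr0.
    have -> : w - ext_base c (w0 - u) = e + ext_base c u.
      by rewrite /e ext_baseD ext_baseN opprD opprK addrA.
    apply: submoduleD; first exact: mul_pow_submodule (full_submodule _).
      by apply: mul_pow_leq hw0; rewrite ?leq_maxr.
    exact: mul_pow_base.
  have hwz := cyc _ hz.
  have cl0 v' : cl (koszul_d (c \o y) v') = 0 by apply/cl_bd; [exact: koszul_sq|exists v'].
  rewrite -[w](subrK (ext_base c (w0 - u))) hv.
  have := cl_lin 1 _ _ (koszul_sq (c \o y) v) hwz.
  by rewrite !rmorph1 !scale1r cl0 add0r => ->.
- move=> z hz; rewrite (cl_bd _ (cyc _ hz)); split=> [[w hw]|[w ->]]; last first.
    by exists (ext_base c w); rewrite ext_base_koszul.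
  (* If z becomes d w over S' and w0 approximates w, then z - d w0 is a cycle over S in m^N, hence a
     boundary. *)
  have [N hN] := weak_artin_rees y accS (cycles_submodule y).
  have [w0 hw0] := ext_dens N w.
  have : boundaries y (z - koszul_d y w0).
    apply: mul_ideal_cycles; apply: hN.
      by rewrite /cycles linearB /= hz koszul_sq subr0.
    apply: ext_topo; rewrite ext_baseD ext_baseN ext_base_koszul hw -linearB.
    exact: mul_pow_koszul.
  by move=> [v hv]; exists (v + w0); rewrite linearD /= -hv subrK.
- move=> q z w hz hw; have [q' hq'] := pi_surj (c q).
  rewrite ext_baseD ext_baseZ -hq' (compat q q') //.
  by rewrite cl_lin //; exact: cyc.
- by move=> z w hz hw; rewrite ext_base_mul cl_mul //; exact: cyc.
- by move=> i z hz; rewrite ext_base_comp cl_comp //; exact: cyc.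
Qed.

Lemma Tor_algebra_koszul (S : comNzRingType) (k : fieldType) (rho : {rmorphism S -> k})
    (A : gralg k) n (y : 'I_n -> S) :
  noetherian_local rho -> min_gen (max_ideal rho) y -> is_Tor_algebra rho A ->
  is_homology (koszul_d y) idfun rho A.
Proof.
move=> S_local ymin [S' [Q [c [rhoQ [pi []]]]]].
move=> [compl [n' [y' [_ [Q_reg _] pi_surj ker_pi compat]]]] [m [x [x_res hA]]]; have [[_ unitQ nQ] _ _] := Q_reg.
have [U [V [UV VU yE]]] := cohen_matrices S_local compl pi_surj compat ymin ker_pi unitQ
  x_res.1 (koszul_resolution_independent x_res).
have [_ _ nS] := S_local.
apply: (is_homology_completion nS (noetherian_surj pi_surj nQ) compl pi_surj compat ymin.1).
exact: is_homology_ext_map UV VU yE hA.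
Qed.

(** * Classes of Koszul cycles *)

Section GradedSign.
Variables (K : comNzRingType) (A : grmod K).
Implicit Types a b : A.

Lemma grmod_ind (P : A -> Prop) : P 0 -> (forall a b, P a -> P b -> P (a + b)) ->
  (forall i a, gm_comp A i a = a -> P a) -> forall a, P a.
Proof.
move=> P0 PD Ph a; rewrite (gm_boundP a); apply: (big_ind P) => // i _.
by apply: (Ph i); rewrite gm_compK eqxx.
Qed.

Definition gr_sign p a : A := gsum (fun q x => (-1) ^+ (p * q) *: x) a.

Let sign_lin p : forall q : nat, linear (fun x : A => (-1) ^+ (p * q) *: x : A).
Proof. by move=> q c x y; rewrite scalerDr !scalerA mulrC. Qed.

Fact gr_sign_linear p : linear (gr_sign p).
Proof. exact: gsum_linear. Qed.
HB.instance Definition _ p := GRing.isLinear.Build K A A _ (gr_sign p) (gr_sign_linear p).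

Lemma gr_sign_hom p q a : gm_comp A q a = a -> gr_sign p a = (-1) ^+ (p * q) *: a.
Proof. by move=> ha; rewrite /gr_sign (gsum_hom (sign_lin p) ha). Qed.

Lemma gr_signE p a N : (gm_bound a <= N)%N ->
  gr_sign p a = \sum_(q < N) (-1) ^+ (p * q) *: gm_comp A q a.
Proof. by move=> h; rewrite /gr_sign (gsumE (sign_lin p) h). Qed.

Lemma comp_gr_sign i p a : gm_comp A i (gr_sign p a) = (-1) ^+ (p * i) *: gm_comp A i a.
Proof.
elim/grmod_ind: a => [|a b ha hb|j a ha]; first by rewrite !linear0 ?scaler0.
  by rewrite !linearD /= ha hb ?scalerDr.
rewrite (gr_sign_hom p ha) linearZ /=; have := gm_compK i j a; rewrite ha.
by case: eqP => [-> ->|_ ->] //; rewrite !scaler0.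
Qed.
End GradedSign.

Lemma tlift_sum (K : comNzRingType) (U V W : lmodType K) (f : U -> V -> W)
    I (r : seq I) (F : I -> tens U V) : bilin f ->
  tlift f (\sum_(i <- r) F i) = \sum_(i <- r) tlift f (F i).
Proof.
move=> bf; apply: (big_morph (tlift f) _ (tlift0 bf)) => u v.
exact: (tliftD u v bf).
Qed.

Section TensorProduct.
Variables (K : comNzRingType) (A B : gralg K).
Let bt := ga_bilin (gtens A B).
Let bp := @pure_bilin K A B.

(** Homogeneity of one inner factor suffices, since [gr_sign] carries the sign on the other. In the
    application the basis elements are homogeneous but the homology classes are not. *)
Lemma gtens_mul_signl p (a a' : A) (b b' : B) : gm_comp A p a' = a' ->
  ga_mul (pure a b : gtens A B) (pure a' b') = pure (ga_mul a a') (ga_mul (gr_sign p b) b').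
Proof.
move=> ha'; elim/grmod_ind: b => [|b1 b2 h1 h2|q b hb].
- by rewrite linear0 (bilin0l (ga_bilin B)) !(bilin0r bp) (bilin0l bt).
- by rewrite linearD (bilinDl (ga_bilin B)) !(bilinDr bp) (bilinDl bt) h1 h2.
rewrite [LHS](gtens_mul_pure _ _ hb ha') (gr_sign_hom _ hb).
by rewrite (bilinZl (ga_bilin B)) (bilinZr bp).
Qed.

Lemma gtens_mul_signr q (a a' : A) (b b' : B) : gm_comp B q b = b ->
  ga_mul (pure a b : gtens A B) (pure a' b') = pure (ga_mul a (gr_sign q a')) (ga_mul b b').
Proof.
move=> hb; elim/grmod_ind: a' => [|a1 a2 h1 h2|p a' ha'].
- by rewrite linear0 (bilin0r (ga_bilin A)) !(bilin0l bp) (bilin0r bt).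
- by rewrite linearD (bilinDr (ga_bilin A)) !(bilinDl bp) (bilinDr bt) h1 h2.
rewrite [LHS](gtens_mul_pure _ _ hb ha') (gr_sign_hom _ ha').
by rewrite (bilinZr (ga_bilin A)) (bilinZl bp) mulnC.
Qed.

Lemma gtens_comp_purel p i (a : A) (b : B) : gm_comp A p a = a ->
  gm_comp (gtens A B) i (pure a b) =
  if (p <= i)%N then pure a (gm_comp B (i - p) b) else 0.
Proof.
move=> ha; elim/grmod_ind: b => [|b1 b2 h1 h2|q b hb].
- by rewrite !(linear0, bilin0r bp); case: ifP.
- rewrite !(linearD, bilinDr bp) /= h1 h2; case: ifP => _; rewrite ?addr0 //.
rewrite [LHS](gtens_comp_pure _ ha hb) -{2}hb gm_compK hb.
case: leqP => le; last by rewrite (ltn_eqF (leq_trans le (leq_addr _ _))).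
rewrite -{1}(subnKC le) eqn_add2l; case: eqP => // _; exact/esym/(bilin0r bp).
Qed.

Lemma gtens_comp_purer q i (a : A) (b : B) : gm_comp B q b = b ->
  gm_comp (gtens A B) i (pure a b) =
  if (q <= i)%N then pure (gm_comp A (i - q) a) b else 0.
Proof.
move=> hb; elim/grmod_ind: a => [|b1 b2 h1 h2|p a ha].
- by rewrite !(linear0, bilin0l bp); case: ifP.
- rewrite !(linearD, bilinDl bp) /= h1 h2; case: ifP => _; rewrite ?addr0 //.
rewrite [LHS](gtens_comp_pure _ ha hb) -{2}ha gm_compK ha.
case: leqP => le; last by rewrite (ltn_eqF (leq_trans le (leq_addl _ _))).
rewrite -{1}(subnK le) eqn_add2r; case: eqP => // _; exact/esym/(bilin0l bp).
Qed.
End TensorProduct.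

Section PositivePart.
Variables (K : comNzRingType) (A : gralg K).

Fact pos_part_subproof (a : A) : pos_pred (a - gm_comp A 0 a).
Proof. by apply/eqP; rewrite linearB /= gm_compK eqxx subrr. Qed.
Definition pos_part (a : A) : pos A := Pos (pos_part_subproof a).

Lemma pos_partK a : gm_comp A 0 a = 0 -> pos_val (pos_part a) = a.
Proof. by move=> h /=; rewrite h subr0. Qed.

Lemma pos_val_inj (a b : pos A) : pos_val a = pos_val b -> a = b.
Proof. exact: val_inj. Qed.

Lemma pos_val0 (a : pos A) : gm_comp A 0 (pos_val a) = 0.
Proof. by case: a => a /= /eqP. Qed.

Lemma pos_valK (a : pos A) : pos_part (pos_val a) = a.
Proof. by apply: pos_val_inj; rewrite pos_partK // pos_val0. Qed.

Fact pos_part_linear : linear pos_part.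
Proof.
move=> c a b; apply: pos_val_inj; rewrite [RHS]pos_val_linear /= linearP /=.
by rewrite opprD addrACA scalerBr.
Qed.
HB.instance Definition _ := GRing.isLinear.Build K A (pos A) _ pos_part pos_part_linear.

Lemma pos_part_mul a b : gm_comp A 0 a = 0 -> gm_comp A 0 b = 0 ->
  pos_part (ga_mul a b) = ga_mul (pos_part a) (pos_part b).
Proof.
move=> ha hb; have h : gm_comp A 0 (ga_mul a b) = 0.
  by have := pos_val0 (ga_mul (pos_part a) (pos_part b)); rewrite /= ha hb !subr0.
by apply: pos_val_inj; rewrite /= ha hb h !subr0.
Qed.

Lemma comp_pos_val i (a : pos A) : pos_val (gm_comp (pos A) i a) = gm_comp A i (pos_val a).
Proof. by []. Qed.

Lemma comp_pos_part i a : gm_comp (pos A) i (pos_part a) = pos_part (gm_comp A i a).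
Proof.
apply: pos_val_inj; rewrite comp_pos_val /= linearB /= !gm_compK eq_sym.
by case: eqP => [<-|].
Qed.

Lemma pos_part_sign p a : pos_part (gr_sign p a) = gr_sign p (pos_part a).
Proof.
elim/grmod_ind: a => [|a b ha hb|q a ha]; first by rewrite !linear0.
  by rewrite !linearD /= ha hb.
rewrite (gr_sign_hom p ha) linearZ; rewrite (@gr_sign_hom _ _ p q) //.
by rewrite comp_pos_part ha.
Qed.
End PositivePart.

Lemma ext_sign_comps (K : comNzRingType) n p (f : exterior K n) N : (n < N)%N ->
  ext_sign p f = \sum_(q < N) (-1) ^+ (p * q) *: gm_comp (exterior K n) q f.
Proof.
move=> nN; apply: ext_coefP => B; rewrite coef_sign linear_sum.
have hB : (#|B| < N)%N by apply: leq_ltn_trans nN; rewrite -[X in (_ <= X)%N]card_ord max_card.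
rewrite (bigD1 (Ordinal hB)) //= linearZ /= coef_comp eqxx big1 ?addr0 // => q.
by rewrite -val_eqE /= eq_sym linearZ /= coef_comp => /negPf ->; exact: mulr0.
Qed.

(** * Homology classes and their minimal representatives *)

Section KoszulHomology.
Variables (S : comNzRingType) (k : fieldType) (rho : {rmorphism S -> k}).
Variables (n : nat) (y : 'I_n -> S) (A : gralg k).
Local Notation E := (exterior S n).
Local Notation d := (koszul_d y).

Definition class_map (cl : E -> A) : Prop :=
  [/\ forall a, exists2 z, d z = 0 & cl z = a,
      forall z, d z = 0 -> (cl z = 0 <-> exists w, z = d w),
      forall q z w, d z = 0 -> d w = 0 -> cl (q *: z + w) = rho q *: cl z + cl w,
      forall z w, d z = 0 -> d w = 0 -> cl (ga_mul z w) = ga_mul (cl z) (cl w)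
    & forall i z, d z = 0 -> cl (gm_comp E i z) = gm_comp A i (cl z)].

(** Representatives of the classes in A^+. By [cycle_coef_max] the second condition restricts only
    the coefficient of degree 0; boundaries satisfy it, and products of such cycles do again. *)
Definition min_cycle (z : E) := d z = 0 /\ forall B, rho (ext_coef B z) = 0.

Hypothesis y_max : forall z, max_ideal rho z <-> gen_ideal y z.
Hypothesis y_ind : independent rho y.
Variable cl : E -> A.
Hypothesis cl_class : class_map cl.

Let rho_y i : rho (y i) = 0.
Proof. exact: gen_mem i y_max. Qed.

Lemma class_boundary w : cl (d w) = 0.
Proof. by case: cl_class => _ h _ _ _; apply/h; [exact: koszul_sq|exists w]. Qed.

Lemma class0 : cl 0 = 0.
Proof. by rewrite -(linear0 d) class_boundary. Qed.

Lemma class_lin q z w : d z = 0 -> d w = 0 -> cl (q *: z + w) = rho q *: cl z + cl w.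
Proof. by case: cl_class => _ _ h _ _; exact: h. Qed.

Lemma classD z w : d z = 0 -> d w = 0 -> cl (z + w) = cl z + cl w.
Proof. by move=> hz hw; rewrite -[z]scale1r class_lin // rmorph1 !scale1r. Qed.

Lemma classZ q z : d z = 0 -> cl (q *: z) = rho q *: cl z.
Proof. by move=> hz; rewrite -[q *: z]addr0 class_lin ?linear0 // class0 addr0. Qed.

Lemma classB z w : d z = 0 -> d w = 0 -> cl (z - w) = cl z - cl w.
Proof. by move=> hz hw; rewrite -scaleN1r addrC class_lin // rmorphN1 scaleN1r addrC. Qed.

Lemma class_sum I (r : seq I) (P : pred I) (F : I -> E) : (forall i, d (F i) = 0) ->
  cl (\sum_(i <- r | P i) F i) = \sum_(i <- r | P i) cl (F i).
Proof.
move=> hF; elim: r => [|i r IH]; first by rewrite !big_nil class0.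
rewrite !big_cons; case: ifP => // _.
by rewrite classD ?IH // linear_sum big1 // => j _; exact: hF.
Qed.

Lemma class_mul z w : d z = 0 -> d w = 0 -> cl (ga_mul z w) = ga_mul (cl z) (cl w).
Proof. by case: cl_class => _ _ _ h _; exact: h. Qed.

Lemma class_comp i z : d z = 0 -> cl (gm_comp E i z) = gm_comp A i (cl z).
Proof. by case: cl_class => _ _ _ _ h; exact: h. Qed.

Lemma class_eq0 z : d z = 0 -> cl z = 0 -> exists w, z = d w.
Proof. by move=> hz; case: cl_class => _ h _ _ _; move/h; apply. Qed.

Lemma comp_cycle i z : d z = 0 -> d (gm_comp E i z) = 0.
Proof. by case: i => [|i] hz; [exact: koszul_comp0|rewrite koszul_comp hz linear0]. Qed.

Lemma sign_cycle p z : d z = 0 -> d (ext_sign p z) = 0.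
Proof.
move=> hz; rewrite (ext_sign_comps p z (leqnn _)) linear_sum big1 // => i _.
by rewrite linearZ /= comp_cycle // scaler0.
Qed.

Lemma class_sign p z : d z = 0 -> cl (ext_sign p z) = gr_sign p (cl z).
Proof.
move=> hz; pose N := maxn n.+1 (gm_bound (cl z)).
rewrite (@ext_sign_comps _ _ p z N) ?leq_maxl //.
rewrite (@gr_signE _ _ p _ N) ?leq_maxr // class_sum; last first.
  by move=> i; rewrite linearZ /= comp_cycle // scaler0.
apply: eq_bigr => i _.
by rewrite classZ ?comp_cycle // rmorph_sign class_comp.
Qed.

Lemma coef0_comp0 z : gm_comp E 0 z = ext_coef set0 z *: ext_one S n.
Proof.
apply: ext_coefP => B; rewrite coef_comp linearZ /= ext_one_basis coef_basis cards_eq0.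
by case: eqP => [->|_]; [rewrite [RHS]mulr1|rewrite [RHS]mulr0].
Qed.

Lemma max_scale_one_boundary c : rho c = 0 -> exists w, c *: ext_one S n = d w.
Proof.
move=> /y_max[e ->]; exists (\sum_i e i *: ext_basis S [set i]).
rewrite scaler_suml linear_sum; apply: eq_bigr => i _.
by rewrite linearZ /= koszul_gen scalerA.
Qed.

Lemma class_comp0 z : d z = 0 -> rho (ext_coef set0 z) = 0 -> gm_comp A 0 (cl z) = 0.
Proof.
move=> hz h0; rewrite -class_comp // coef0_comp0.
by have [w ->] := max_scale_one_boundary h0; exact: class_boundary.
Qed.

(** For i in B, the vanishing of the coefficient of [d z] at B minus i is a relation among the y in
    which [y i] has, up to sign, the coefficient of z at B. *)
Lemma cycle_coef_max z B : d z = 0 -> B != set0 -> rho (ext_coef B z) = 0.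
Proof.
move=> hz /set0Pn[i iB]; pose C := B :\ i.
have := congr1 (ext_coef C) hz; rewrite linear0 coef_koszul => h.
have := y_ind (c := fun j => if j \notin C then (-1) ^+ inv [set j] C * ext_coef (j |: C) z else 0).
move=> /(_ _ i); rewrite setD11 /= setD1K // rmorphM rmorph_sign => h'.
have /h' : \sum_j (if j \notin C then (-1) ^+ inv [set j] C * ext_coef (j |: C) z else 0) * y j = 0.
  rewrite -[RHS]h [RHS]big_mkcond; apply: eq_bigr => j _.
  by case: ifP => _; rewrite ?mul0r // -mulrA [_ * y j]mulrC.
by move/eqP; rewrite mulf_eq0 signr_eq0 => /eqP.
Qed.

Lemma min_cycle_pos a : gm_comp A 0 a = 0 -> exists2 z, min_cycle z & cl z = a.
Proof.
move=> ha; case: (cl_class) => surj _ _ _ _; have [z hz clz] := surj a.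
have hz' : d (z - gm_comp E 0 z) = 0 by rewrite linearB /= koszul_comp0 subr0.
exists (z - gm_comp E 0 z).
  split=> // B; case: (B =P set0) => [->|/eqP ne]; last exact: cycle_coef_max.
  by rewrite linearB /= coef_comp cards0 eqxx subrr rmorph0.
by rewrite classB ?koszul_comp0 // class_comp // clz ha subr0.
Qed.

Lemma min_cycle_comp0 z : min_cycle z -> gm_comp A 0 (cl z) = 0.
Proof. by move=> [hz h]; exact: class_comp0. Qed.

Lemma min_cycle_lin q z w : min_cycle z -> min_cycle w -> min_cycle (q *: z + w).
Proof.
move=> [hz hz'] [hw hw']; split=> [|B]; first by rewrite linearP /= hz hw scaler0 addr0.
by rewrite linearP /= rmorphD rmorphM hz' hw' mulr0 addr0.
Qed.

Lemma min_cycle_boundary w : min_cycle (d w).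
Proof. by split=> [|B]; [exact: koszul_sq|exact: coef_boundary_max]. Qed.

Lemma min_cycle_mul z w : min_cycle z -> min_cycle w -> min_cycle (ga_mul z w).
Proof.
move=> [hz hz'] [hw _]; split=> [|B].
  by rewrite koszul_mul hz hw (bilin0l (ga_bilin _)) (bilin0r (ga_bilin _)) addr0.
by rewrite coef_mul rmorph_sum big1 // => C _; rewrite !rmorphM hz' mul0r mulr0.
Qed.

Lemma min_cycle_comp i z : min_cycle z -> min_cycle (gm_comp E i z).
Proof.
move=> [hz hz']; split=> [|B]; first exact: comp_cycle.
by rewrite coef_comp; case: ifP => _; rewrite ?rmorph0.
Qed.

(** The class of 1 is not zero, because boundaries have coefficients in the maximal ideal, and it
    spans degree 0, because the degree 0 chains are the multiples of 1. *)
Lemma koszul_homology_connected : (forall c, exists x, rho x = c) -> connected A.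
Proof.
move=> rho_surj; pose u := cl (ext_one S n).
have d1 := koszul_one y; case: (cl_class) => surj _ _ _ _.
have u_neq0 : u <> 0.
  move=> /(class_eq0 d1)[w /(congr1 (ext_coef set0))]; rewrite ext_one_basis coef_basis eqxx.
  move=> /(congr1 rho); rewrite coef_boundary_max // rmorph1 => /eqP.
  by rewrite oner_eq0.
have u0 : gm_comp A 0 u = u by rewrite -class_comp // comp_one.
exists u; split=> // [a|a].
  by have [z hz <-] := surj a; rewrite -!class_mul // ext_mul1 ext_mulr1.
have [z hz za] := surj a.
have a0 : gm_comp A 0 a = rho (ext_coef set0 z) *: u.
  by rewrite -za -class_comp // coef0_comp0 classZ.
exists (rho (ext_coef set0 z), pos_part a); split=> /= [|[c b] /= ab].
  by rewrite a0 addrC subrK.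
have ca : gm_comp A 0 a = c *: u by rewrite ab linearD linearZ /= u0 pos_val0 addr0.
have /eqP : (rho (ext_coef set0 z) - c) *: u = 0 by rewrite scalerBl -a0 -ca subrr.
rewrite scaler_eq0; case: (u =P 0) => // _; rewrite orbF subr_eq0 => /eqP ->.
by congr (_, _); apply: pos_val_inj; rewrite /= ca ab addrC addKr.
Qed.
End KoszulHomology.

(** * Koszul complexes on a concatenated sequence *)

Section JoinSets.
Variables t s : nat.
Implicit Types (A : {set 'I_t}) (B : {set 'I_s}) (C : {set 'I_(t + s)}).

Lemma ord_split_ind (P : 'I_(t + s) -> Prop) :
  (forall i, P (lshift s i)) -> (forall j, P (rshift t j)) -> forall l, P l.
Proof. by move=> hl hr l; rewrite -[l]splitK; case: split. Qed.

Definition join A B : {set 'I_(t + s)} :=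
  [set l | match split l with inl i => i \in A | inr j => j \in B end].
Definition lpart C : {set 'I_t} := [set i | lshift s i \in C].
Definition rpart C : {set 'I_s} := [set j | rshift t j \in C].

Lemma in_joinl A B i : (lshift s i \in join A B) = (i \in A).
Proof. by rewrite inE (unsplitK (inl i)). Qed.
Lemma in_joinr A B j : (rshift t j \in join A B) = (j \in B).
Proof. by rewrite inE (unsplitK (inr j)). Qed.

Let joinE := (in_joinl, in_joinr).

Lemma join_setP C C' : (forall i, (lshift s i \in C) = (lshift s i \in C')) ->
  (forall j, (rshift t j \in C) = (rshift t j \in C')) -> C = C'.
Proof. by move=> hl hr; apply/setP; exact: ord_split_ind. Qed.

Lemma joinK C : join (lpart C) (rpart C) = C.
Proof. by apply: join_setP => i; rewrite joinE inE. Qed.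
Lemma lpart_join A B : lpart (join A B) = A.
Proof. by apply/setP=> i; rewrite inE joinE. Qed.
Lemma rpart_join A B : rpart (join A B) = B.
Proof. by apply/setP=> i; rewrite inE joinE. Qed.

Lemma join0 : join set0 set0 = set0.
Proof. by apply: join_setP => i; rewrite joinE !inE. Qed.

Lemma joinD A B A' B' : join A B :\: join A' B' = join (A :\: A') (B :\: B').
Proof. by apply: join_setP => i; rewrite !(joinE, inE). Qed.

Lemma joinUl i A B : lshift s i |: join A B = join (i |: A) B.
Proof.
apply: join_setP => j; rewrite !(joinE, in_setU1).
  by rewrite (inj_eq (@lshift_inj _ _)).
by rewrite eq_rlshift.
Qed.

Lemma joinUr j A B : rshift t j |: join A B = join A (j |: B).
Proof.
apply: join_setP => i; rewrite !(joinE, in_setU1).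
  by rewrite eq_lrshift.
by rewrite (inj_eq (@rshift_inj _ _)).
Qed.

Lemma set1_lshift i : [set lshift s i] = join [set i] set0.
Proof. by rewrite -[LHS]setU0 -join0 joinUl setU0. Qed.
Lemma set1_rshift j : [set rshift t j] = join set0 [set j].
Proof. by rewrite -[LHS]setU0 -join0 joinUr setU0. Qed.

Lemma join_sub A B A' B' : (join A B \subset join A' B') = (A \subset A') && (B \subset B').
Proof.
apply/subsetP/andP => [h|[/subsetP hA /subsetP hB]].
  split; apply/subsetP=> i iA.
    by have := h (lshift s i); rewrite !joinE; apply.
  by have := h (rshift t i); rewrite !joinE; apply.
by apply: ord_split_ind => i; rewrite !joinE; [exact: hA|exact: hB].
Qed.

Lemma big_join (T : Type) (idx : T) (op : Monoid.com_law idx) A B (F : 'I_(t + s) -> T) :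
  \big[op/idx]_(l in join A B) F l =
  op (\big[op/idx]_(i in A) F (lshift s i)) (\big[op/idx]_(j in B) F (rshift t j)).
Proof.
rewrite big_mkcond big_split_ord /= [in RHS]big_mkcond [X in _ = op _ X]big_mkcond.
by congr (op _ _); apply: eq_bigr => i _; rewrite joinE.
Qed.

Lemma card_join A B : #|join A B| = (#|A| + #|B|)%N.
Proof. by rewrite -!sum1_card big_join. Qed.

(** All right indices exceed all left ones, so each pair from B and A' is an inversion; this is the
    Koszul sign of the tensor product. *)
Lemma inv_join A B A' B' :
  inv (join A B) (join A' B') = (inv A A' + inv B B' + #|B| * #|A'|)%N.
Proof.
rewrite /inv big_join /= -addnA; congr (_ + _)%N.
  apply: eq_bigr => i _; rewrite big_join /= [X in (_ + X)%N]big1 ?addn0 // => j _.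
  by rewrite /= ltnNge (leq_trans (ltnW (ltn_ord i))) // leq_addr.
rewrite -sum1_card big_distrl -big_split; apply: eq_bigr => j _ /=.
rewrite big_join /= addnC mul1n -sum1_card; congr (_ + _)%N; apply: eq_bigr => i _ /=.
  by rewrite ltn_add2l.
by rewrite (leq_trans (ltn_ord i)) // leq_addr.
Qed.

Lemma big_sub_join (T : Type) (idx : T) (op : Monoid.com_law idx) A B (F : {set 'I_(t + s)} -> T) :
  \big[op/idx]_(C : {set 'I_(t + s)} | C \subset join A B) F C =
  \big[op/idx]_(A' : {set 'I_t} | A' \subset A) \big[op/idx]_(B' : {set 'I_s} | B' \subset B)
    F (join A' B').
Proof.
rewrite pair_big (reindex (fun p : {set 'I_t} * {set 'I_s} => join p.1 p.2)) /=.
  by apply: eq_bigl => p; rewrite join_sub.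
exists (fun C => (lpart C, rpart C)) => [[A' B'] _|C _] /=; last exact: joinK.
by rewrite lpart_join rpart_join.
Qed.
End JoinSets.

Section Slices.
Variables (S : comNzRingType) (t s : nat).
Local Notation E := (exterior S (t + s)).
Implicit Types (A : {set 'I_t}) (B : {set 'I_s}) (z w : E).

(** With E seen as the tensor product of [exterior S t] and [exterior S s], this is the coordinate
    of z along [e_A] in the left factor. *)
Definition lslice A z : exterior S s := ext_of (fun B => ext_coef (join A B) z).
Definition rslice B z : exterior S t := ext_of (fun A => ext_coef (join A B) z).

Lemma coef_lslice A B z : ext_coef B (lslice A z) = ext_coef (join A B) z.
Proof. exact: coef_ext_of. Qed.
Lemma coef_rslice A B z : ext_coef A (rslice B z) = ext_coef (join A B) z.
Proof. exact: coef_ext_of. Qed.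

Fact lslice_linear A : linear (lslice A).
Proof. by move=> c z w; apply: ext_coefP => B; rewrite linearP /= !coef_lslice linearP. Qed.
HB.instance Definition _ A :=
  GRing.isLinear.Build S E (exterior S s) _ (lslice A) (lslice_linear A).
Fact rslice_linear B : linear (rslice B).
Proof. by move=> c z w; apply: ext_coefP => A; rewrite linearP /= !coef_rslice linearP. Qed.
HB.instance Definition _ B :=
  GRing.isLinear.Build S E (exterior S t) _ (rslice B) (rslice_linear B).

Lemma coef_koszul_join (y : 'I_(t + s) -> S) A B z :
  ext_coef (join A B) (koszul_d y z) =
  ext_coef A (koszul_d (fun i => y (lshift s i)) (rslice B z)) +
  (-1) ^+ #|A| * ext_coef B (koszul_d (fun j => y (rshift t j)) (lslice A z)).
Proof.
rewrite coef_koszul big_mkcond big_split_ord /=; congr (_ + _).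
  rewrite coef_koszul [RHS]big_mkcond; apply: eq_bigr => i _; rewrite in_joinl.
  by case: ifP => // _; rewrite joinUl set1_lshift inv_join inv0l cards0 mul0n !addn0 coef_rslice.
rewrite coef_koszul mulr_sumr [RHS]big_mkcond; apply: eq_bigr => j _; rewrite in_joinr.
case: ifP => // _; rewrite joinUr set1_rshift inv_join inv0l cards1 mul1n coef_lslice.
by rewrite add0n exprD -mulrA mulrCA.
Qed.

Lemma lslice_mul A z w : lslice A (ga_mul z w) =
  \sum_(A' : {set 'I_t} | A' \subset A)
    (-1) ^+ inv A' (A :\: A') *:
      ga_mul (ext_sign #|A :\: A'| (lslice A' z)) (lslice (A :\: A') w).
Proof.
apply: ext_coefP => B; rewrite coef_lslice coef_mul big_sub_join linear_sum.
apply: eq_bigr => A' _; rewrite linearZ /= coef_mul scaler_sumr; apply: eq_bigr => B' _.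
rewrite joinD inv_join !exprD coef_sign !coef_lslice mulnC /GRing.scale /=; ring.
Qed.

Lemma rslice_mul B z w : rslice B (ga_mul z w) =
  \sum_(B' : {set 'I_s} | B' \subset B)
    (-1) ^+ inv B' (B :\: B') *:
      ga_mul (rslice B' z) (ext_sign #|B'| (rslice (B :\: B') w)).
Proof.
apply: ext_coefP => A; rewrite coef_rslice coef_mul big_sub_join exchange_big linear_sum.
apply: eq_bigr => B' _; rewrite linearZ /= coef_mul scaler_sumr; apply: eq_bigr => A' _.
rewrite joinD inv_join !exprD coef_sign !coef_rslice /GRing.scale /=; ring.
Qed.

Lemma lslice_comp A i z : lslice A (gm_comp E i z) =
  if (#|A| <= i)%N then gm_comp (exterior S s) (i - #|A|) (lslice A z) else 0.
Proof.
apply: ext_coefP => B; rewrite coef_lslice coef_comp card_join.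
case: leqP => le; last by rewrite linear0 gtn_eqF // (leq_trans le) // leq_addr.
by rewrite coef_comp coef_lslice -{1}(subnKC le) eqn_add2l.
Qed.

Lemma rslice_comp B i z : rslice B (gm_comp E i z) =
  if (#|B| <= i)%N then gm_comp (exterior S t) (i - #|B|) (rslice B z) else 0.
Proof.
apply: ext_coefP => A; rewrite coef_rslice coef_comp card_join.
case: leqP => le; last by rewrite linear0 gtn_eqF // (leq_trans le) // leq_addl.
by rewrite coef_comp coef_rslice -{1}(subnK le) eqn_add2r.
Qed.
End Slices.

(** * The component over R/I *)

Section LeftProjection.
Variables (R B : comNzRingType) (k : fieldType) (p : {rmorphism R -> B}).
Variables (rho : {rmorphism R -> k}) (rhoB : {rmorphism B -> k}).
Variables (t s : nat) (y : 'I_(t + s) -> R) (A : gralg k).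
Local Notation yB := (fun j => p (y (rshift t j))).
Variable cl : exterior B s -> A.
Hypothesis p_rho : forall z, rhoB (p z) = rho z.
Hypothesis p_surj : forall b, exists a, p a = b.
Hypothesis rho_surj : forall a, exists z, rho z = a.
Hypothesis p_y : forall i, p (y (lshift s i)) = 0.
Hypothesis yB_max : forall z, max_ideal rhoB z <-> gen_ideal yB z.
Hypothesis yB_ind : independent rhoB yB.
Hypothesis cl_class : class_map rhoB yB cl.

Local Notation E := (exterior R (t + s)).
Local Notation T := (gtens (exterior k t) (pos A)).
Let bp := @pure_bilin k (exterior k t) (pos A).

Definition lproj (C : {set 'I_t}) (z : E) : exterior B s := ext_base p (lslice C z).

Lemma coef_lproj C D z : ext_coef D (lproj C z) = p (ext_coef (join C D) z).
Proof. by rewrite coef_base coef_lslice. Qed.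

Lemma lproj_lin C q z w : lproj C (q *: z + w) = p q *: lproj C z + lproj C w.
Proof. by rewrite /lproj linearP /= ext_baseD ext_baseZ. Qed.

(** The half of the differential that comes from x1 dies under p; the sign is that of moving the
    other half past [e_C]. *)
Lemma lproj_koszul C z : koszul_d yB (lproj C z) = (-1) ^+ #|C| *: lproj C (koszul_d y z).
Proof.
apply: ext_coefP => D; rewrite linearZ /= coef_lproj coef_koszul_join.
have -> : koszul_d yB (lproj C z) = ext_base p (koszul_d (fun j => y (rshift t j)) (lslice C z)).
  by rewrite ext_base_koszul.
rewrite coef_base rmorphD rmorphM rmorph_sign.
rewrite (_ : p (ext_coef C _) = 0); last first.
  by rewrite coef_koszul rmorph_sum big1 // => i _; rewrite !rmorphM p_y mul0r mulr0.
by rewrite add0r [RHS]mulrA -exprD addnn -signr_odd odd_double mul1r.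
Qed.

Lemma lproj_cycle C z : koszul_d y z = 0 -> koszul_d yB (lproj C z) = 0.
Proof. by move=> h; rewrite lproj_koszul h /lproj linear0 ext_base0 scaler0. Qed.

Lemma lproj_min_cycle C z : min_cycle rho y z -> min_cycle rhoB yB (lproj C z).
Proof.
move=> [hz hz']; split=> [|D]; first exact: lproj_cycle.
by rewrite coef_lproj p_rho.
Qed.

Definition lterm C z : pos A := pos_part (cl (lproj C z)).

Definition lclass (z : E) : T := \sum_C pure (ext_basis k C) (lterm C z).

Lemma lterm_lin C q z w : koszul_d y z = 0 -> koszul_d y w = 0 ->
  lterm C (q *: z + w) = rho q *: lterm C z + lterm C w.
Proof.
move=> hz hw; rewrite /lterm lproj_lin (class_lin cl_class); try exact: lproj_cycle.
by rewrite linearP /= p_rho.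
Qed.

Lemma lclass_lin q z w : koszul_d y z = 0 -> koszul_d y w = 0 ->
  lclass (q *: z + w) = rho q *: lclass z + lclass w.
Proof.
move=> hz hw; rewrite /lclass scaler_sumr -big_split; apply: eq_bigr => C _ /=.
by rewrite lterm_lin // bp.2.
Qed.

Lemma lclass_eq z w : (forall C, lproj C z = lproj C w) -> lclass z = lclass w.
Proof. by move=> h; apply: eq_bigr => C _; rewrite /lterm h. Qed.

Lemma lclass0 : lclass 0 = 0.
Proof.
apply: big1 => C _; rewrite /lterm /lproj linear0 ext_base0 (class0 cl_class) linear0.
exact: (bilin0r bp).
Qed.

Lemma lclass_boundary w : lclass (koszul_d y w) = 0.
Proof.
apply: big1 => C _; rewrite /lterm (_ : lproj C _ = koszul_d yB ((-1) ^+ #|C| *: lproj C w)).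
  by rewrite (class_boundary cl_class) linear0; exact: (bilin0r bp).
by rewrite linearZ /= lproj_koszul scalerA -exprD addnn -signr_odd odd_double scale1r.
Qed.

Lemma lclass_comp i z : koszul_d y z = 0 -> lclass (gm_comp E i z) = gm_comp T i (lclass z).
Proof.
move=> hz; rewrite linear_sum; apply: eq_bigr => C _.
rewrite [RHS](gtens_comp_purel _ _ (comp_basis k C)) /lterm /lproj lslice_comp.
case: ifP => _; last first.
  by rewrite ext_base0 (class0 cl_class) linear0 (bilin0r bp).
rewrite ext_base_comp (class_comp cl_class) ?comp_pos_part //.
exact: lproj_cycle.
Qed.

Lemma lproj_mul C z w : lproj C (ga_mul z w) =
  \sum_(D : {set 'I_t} | D \subset C) (-1) ^+ inv D (C :\: D) *:
    ga_mul (ext_sign #|C :\: D| (lproj D z)) (lproj (C :\: D) w).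
Proof.
rewrite /lproj lslice_mul ext_base_sum; apply: eq_bigr => D _.
by rewrite ext_baseZ rmorph_sign ext_base_mul ext_base_sign.
Qed.

Lemma lterm_mul C z w : min_cycle rho y z -> min_cycle rho y w ->
  lterm C (ga_mul z w) =
  \sum_(D : {set 'I_t} | D \subset C) (-1) ^+ inv D (C :\: D) *:
    ga_mul (gr_sign #|C :\: D| (lterm D z)) (lterm (C :\: D) w).
Proof.
move=> mz mw; rewrite /lterm lproj_mul.
have cz D : koszul_d yB (lproj D z) = 0 by apply: lproj_cycle; case: mz.
have cw D : koszul_d yB (lproj D w) = 0 by apply: lproj_cycle; case: mw.
have cm D : koszul_d yB (ga_mul (ext_sign #|C :\: D| (lproj D z)) (lproj (C :\: D) w)) = 0.
  rewrite koszul_mul sign_cycle // cw.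
  by rewrite (bilin0l (ga_bilin _)) (bilin0r (ga_bilin _)) addr0.
rewrite (class_sum cl_class) => [|D]; last by rewrite linearZ /= cm scaler0.
rewrite linear_sum; apply: eq_bigr => D _.
rewrite (classZ cl_class) // linearZ /= rmorph_sign (class_mul cl_class) ?sign_cycle //.
rewrite (class_sign cl_class) // pos_part_mul ?pos_part_sign //.
  by rewrite comp_gr_sign (min_cycle_comp0 yB_max cl_class) ?scaler0 //; exact: lproj_min_cycle.
by rewrite (min_cycle_comp0 yB_max cl_class) //; exact: lproj_min_cycle.
Qed.

Lemma lclass_mul z w : min_cycle rho y z -> min_cycle rho y w ->
  lclass (ga_mul z w) = ga_mul (lclass z) (lclass w).
Proof.
move=> mz mw; rewrite /lclass (bilin_suml (ga_bilin T)).
under [RHS]eq_bigr => D _ do rewrite (bilin_sumr (ga_bilin T)).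
transitivity (\sum_(D : {set 'I_t}) \sum_(C : {set 'I_t} | D \subset C)
   (-1) ^+ inv D (C :\: D) *:
   pure (ext_basis k C) (ga_mul (gr_sign #|C :\: D| (lterm D z)) (lterm (C :\: D) w))).
  rewrite (exchange_big_dep predT) //=; apply: eq_bigr => C _.
  rewrite lterm_mul // (bilin_sumr bp); apply: eq_bigr => D _.
  by rewrite (bilinZr bp).
apply: eq_bigr => D _.
(* For fixed D, the product of [e_D] and [e_F] is nonzero only for F disjoint from D; the remaining
   pairs are indexed by the union C, with F = C minus D. *)
under [RHS]eq_bigr => F _ do rewrite (gtens_mul_signl _ _ _ (comp_basis k F))
  [X in pure X _]ext_expand (bilin_suml bp).
rewrite exchange_big [LHS]big_mkcond; apply: eq_bigr => C _.
under [RHS]eq_bigr => F _ do rewrite (bilinZl bp) coef_mul_basis coef_basis.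
case: ifP => sD; last by rewrite big1 // => F _; rewrite scale0r.
rewrite (bigD1 (C :\: D)) //= eqxx mulr1 big1 ?addr0 // => F.
by rewrite eq_sym => /negPf ->; rewrite mulr0 scale0r.
Qed.

Let coef_lift_bilin C : bilin (fun (u : exterior k t) (a : pos A) => (ext_coef C u : k) *: a).
Proof.
split=> [a c u v|u c a b]; first by rewrite linearP /= scalerDl scalerA.
by rewrite scalerDr !scalerA mulrC.
Qed.

(** Tensors are accessible only through bilinear maps. Pairing with the coordinate along [e_C]
    recovers each term, so a zero tensor has zero terms. *)
Lemma lclass_coef C z : tlift (fun (u : exterior k t) (a : pos A) => (ext_coef C u : k) *: a)
  (lclass z) = lterm C z.
Proof.
have bl := coef_lift_bilin C; rewrite /lclass tlift_sum // (bigD1 C) //= tlift_pure //.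
rewrite coef_basis eqxx scale1r big1 ?addr0 // => D ne.
by rewrite tlift_pure // coef_basis eq_sym (negPf ne) scale0r.
Qed.

Lemma lclass_inj z : min_cycle rho y z -> lclass z = 0 ->
  exists v, forall C, p (ext_coef C z) = p (ext_coef C (koszul_d y v)).
Proof.
move=> mz z0; have h C : exists v, lproj C z = koszul_d yB v.
  apply: (class_eq0 cl_class); first by apply: lproj_cycle; case: mz.
  rewrite -[LHS]pos_partK; last exact: min_cycle_comp0 (lproj_min_cycle C mz).
  rewrite -/(lterm C z) -lclass_coef z0.
  rewrite (linear_at0 (tlift_linear (coef_lift_bilin C))).
  exact: linear_at0 (@pos_val_linear k A).
have [v hv] := choice h.
(* The primitives of the slices are lifted coefficientwise to one chain over R; the sign compensates
   the one in [lproj_koszul]. *)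
have [c hc] := choice (fun D : {set 'I_(t + s)} =>
  p_surj ((-1) ^+ #|lpart D| * ext_coef (rpart D) (v (lpart D)))).
have hl C : lproj C (ext_of c) = (-1) ^+ #|C| *: v C.
  apply: ext_coefP => D; rewrite coef_lproj coef_ext_of hc lpart_join rpart_join.
  by rewrite linearZ.
exists (ext_of c) => D; rewrite -(joinK D) -!coef_lproj hv.
rewrite (_ : lproj (lpart D) _ = koszul_d yB (v (lpart D))) //.
rewrite -[LHS]scale1r -(sqrr_sign _ #|lpart D|) expr2 -scalerA -lproj_koszul hl.
by rewrite linearZ /= scalerA -expr2 sqrr_sign scale1r.
Qed.

(** The family z consists of prospective slices; assembling them into a cycle over R needs the
    second quotient and is left to [lclass_lift]. *)
Lemma lclass_surj (a : T) : exists z : {set 'I_t} -> exterior B s,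
  (forall C, min_cycle rhoB yB (z C)) /\
  a = \sum_C pure (ext_basis k C) (pos_part (cl (z C))).
Proof.
have m0 : min_cycle rhoB yB (0 : exterior B s).
  by split=> [|D]; rewrite linear0 ?rmorph0.
elim/tens_ind: a => [|a b [z [mz ->]] [w [mw ->]]|u a].
- exists (fun=> 0); split=> //; rewrite big1 // => C _.
  by rewrite (class0 cl_class) linear0; exact: (bilin0r bp).
- exists (fun C => 1 *: z C + w C); split=> [C|]; first exact: min_cycle_lin.
  rewrite -big_split; apply: eq_bigr => C _ /=.
  have [[dz _] [dw _]] := (mz C, mw C).
  by rewrite (class_lin cl_class) // rmorph1 !scale1r linearD (bilinDr bp).
- have [z mz za] := min_cycle_pos yB_ind cl_class (pos_val0 a).
  have rhoB_surj q : exists b, rhoB b = q.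
    by have [r hr] := rho_surj q; exists (p r); rewrite p_rho.
  have [c hc] := choice (fun C => rhoB_surj (ext_coef C u)).
  exists (fun C => c C *: z + 0); split=> [C|]; first exact: min_cycle_lin.
  rewrite [u in LHS]ext_expand (bilin_suml bp); apply: eq_bigr => C _.
  rewrite addr0 (classZ cl_class); last by case: mz.
  by rewrite hc za linearZ /= pos_valK (bilinZl bp) (bilinZr bp).
Qed.
End LeftProjection.

(** * The component over R/J *)

Section RightProjection.
Variables (R B : comNzRingType) (k : fieldType) (p : {rmorphism R -> B}).
Variables (rho : {rmorphism R -> k}) (rhoB : {rmorphism B -> k}).
Variables (t s : nat) (y : 'I_(t + s) -> R) (A : gralg k).
Local Notation yB := (fun i => p (y (lshift s i))).
Variable cl : exterior B t -> A.
Hypothesis p_rho : forall z, rhoB (p z) = rho z.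
Hypothesis p_surj : forall b, exists a, p a = b.
Hypothesis rho_surj : forall a, exists z, rho z = a.
Hypothesis p_y : forall i, p (y (rshift t i)) = 0.
Hypothesis yB_max : forall z, max_ideal rhoB z <-> gen_ideal yB z.
Hypothesis yB_ind : independent rhoB yB.
Hypothesis cl_class : class_map rhoB yB cl.

Local Notation E := (exterior R (t + s)).
Local Notation T := (gtens (pos A) (exterior k s)).
Let bp := @pure_bilin k (pos A) (exterior k s).

Definition rproj (C : {set 'I_s}) (z : E) : exterior B t := ext_base p (rslice C z).

Lemma coef_rproj C D z : ext_coef D (rproj C z) = p (ext_coef (join D C) z).
Proof. by rewrite coef_base coef_rslice. Qed.

Lemma rproj_lin C q z w : rproj C (q *: z + w) = p q *: rproj C z + rproj C w.
Proof. by rewrite /rproj linearP /= ext_baseD ext_baseZ. Qed.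

(** There is no sign, unlike in [lproj_koszul]: the surviving half of the differential acts on the
    left factor and passes nothing. *)
Lemma rproj_koszul C z : koszul_d yB (rproj C z) = rproj C (koszul_d y z).
Proof.
apply: ext_coefP => D; rewrite coef_rproj coef_koszul_join.
have -> : koszul_d yB (rproj C z) = ext_base p (koszul_d (fun i => y (lshift s i)) (rslice C z)).
  by rewrite ext_base_koszul.
rewrite coef_base rmorphD rmorphM rmorph_sign.
rewrite (_ : p (ext_coef C _) = 0) ?mulr0 ?addr0 //.
by rewrite coef_koszul rmorph_sum big1 // => i _; rewrite !rmorphM p_y mul0r mulr0.
Qed.

Lemma rproj_cycle C z : koszul_d y z = 0 -> koszul_d yB (rproj C z) = 0.
Proof. by move=> h; rewrite rproj_koszul h /rproj linear0 ext_base0. Qed.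

Lemma rproj_min_cycle C z : min_cycle rho y z -> min_cycle rhoB yB (rproj C z).
Proof.
move=> [hz hz']; split=> [|D]; first exact: rproj_cycle.
by rewrite coef_rproj p_rho.
Qed.

Definition rterm C z : pos A := pos_part (cl (rproj C z)).

Definition rclass (z : E) : T := \sum_C pure (rterm C z) (ext_basis k C).

Lemma rterm_lin C q z w : koszul_d y z = 0 -> koszul_d y w = 0 ->
  rterm C (q *: z + w) = rho q *: rterm C z + rterm C w.
Proof.
move=> hz hw; rewrite /rterm rproj_lin (class_lin cl_class); try exact: rproj_cycle.
by rewrite linearP /= p_rho.
Qed.

Lemma rclass_lin q z w : koszul_d y z = 0 -> koszul_d y w = 0 ->
  rclass (q *: z + w) = rho q *: rclass z + rclass w.
Proof.
move=> hz hw; rewrite /rclass scaler_sumr -big_split; apply: eq_bigr => C _ /=.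
by rewrite rterm_lin // bp.1.
Qed.

Lemma rclass_eq z w : (forall C, rproj C z = rproj C w) -> rclass z = rclass w.
Proof. by move=> h; apply: eq_bigr => C _; rewrite /rterm h. Qed.

Lemma rclass0 : rclass 0 = 0.
Proof.
apply: big1 => C _; rewrite /rterm /rproj linear0 ext_base0 (class0 cl_class) linear0.
exact: (bilin0l bp).
Qed.

Lemma rclass_boundary w : rclass (koszul_d y w) = 0.
Proof.
apply: big1 => C _; rewrite /rterm -rproj_koszul.
by rewrite (class_boundary cl_class) linear0; exact: (bilin0l bp).
Qed.

Lemma rclass_comp i z : koszul_d y z = 0 -> rclass (gm_comp E i z) = gm_comp T i (rclass z).
Proof.
move=> hz; rewrite linear_sum; apply: eq_bigr => C _.
rewrite [RHS](gtens_comp_purer _ _ (comp_basis k C)) /rterm /rproj rslice_comp.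
case: ifP => _; last first.
  by rewrite ext_base0 (class0 cl_class) linear0 (bilin0l bp).
rewrite ext_base_comp (class_comp cl_class) ?comp_pos_part //.
exact: rproj_cycle.
Qed.

Lemma rproj_mul C z w : rproj C (ga_mul z w) =
  \sum_(D : {set 'I_s} | D \subset C) (-1) ^+ inv D (C :\: D) *:
    ga_mul (rproj D z) (ext_sign #|D| (rproj (C :\: D) w)).
Proof.
rewrite /rproj rslice_mul ext_base_sum; apply: eq_bigr => D _.
by rewrite ext_baseZ rmorph_sign ext_base_mul ext_base_sign.
Qed.

Lemma rterm_mul C z w : min_cycle rho y z -> min_cycle rho y w ->
  rterm C (ga_mul z w) =
  \sum_(D : {set 'I_s} | D \subset C) (-1) ^+ inv D (C :\: D) *:
    ga_mul (rterm D z) (gr_sign #|D| (rterm (C :\: D) w)).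
Proof.
move=> mz mw; rewrite /rterm rproj_mul.
have cz D : koszul_d yB (rproj D z) = 0 by apply: rproj_cycle; case: mz.
have cw D : koszul_d yB (rproj D w) = 0 by apply: rproj_cycle; case: mw.
have cm D : koszul_d yB (ga_mul (rproj D z) (ext_sign #|D| (rproj (C :\: D) w))) = 0.
  rewrite koszul_mul sign_cycle // cz.
  by rewrite (bilin0l (ga_bilin _)) (bilin0r (ga_bilin _)) addr0.
rewrite (class_sum cl_class) => [|D]; last by rewrite linearZ /= cm scaler0.
rewrite linear_sum; apply: eq_bigr => D _.
rewrite (classZ cl_class) // linearZ /= rmorph_sign (class_mul cl_class) ?sign_cycle //.
rewrite (class_sign cl_class) // pos_part_mul ?pos_part_sign //.
  by rewrite (min_cycle_comp0 yB_max cl_class) //; exact: rproj_min_cycle.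
by rewrite comp_gr_sign (min_cycle_comp0 yB_max cl_class) ?scaler0 //; exact: rproj_min_cycle.
Qed.

Lemma rclass_mul z w : min_cycle rho y z -> min_cycle rho y w ->
  rclass (ga_mul z w) = ga_mul (rclass z) (rclass w).
Proof.
move=> mz mw; rewrite /rclass (bilin_suml (ga_bilin T)).
under [RHS]eq_bigr => D _ do rewrite (bilin_sumr (ga_bilin T)).
transitivity (\sum_(D : {set 'I_s}) \sum_(C : {set 'I_s} | D \subset C)
   (-1) ^+ inv D (C :\: D) *:
   pure (ga_mul (rterm D z) (gr_sign #|D| (rterm (C :\: D) w))) (ext_basis k C)).
  rewrite (exchange_big_dep predT) //=; apply: eq_bigr => C _.
  rewrite rterm_mul // (bilin_suml bp); apply: eq_bigr => D _.
  by rewrite (bilinZl bp).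
apply: eq_bigr => D _.
under [RHS]eq_bigr => F _ do rewrite (gtens_mul_signr _ _ _ (comp_basis k D))
  [X in pure _ X]ext_expand (bilin_sumr bp).
rewrite exchange_big [LHS]big_mkcond; apply: eq_bigr => C _.
under [RHS]eq_bigr => F _ do rewrite (bilinZr bp) coef_mul_basis coef_basis.
case: ifP => sD; last by rewrite big1 // => F _; rewrite scale0r.
rewrite (bigD1 (C :\: D)) //= eqxx mulr1 big1 ?addr0 // => F.
by rewrite eq_sym => /negPf ->; rewrite mulr0 scale0r.
Qed.

Let coef_lift_bilin C : bilin (fun (a : pos A) (u : exterior k s) => (ext_coef C u : k) *: a).
Proof.
split=> [u c a b|a c u v]; last by rewrite linearP /= scalerDl scalerA.
by rewrite scalerDr !scalerA mulrC.
Qed.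

Lemma rclass_coef C z : tlift (fun (a : pos A) (u : exterior k s) => (ext_coef C u : k) *: a)
  (rclass z) = rterm C z.
Proof.
have bl := coef_lift_bilin C; rewrite /rclass tlift_sum // (bigD1 C) //= tlift_pure //.
rewrite coef_basis eqxx scale1r big1 ?addr0 // => D ne.
by rewrite tlift_pure // coef_basis eq_sym (negPf ne) scale0r.
Qed.

Lemma rclass_inj z : min_cycle rho y z -> rclass z = 0 ->
  exists v, forall C, p (ext_coef C z) = p (ext_coef C (koszul_d y v)).
Proof.
move=> mz z0; have h C : exists v, rproj C z = koszul_d yB v.
  apply: (class_eq0 cl_class); first by apply: rproj_cycle; case: mz.
  rewrite -[LHS]pos_partK; last exact: min_cycle_comp0 (rproj_min_cycle C mz).
  rewrite -/(rterm C z) -rclass_coef z0.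
  rewrite (linear_at0 (tlift_linear (coef_lift_bilin C))).
  exact: linear_at0 (@pos_val_linear k A).
have [v hv] := choice h.
have [c hc] := choice (fun D : {set 'I_(t + s)} => p_surj (ext_coef (lpart D) (v (rpart D)))).
have hl C : rproj C (ext_of c) = v C.
  by apply: ext_coefP => D; rewrite coef_rproj coef_ext_of hc lpart_join rpart_join.
exists (ext_of c) => D; rewrite -(joinK D) -!coef_rproj hv.
by rewrite -rproj_koszul hl.
Qed.

Lemma rclass_surj (a : T) : exists z : {set 'I_s} -> exterior B t,
  (forall C, min_cycle rhoB yB (z C)) /\
  a = \sum_C pure (pos_part (cl (z C))) (ext_basis k C).
Proof.
have m0 : min_cycle rhoB yB (0 : exterior B t).
  by split=> [|D]; rewrite linear0 ?rmorph0.
elim/tens_ind: a => [|a b [z [mz ->]] [w [mw ->]]|a u].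
- exists (fun=> 0); split=> //; rewrite big1 // => C _.
  by rewrite (class0 cl_class) linear0; exact: (bilin0l bp).
- exists (fun C => 1 *: z C + w C); split=> [C|]; first exact: min_cycle_lin.
  rewrite -big_split; apply: eq_bigr => C _ /=.
  have [[dz _] [dw _]] := (mz C, mw C).
  by rewrite (class_lin cl_class) // rmorph1 !scale1r linearD (bilinDl bp).
- have [z mz za] := min_cycle_pos yB_ind cl_class (pos_val0 a).
  have rhoB_surj q : exists b, rhoB b = q.
    by have [r hr] := rho_surj q; exists (p r); rewrite p_rho.
  have [c hc] := choice (fun C => rhoB_surj (ext_coef C u)).
  exists (fun C => c C *: z + 0); split=> [C|]; first exact: min_cycle_lin.
  rewrite [u in LHS]ext_expand (bilin_sumr bp); apply: eq_bigr => C _.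
  rewrite addr0 (classZ cl_class); last by case: mz.
  by rewrite hc za linearZ /= pos_valK (bilinZl bp) (bilinZr bp).
Qed.
End RightProjection.

(** * The module W *)

Section Wclass.
Variables (k : fieldType) (t s : nat).
Local Notation T := (tens (exterior k t) (exterior k s)).
Let bp := @pure_bilin k (exterior k t) (exterior k s).
Implicit Types g h : {set 'I_t} -> {set 'I_s} -> k.

Definition ext2_sum g : T := \sum_A \sum_B g A B *: pure (ext_basis k A) (ext_basis k B).

Definition W_class g : W k t s := gquot_pi (W_sub0 k t s) (@W_sub_lin k t s) (ext2_sum g).

Lemma ext2_sum_lin c g h :
  ext2_sum (fun A B => c * g A B + h A B) = c *: ext2_sum g + ext2_sum h.
Proof.
rewrite /ext2_sum scaler_sumr -big_split; apply: eq_bigr => A _ /=.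
rewrite scaler_sumr -big_split; apply: eq_bigr => B _ /=.
by rewrite scalerDl scalerA.
Qed.

Lemma W_class_lin c g h :
  W_class (fun A B => c * g A B + h A B) = c *: W_class g + W_class h.
Proof. by rewrite /W_class ext2_sum_lin; exact: gquot_pi_linear. Qed.

Lemma W_class_eq g h : (forall A B, g A B = h A B) -> W_class g = W_class h.
Proof.
move=> gh; rewrite /W_class; congr gquot_pi.
by apply: eq_bigr => A _; apply: eq_bigr => B _; rewrite gh.
Qed.

Lemma ext2_sum_surj (x : T) : exists g, x = ext2_sum g.
Proof.
elim/tens_ind: x => [|x y [g ->] [h ->]|u v].
- exists (fun _ _ => 0); rewrite /ext2_sum big1 // => A _.
  by rewrite big1 // => B _; rewrite scale0r.
- exists (fun A B => 1 * g A B + h A B).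
  by rewrite ext2_sum_lin scale1r.
- exists (fun A B => ext_coef A u * ext_coef B v).
  rewrite {1}(ext_expand u) (bilin_suml bp); apply: eq_bigr => A _.
  rewrite {1}(ext_expand v) (bilin_sumr bp); apply: eq_bigr => B _.
  by rewrite (bilinZl bp) (bilinZr bp) scalerA.
Qed.

Lemma W_class_surj (w : W k t s) : exists g, w = W_class g.
Proof.
have [x ->] := gquot_surj (w : W_quot k t s); have [g ->] := ext2_sum_surj x.
by exists g.
Qed.

Let coef2_bilin A B : bilin (fun (u : exterior k t) (v : exterior k s) =>
  (ext_coef A u * ext_coef B v : k^o)).
Proof.
split=> [v c u u'|u c v v']; rewrite linearP /=.
  by rewrite mulrDl /GRing.scale /= -mulrA.
by rewrite mulrDr /GRing.scale /= mulrCA.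
Qed.

Lemma ext2_sum_coef g A B :
  tlift (fun (u : exterior k t) (v : exterior k s) => (ext_coef A u * ext_coef B v : k^o))
    (ext2_sum g) = g A B.
Proof.
have bl := coef2_bilin A B; have lin := tlift_linear bl.
have E A' B' : tlift (fun (u : exterior k t) (v : exterior k s) =>
    (ext_coef A u * ext_coef B v : k^o)) (g A' B' *: pure (ext_basis k A') (ext_basis k B'))
    = g A' B' * ((A == A')%:R * (B == B')%:R).
  by rewrite -(bilinZl bp) tlift_pure // linearZ /= !coef_basis /GRing.scale /= mulrA.
rewrite /ext2_sum tlift_sum // (bigD1 A) //= tlift_sum // (bigD1 B) //= E !eqxx !mulr1.
rewrite big1 ?addr0 => [|B' ne]; last by rewrite E [B == _]eq_sym (negPf ne) !mulr0.
rewrite big1 ?addr0 // => A' ne; rewrite tlift_sum // big1 // => B' _.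
by rewrite E [A == _]eq_sym (negPf ne) mul0r mulr0.
Qed.

(** The submodule divided out is spanned by the basis tensors with A or B empty, so those with both
    nonempty give a basis of W. *)
Lemma W_class_eq0 g : W_class g = 0 <->
  (forall A B, A != set0 -> B != set0 -> g A B = 0).
Proof.
have pi0 : W_class g = 0 <-> W_sub (ext2_sum g).
  have h := gquot_piP (W_sub0 k t s) (@W_sub_lin k t s) (ext2_sum g) 0.
  have p0 : gquot_pi (W_sub0 k t s) (@W_sub_lin k t s) 0 = 0 by exact: linear0.
  by rewrite subr0 p0 in h.
rewrite pi0; split=> [[u [v uv]] A B A0 B0|g0].
  have bl := coef2_bilin A B.
  rewrite -[LHS](ext2_sum_coef g A B) uv (tliftD _ _ bl) !tlift_pure //.
  by rewrite !ext_one_basis !coef_basis (negPf A0) (negPf B0) mul0r mulr0 addr0.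
(* The pair of empty sets belongs to both summands of the submodule; its coefficient is put into the
   second witness and left out of the first. *)
exists (\sum_(A | A != set0) g A set0 *: ext_basis k A), (\sum_B g set0 B *: ext_basis k B).
rewrite (bilin_suml bp) (bilin_sumr bp) /ext2_sum (bigD1 set0) //=; congr (_ + _).
  by apply: eq_bigr => B _; rewrite ext_one_basis (bilinZr bp).
apply: eq_bigr => A A0; rewrite (bigD1 set0) //= big1 ?addr0.
  by rewrite ext_one_basis (bilinZl bp).
by move=> B B0; rewrite g0 // scale0r.
Qed.

(** Degree i of W is total degree i + 1 of the tensor product, because of the desuspension. *)
Lemma W_class_comp i g : gm_comp (W k t s) i (W_class g) =
  W_class (fun A B => if (#|A| + #|B| == i.+1)%N then g A B else 0).
Proof.
rewrite [LHS](gquot_compE _ _ (@W_comp k t s)) /W_class; congr gquot_pi.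
rewrite /ext2_sum linear_sum; apply: eq_bigr => A _; rewrite linear_sum.
apply: eq_bigr => B _; rewrite linearZ /=.
rewrite [X in _ *: X](gtens_comp_pure _ (comp_basis k A) (comp_basis k B)) eq_sym.
by case: eqP => _; rewrite ?scaler0 ?scale0r.
Qed.
End Wclass.

(** * The homology of a fiber product *)

Section LeadingCoefficients.
Variables (R : comNzRingType) (k : fieldType) (rho : {rmorphism R -> k}).
Variables (n : nat) (y : 'I_n -> R).
Hypothesis y_max : forall z, max_ideal rho z <-> gen_ideal y z.
Hypothesis y_ind : independent rho y.

(* The coordinates of the class of z in m/m^2 on the basis y; the value is
   irrelevant for z outside m. *)
Definition lead (z : R) (l : 'I_n) : k :=
  if pselect (gen_ideal y z) is left h then rho (projT1 (cid h) l) else 0.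

(** Two expressions of the same element differ by a relation, whose coefficients have residue 0 by
    independence. *)
Lemma leadE (c : 'I_n -> R) l : lead (\sum_i c i * y i) l = rho (c l).
Proof.
rewrite /lead; case: pselect => [h|[]]; last by exists c.
case: cid => e /= he; apply/esym/eqP; rewrite -subr_eq0 -rmorphB; apply/eqP.
apply: (y_ind (c := fun l => c l - e l)).
under eq_bigr do rewrite mulrBl.
by rewrite sumrB he subrr.
Qed.

Lemma lead_lin q z w l : rho z = 0 -> rho w = 0 ->
  lead (q * z + w) l = rho q * lead z l + lead w l.
Proof.
move=> /y_max[c ->] /y_max[e ->]; rewrite !leadE -rmorphM -rmorphD.
rewrite -(leadE (fun l => q * c l + e l)); congr (lead _ _).
rewrite mulr_sumr -big_split; apply: eq_bigr => i _ /=.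
by rewrite mulrDl mulrA.
Qed.

Lemma lead0 l : lead 0 l = 0.
Proof.
have := leadE (fun=> 0) l; rewrite rmorph0 big1 // => i _; exact: mul0r.
Qed.

Lemma lead_mul z w l : rho z = 0 -> rho w = 0 -> lead (z * w) l = 0.
Proof.
by move=> hz hw; rewrite -[z * w]addr0 lead_lin ?rmorph0 // hz mul0r lead0 add0r.
Qed.

Lemma lead_sum I (r : seq I) (P : pred I) (F : I -> R) l : (forall i, rho (F i) = 0) ->
  (forall i, lead (F i) l = 0) -> lead (\sum_(i <- r | P i) F i) l = 0.
Proof.
move=> hF lF.
suff [] : rho (\sum_(i <- r | P i) F i) = 0 /\ lead (\sum_(i <- r | P i) F i) l = 0 by [].
apply: (big_ind (fun z => rho z = 0 /\ lead z l = 0)) => [|z w [hz lz] [hw lw]|i _] //.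
  by rewrite rmorph0 lead0.
by rewrite rmorphD -{2}[z]mul1r lead_lin // hz lz hw lw mulr0 !addr0.
Qed.

(** The sign is the one with which [y l] times the coefficient of w at C enters the coefficient of
    [koszul_d y w] at [C :\ l], so that the residue of that coefficient comes back unsigned. *)
Definition retract l (C : {set 'I_n}) (z : exterior R n) : k :=
  (-1) ^+ inv [set l] (C :\ l) * lead (ext_coef (C :\ l) z) l.

Lemma retract_boundary l (C : {set 'I_n}) w : l \in C ->
  retract l C (koszul_d y w) = rho (ext_coef C w).
Proof.
move=> lC; rewrite /retract coef_koszul big_mkcond.
rewrite (eq_bigr (fun j => (if j \notin C :\ l then
  (-1) ^+ inv [set j] (C :\ l) * ext_coef (j |: C :\ l) w else 0) * y j)); last first.
  by move=> j _; case: ifP => _; rewrite ?mul0r // -mulrA [_ * y j]mulrC.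
by rewrite leadE setD11 setD1K //= rmorphM rmorph_sign signrMK.
Qed.

Lemma retract_lin l C q z w : (forall D, rho (ext_coef D z) = 0) ->
  (forall D, rho (ext_coef D w) = 0) ->
  retract l C (q *: z + w) = rho q * retract l C z + retract l C w.
Proof. by move=> hz hw; rewrite /retract linearP /= lead_lin // mulrDr mulrCA. Qed.

Lemma retract_mul l C z w : (forall D, rho (ext_coef D z) = 0) ->
  (forall D, rho (ext_coef D w) = 0) -> retract l C (ga_mul z w) = 0.
Proof.
move=> hz hw; rewrite /retract coef_mul lead_sum ?mulr0 // => D.
  by rewrite !rmorphM hz mul0r mulr0.
rewrite mulrA -[(_ * _) * _]addr0 -mulrA lead_lin ?rmorph0 ?rmorphM ?hz ?mul0r //.
by rewrite lead_mul // mulr0 lead0 addr0.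
Qed.

Lemma retract_comp l (C : {set 'I_n}) i z : l \in C -> retract l C (gm_comp (exterior R n) i z) =
  if #|C| == i.+1 then retract l C z else 0.
Proof.
move=> lC; rewrite /retract coef_comp (cardsD1 l C) lC add1n eqSS.
by case: eqP => _; rewrite // lead0 mulr0.
Qed.
End LeadingCoefficients.

(** * Assembly of the three components *)

Section FiberProduct.
Variables (R B1 B2 : comNzRingType) (k : fieldType).
Variables (p : {rmorphism R -> B1}) (q : {rmorphism R -> B2}).
Variables (rho : {rmorphism R -> k}) (rho1 : {rmorphism B1 -> k}) (rho2 : {rmorphism B2 -> k}).
Variables (t s : nat) (y : 'I_(t + s) -> R) (A1 A2 : gralg k).
Local Notation y1 := (fun j => p (y (rshift t j))).
Local Notation y2 := (fun i => q (y (lshift s i))).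
Variables (cl1 : exterior B1 s -> A1) (cl2 : exterior B2 t -> A2).
Hypothesis p_rho : forall z, rho1 (p z) = rho z.
Hypothesis q_rho : forall z, rho2 (q z) = rho z.
Hypothesis p_surj : forall b, exists a, p a = b.
Hypothesis q_surj : forall b, exists a, q a = b.
Hypothesis rho_surj : forall a, exists z, rho z = a.
Hypothesis p_y : forall i, p (y (lshift s i)) = 0.
Hypothesis q_y : forall j, q (y (rshift t j)) = 0.
Hypothesis pq_inj : forall z, p z = 0 -> q z = 0 -> z = 0.
Hypothesis y_max : forall z, max_ideal rho z <-> gen_ideal y z.
Hypothesis y_ind : independent rho y.
Hypothesis y1_max : forall z, max_ideal rho1 z <-> gen_ideal y1 z.
Hypothesis y1_ind : independent rho1 y1.
Hypothesis y2_max : forall z, max_ideal rho2 z <-> gen_ideal y2 z.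
Hypothesis y2_ind : independent rho2 y2.
Hypothesis cl1_class : class_map rho1 y1 cl1.
Hypothesis cl2_class : class_map rho2 y2 cl2.

Local Notation E := (exterior R (t + s)).
Local Notation T1 := (gtens (exterior k t) (pos A1)).
Local Notation T2 := (gtens (pos A2) (exterior k s)).
Local Notation T := (trivext0 (gprod T1 T2) (W k t s)).
Local Notation mcyc := (min_cycle rho y).
Implicit Types (z w : E).

Lemma max_split (z : R) : rho z = 0 -> exists a b, [/\ p a = 0, q b = 0 & z = a + b].
Proof.
move=> /y_max[c ->]; rewrite big_split_ord /=.
exists (\sum_(i < t) c (lshift s i) * y (lshift s i)).
exists (\sum_(j < s) c (rshift t j) * y (rshift t j)).
by split=> //; rewrite rmorph_sum big1 // => i _; rewrite rmorphM ?p_y ?q_y mulr0.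
Qed.

(** Under p an expression of z in the y becomes a relation among the images of x2, whose
    coefficients have residue 0 by independence. Hence the coordinates along x2 depend only on the
    image under p. *)
Lemma lead_p (z : R) j : p z = 0 -> lead rho y z (rshift t j) = 0.
Proof.
move=> pz; have /y_max[c zc] : rho z = 0 by rewrite -p_rho pz rmorph0.
rewrite zc leadE // -p_rho; apply: (y1_ind (c := fun j => p (c (rshift t j)))).
move: pz; rewrite zc rmorph_sum big_split_ord /= big1 ?add0r => [h|i _].
  by rewrite -[RHS]h; apply: eq_bigr => i _; rewrite rmorphM.
by rewrite rmorphM p_y mulr0.
Qed.

Lemma lead_q (z : R) i : q z = 0 -> lead rho y z (lshift s i) = 0.
Proof.
move=> qz; have /y_max[c zc] : rho z = 0 by rewrite -q_rho qz rmorph0.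
rewrite zc leadE // -q_rho; apply: (y2_ind (c := fun i => q (c (lshift s i)))).
move: qz; rewrite zc rmorph_sum big_split_ord /= addrC big1 ?add0r => [h|j _].
  by rewrite -[RHS]h; apply: eq_bigr => j _; rewrite rmorphM.
by rewrite rmorphM q_y mulr0.
Qed.

Local Notation ret := (retract rho y).

Lemma retract_p j C z w : mcyc z -> mcyc w ->
  (forall D, p (ext_coef D z) = p (ext_coef D w)) -> ret (rshift t j) C z = ret (rshift t j) C w.
Proof.
move=> [_ hz] [_ hw] pzw; apply/eqP; rewrite -subr_eq0.
rewrite -[X in _ - X]mul1r -mulNr -(rmorphN1 rho) addrC -retract_lin // /retract lead_p ?mulr0 //.
by rewrite linearP /= scaleN1r addrC rmorphB pzw subrr.
Qed.

Lemma retract_q i C z w : mcyc z -> mcyc w ->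
  (forall D, q (ext_coef D z) = q (ext_coef D w)) -> ret (lshift s i) C z = ret (lshift s i) C w.
Proof.
move=> [_ hz] [_ hw] qzw; apply/eqP; rewrite -subr_eq0.
rewrite -[X in _ - X]mul1r -mulNr -(rmorphN1 rho) addrC -retract_lin // /retract lead_q ?mulr0 //.
by rewrite linearP /= scaleN1r addrC rmorphB qzw subrr.
Qed.

(** The indices picked from A and B do not depend on z, which keeps the map linear. The value 0 for
    an empty A or B is harmless, since these coordinates vanish in W. *)
Definition omega z (A : {set 'I_t}) (B : {set 'I_s}) : k :=
  if [pick i in A] is Some i then
    if [pick j in B] is Some j then
      ret (rshift t j) (join A B) z - ret (lshift s i) (join A B) z
    else 0
  else 0.

Lemma omega_lin c z w A B : mcyc z -> mcyc w ->
  omega (c *: z + w) A B = rho c * omega z A B + omega w A B.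
Proof.
move=> [_ hz] [_ hw]; rewrite /omega.
case: pickP => [i iA|_]; last by rewrite mulr0 addr0.
case: pickP => [j jB|_]; last by rewrite mulr0 addr0.
by rewrite !retract_lin // mulrBr opprD addrACA.
Qed.

Lemma omega_boundary w A B : omega (koszul_d y w) A B = 0.
Proof.
rewrite /omega; case: pickP => [i iA|_] //; case: pickP => [j jB|_] //.
by rewrite !retract_boundary ?in_joinl ?in_joinr // subrr.
Qed.

Lemma omega_mul z w A B : mcyc z -> mcyc w -> omega (ga_mul z w) A B = 0.
Proof.
move=> [_ hz] [_ hw]; rewrite /omega; case: pickP => [i iA|_] //; case: pickP => [j jB|_] //.
by rewrite !retract_mul // subrr.
Qed.

Lemma omega_comp i z A B : omega (gm_comp E i z) A B =
  if (#|A| + #|B| == i.+1)%N then omega z A B else 0.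
Proof.
rewrite /omega; case: pickP => [a aA|_]; last by rewrite if_same.
case: pickP => [j jB|_]; last by rewrite if_same.
rewrite !retract_comp ?in_joinl ?in_joinr // card_join.
by case: eqP => _; rewrite ?subr0.
Qed.

Definition fiber_class z : T :=
  ((lclass p cl1 z, rclass q cl2 z), W_class (omega z)).

Lemma fiber_class_lin c z w : mcyc z -> mcyc w ->
  fiber_class (c *: z + w) = rho c *: fiber_class z + fiber_class w.
Proof.
move=> mz mw; have [[dz _] [dw _]] := (mz, mw); rewrite /fiber_class.
rewrite (lclass_lin p_rho p_y cl1_class) // (rclass_lin q_rho q_y cl2_class) //.
rewrite (W_class_eq (h := fun A B => rho c * omega z A B + omega w A B)).
  by rewrite W_class_lin.
by move=> A B; exact: omega_lin.
Qed.

Lemma fiber_class_boundary w : fiber_class (koszul_d y w) = 0.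
Proof.
rewrite /fiber_class (lclass_boundary p_y cl1_class) (rclass_boundary q_y cl2_class).
by congr (_, _); apply/W_class_eq0 => A B _ _; exact: omega_boundary.
Qed.

Lemma fiber_class_comp i z : mcyc z -> fiber_class (gm_comp E i z) = gm_comp T i (fiber_class z).
Proof.
move=> [dz _]; rewrite /fiber_class (lclass_comp p_y cl1_class) // (rclass_comp q_y cl2_class) //.
rewrite (W_class_eq (omega_comp i z)).
by congr (_, _); rewrite -W_class_comp.
Qed.

Lemma fiber_class_mul z w : mcyc z -> mcyc w ->
  fiber_class (ga_mul z w) = ga_mul (fiber_class z) (fiber_class w).
Proof.
move=> mz mw; rewrite /fiber_class (lclass_mul p_rho p_y y1_max cl1_class mz mw).
rewrite (rclass_mul q_rho q_y y2_max cl2_class mz mw).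
transitivity ((ga_mul (lclass p cl1 z) (lclass p cl1 w),
  ga_mul (rclass q cl2 z) (rclass q cl2 w), 0) : T).
  by congr (_, _); apply/W_class_eq0 => A B _ _; exact: omega_mul.
rewrite [RHS]/ga_mul /= /trivext_mul add0r; congr (_, _).
rewrite /gsum big1 // => i _; rewrite big1 // => j _; exact: scaler0.
Qed.

(** The boundary is tested under p and under q separately: under q all coefficients of z vanish, and
    under p only the slices matter. *)
Lemma cycle_pq z : (forall D, q (ext_coef D z) = 0) ->
  (forall C, koszul_d y1 (lproj p C z) = 0) -> koszul_d y z = 0.
Proof.
move=> qz cz; apply: ext_coefP => D; rewrite linear0; apply: pq_inj.
  rewrite -(joinK D) -coef_lproj.
  have := lproj_koszul p_y (lpart D) z; rewrite cz => /esym/(congr1 ( *:%R ((-1) ^+ #|lpart D|))).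
  by rewrite scalerA -expr2 sqrr_sign scale1r scaler0 => ->; rewrite linear0.
rewrite coef_koszul rmorph_sum big1 // => l _.
by rewrite !rmorphM qz !mulr0.
Qed.

Lemma cycle_qp z : (forall D, p (ext_coef D z) = 0) ->
  (forall C, koszul_d y2 (rproj q C z) = 0) -> koszul_d y z = 0.
Proof.
move=> pz cz; apply: ext_coefP => D; rewrite linear0; apply: pq_inj; last first.
  rewrite -(joinK D) -coef_rproj.
  by rewrite -(rproj_koszul q_y) cz linear0.
rewrite coef_koszul rmorph_sum big1 // => l _.
by rewrite !rmorphM pz !mulr0.
Qed.

(** Modulo I the summand I of the maximal ideal dies, so a lift can be chosen in the other summand
    J, where q vanishes. *)
Lemma lift_p b : rho1 b = 0 -> exists a, p a = b /\ q a = 0.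
Proof.
have [r <-] := p_surj b; rewrite p_rho => /max_split[a [c [pa qc ->]]].
by exists c; rewrite rmorphD pa add0r.
Qed.

Lemma lift_q b : rho2 b = 0 -> exists a, q a = b /\ p a = 0.
Proof.
have [r <-] := q_surj b; rewrite q_rho => /max_split[a [c [pa qc ->]]].
by exists a; rewrite rmorphD qc addr0.
Qed.

Lemma rclass_eq0 z : (forall D, q (ext_coef D z) = 0) -> rclass q cl2 z = 0.
Proof.
move=> qz; rewrite -(rclass0 (p := q) (y := y) cl2_class); apply: rclass_eq => C.
by apply: ext_coefP => D; rewrite !coef_rproj qz linear0 rmorph0.
Qed.

Lemma lclass_eq0 z : (forall D, p (ext_coef D z) = 0) -> lclass p cl1 z = 0.
Proof.
move=> pz; rewrite -(lclass0 (p := p) (y := y) cl1_class); apply: lclass_eq => C.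
by apply: ext_coefP => D; rewrite !coef_lproj pz linear0 rmorph0.
Qed.

Lemma fiber_class_inj z : mcyc z -> fiber_class z = 0 -> exists w, z = koszul_d y w.
Proof.
move=> mz [lz rz /W_class_eq0 oz].
have [v2 hv2] := lclass_inj p_rho p_surj p_y y1_max cl1_class mz lz.
have [v1 hv1] := rclass_inj q_rho q_surj q_y y2_max cl2_class mz rz.
have mb v : mcyc (koszul_d y v) by exact: min_cycle_boundary.
(* Under p the coefficient of the primitive at C is only ever multiplied by terms of x2 indexed in
   C, so it is prescribed only if C contains such an index; likewise for q and x1. *)
have glue C : exists u, (rpart C != set0 -> p u = p (ext_coef C v2)) /\
    (lpart C != set0 -> q u = q (ext_coef C v1)).
  have [B0|B0] := boolP (rpart C == set0); first by exists (ext_coef C v1).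
  have [A0|A0] := boolP (lpart C == set0); first by exists (ext_coef C v2).
  have := oz _ _ A0 B0; rewrite /omega joinK.
  case: pickP => [i|/pred0P]; last first.
    by move=> h; case/set0Pn: A0 => i; rewrite (pred0P h i).
  rewrite inE => iC; case: pickP => [j|/pred0P]; last first.
    by move=> h; case/set0Pn: B0 => j; rewrite (pred0P h j).
  rewrite inE => jC.
  rewrite (retract_p _ _ mz (mb v2) hv2) (retract_q _ _ mz (mb v1) hv1).
  (* The vanishing of [omega z] says that the coefficients of v2 and v1 at C have the same residue.
     Their difference is a + b with a killed by p and b by q, and u = v2 - a = v1 + b is the common
     lift. *)
  rewrite !retract_boundary // -rmorphB => /max_split[a [b [pa qb ab]]].
  exists (ext_coef C v2 - a); split=> _; first by rewrite rmorphB pa subr0.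
  have -> : ext_coef C v2 - a = ext_coef C v1 + b.
    by apply/eqP; rewrite subr_eq -addrA [b + a]addrC -ab addrC subrK.
  by rewrite rmorphD qb addr0.
have [w hw] := choice glue; exists (ext_of w).
apply: ext_coefP => D; apply/eqP; rewrite -subr_eq0; apply/eqP; apply: pq_inj.
  rewrite rmorphB hv2 !coef_koszul !rmorph_sum -sumrB big1 // => l _.
  rewrite !rmorphM -mulrBr -mulrBr coef_ext_of.
  elim/ord_split_ind: l => l; first by rewrite p_y mul0r mulr0.
  rewrite (hw _).1 ?subrr ?mulr0 //; apply/set0Pn; exists l.
  by rewrite inE setU11.
rewrite rmorphB hv1 !coef_koszul !rmorph_sum -sumrB big1 // => l _.
rewrite !rmorphM -mulrBr -mulrBr coef_ext_of.
elim/ord_split_ind: l => l; last by rewrite q_y mul0r mulr0.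
rewrite (hw _).2 ?subrr ?mulr0 //; apply/set0Pn; exists l.
by rewrite inE setU11.
Qed.

(** The coefficients of the prescribed slices have residue 0, hence lift to elements killed by q;
    the resulting chain has no component over R/J. *)
Lemma lclass_lift (a : T1) : exists z,
  [/\ mcyc z, lclass p cl1 z = a & rclass q cl2 z = 0].
Proof.
have [x [mx ->]] := lclass_surj p_rho rho_surj y1_ind cl1_class a.
have [c hc] := choice (fun D : {set 'I_(t + s)} =>
  lift_p ((mx (lpart D)).2 (rpart D))).
have qz D : q (ext_coef D (ext_of c)) = 0 by rewrite coef_ext_of (hc D).2.
have xz C : lproj p C (ext_of c) = x C.
  by apply: ext_coefP => D; rewrite coef_lproj coef_ext_of (hc _).1 lpart_join rpart_join.
exists (ext_of c); split; last exact: rclass_eq0.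
  split=> [|D]; last by rewrite -q_rho qz rmorph0.
  by apply: cycle_pq => // C; rewrite xz; case: (mx C).
by apply: eq_bigr => C _; rewrite /lterm xz.
Qed.

Lemma rclass_lift (a : T2) : exists z,
  [/\ mcyc z, rclass q cl2 z = a & lclass p cl1 z = 0].
Proof.
have [x [mx ->]] := rclass_surj q_rho rho_surj y2_ind cl2_class a.
have [c hc] := choice (fun D : {set 'I_(t + s)} =>
  lift_q ((mx (rpart D)).2 (lpart D))).
have pz D : p (ext_coef D (ext_of c)) = 0 by rewrite coef_ext_of (hc D).2.
have xz C : rproj q C (ext_of c) = x C.
  by apply: ext_coefP => D; rewrite coef_rproj coef_ext_of (hc _).1 lpart_join rpart_join.
exists (ext_of c); split; last exact: lclass_eq0.
  split=> [|D]; last by rewrite -p_rho pz rmorph0.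
  by apply: cycle_qp => // C; rewrite xz; case: (mx C).
by apply: eq_bigr => C _; rewrite /rterm xz.
Qed.

(** The cycle is the J-part of a boundary d w whose primitive has the prescribed residues g. It
    agrees with d w under p and vanishes under q, so both product components are zero; the
    retraction along x2 reads g off d w, and the one along x1 reads 0. *)
Lemma W_class_lift (x : W k t s) : exists z,
  [/\ mcyc z, lclass p cl1 z = 0, rclass q cl2 z = 0 & W_class (omega z) = x].
Proof.
have [g ->] := W_class_surj x.
have [w hw] := choice (fun D : {set 'I_(t + s)} => rho_surj (g (lpart D) (rpart D))).
pose b := koszul_d y (ext_of w); have mb : mcyc b by exact: min_cycle_boundary.
have [c hc] := choice (fun D => lift_p (etrans (p_rho _) (mb.2 D))).
have pz D : p (ext_coef D (ext_of c)) = p (ext_coef D b) by rewrite coef_ext_of (hc D).1.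
have qz D : q (ext_coef D (ext_of c)) = 0 by rewrite coef_ext_of (hc D).2.
have lz C : lproj p C (ext_of c) = lproj p C b.
  by apply: ext_coefP => D; rewrite !coef_lproj pz.
have mz : mcyc (ext_of c).
  split=> [|D]; last by rewrite -q_rho qz rmorph0.
  apply: cycle_pq => // C; rewrite lz; apply: (lproj_cycle p_y); exact: koszul_sq.
exists (ext_of c); split=> //; last 1 first.
- apply/eqP; rewrite -subr_eq0 -scaleN1r addrC -W_class_lin; apply/eqP/W_class_eq0.
  move=> A B A0 B0; rewrite /omega.
  case: pickP => [i iA|/pred0P h]; last by case/set0Pn: A0 => i; rewrite (pred0P h i).
  case: pickP => [j jB|/pred0P h]; last by case/set0Pn: B0 => j; rewrite (pred0P h j).
  rewrite (retract_p _ _ mz mb pz) retract_boundary ?in_joinr // coef_ext_of hw.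
  by rewrite lpart_join rpart_join /retract lead_q // mulr0 subr0 mulN1r addNr.
- by rewrite (lclass_eq cl1 lz) (lclass_boundary p_y cl1_class).
- exact: rclass_eq0.
Qed.

Lemma fiber_class_surj (x : T) : exists2 z, mcyc z & fiber_class z = x.
Proof.
case: x => [[a b] c].
have [z1 [m1 l1 r1]] := lclass_lift a; have [z2 [m2 r2 l2]] := rclass_lift b.
have m12 := min_cycle_lin 1 m1 m2.
(* The lifts of a and b may carry a component in W; z3 corrects it without touching the other
   two. *)
have [z3 [m3 l3 r3 o3]] := W_class_lift (c - W_class (omega (1 *: z1 + z2))).
exists (1 *: (1 *: z1 + z2) + z3); first exact: min_cycle_lin.
rewrite fiber_class_lin // rmorph1 scale1r /fiber_class l3 r3 o3.
have -> : lclass p cl1 (1 *: z1 + z2) = a.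
  rewrite (lclass_lin p_rho p_y cl1_class) ?l1 ?l2 ?rmorph1 ?scale1r ?addr0 //.
    by case: m1.
  by case: m2.
have -> : rclass q cl2 (1 *: z1 + z2) = b.
  rewrite (rclass_lin q_rho q_y cl2_class) ?r1 ?r2 ?scaler0 ?add0r //.
    by case: m1.
  by case: m2.
by congr (_, _, _); rewrite /= ?addr0 // addrC subrK.
Qed.

Variables (A : gralg k) (cl : E -> A).
Hypothesis cl_class : class_map rho y cl.

(** Since [fiber_class] kills boundaries, it depends only on the class of a minimal cycle. The map
    is defined on chosen representatives and computed, through [fE], on any others. *)
Theorem fiber_product_iso : gralg_iso (pos A) T.
Proof.
have rep (a : pos A) : exists z, mcyc z /\ cl z = pos_val a.
  by have [z mz <-] := min_cycle_pos y_ind cl_class (pos_val0 a); exists z.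
have [r hr] := choice rep.
have indep z w : mcyc z -> mcyc w -> cl z = cl w -> fiber_class z = fiber_class w.
  move=> mz mw zw; have [[dz _] [dw _]] := (mz, mw).
  have [u hu] : exists u, z - w = koszul_d y u.
    apply: (class_eq0 cl_class); first by rewrite linearB /= dz dw subrr.
    by rewrite (classB cl_class) // zw subrr.
  rewrite -[z](subrK w) hu -[koszul_d y u]scale1r fiber_class_lin //.
    by rewrite fiber_class_boundary scaler0 add0r.
  exact: min_cycle_boundary.
pose f (a : pos A) : T := fiber_class (r a).
have fE a z : mcyc z -> cl z = pos_val a -> f a = fiber_class z.
  by move=> mz za; apply: indep => //; [case: (hr a)|rewrite za; case: (hr a)].
have f_lin : linear f.
  move=> c a b; have [e <-] := rho_surj c; have [[ma ha] [mb hb]] := (hr a, hr b).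
  rewrite -fiber_class_lin //; apply: fE; first exact: min_cycle_lin.
  by rewrite (class_lin cl_class) ?ha ?hb ?pos_val_linear //; [case: ma|case: mb].
pose fL := GRing.isLinear.Build k (pos A) T _ f f_lin.
pose F : {linear pos A -> T} := HB.pack f fL.
exists F; split.
- have surj (x : T) : exists a, f a = x.
    have [z mz <-] := fiber_class_surj x; exists (pos_part (cl z)); apply: fE => //.
    by rewrite pos_partK // (min_cycle_comp0 y_max cl_class).
  have [g hg] := choice surj; exists g => // a; apply/eqP; rewrite -subr_eq0; apply/eqP.
  have : f (g (f a) - a) = 0.
    by rewrite -scaleN1r addrC f_lin hg scaleN1r addNr.
  move: (g (f a) - a) => b fb; have [mb hb] := hr b.
  have [w hw] := fiber_class_inj mb fb.
  apply: pos_val_inj; rewrite -hb hw (class_boundary cl_class).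
  exact/esym/(linear_at0 (@pos_val_linear k A)).
- move=> a b; have [[ma ha] [mb hb]] := (hr a, hr b).
  rewrite -fiber_class_mul //; apply: fE; first exact: min_cycle_mul.
  by rewrite (class_mul cl_class) ?ha ?hb //; [case: ma|case: mb].
- move=> i a; have [ma ha] := hr a.
  rewrite -fiber_class_comp //; apply: fE; first exact: min_cycle_comp.
  by rewrite (class_comp cl_class) ?ha //; case: ma.
Qed.
End FiberProduct.

(** * From the direct sum of I and J to the fiber product *)

Lemma quot_eq0 (R : comNzRingType) (I : idealr R) z :
  \pi_{ideal_quot I} z = 0 <-> z \in I.
Proof.
rewrite -[z in z \in I]subr0 Quotient.idealrBE.
by rewrite -(rmorph0 (\pi_{ideal_quot I})); split=> [->|/eqP].
Qed.

Lemma quot_surj (R : comNzRingType) (I : idealr R) (b : {ideal_quot I}) :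
  exists a, \pi_{ideal_quot I} a = b.
Proof. by exists (repr b); rewrite reprK. Qed.

Lemma noetherian_local_quot (R : comNzRingType) (k : fieldType) (rho : {rmorphism R -> k})
    (I : idealr R) (rhoI : {rmorphism {ideal_quot I} -> k}) :
  (forall z, rhoI (\pi_{ideal_quot I} z) = rho z) ->
  noetherian_local rho -> noetherian_local rhoI.
Proof.
move=> rhoI_pi [surj unitR nR]; split=> [c|b|].
- by have [z <-] := surj c; exists (\pi z); rewrite rhoI_pi.
- have [z <-] := quot_surj b; rewrite rhoI_pi => /unitR[u zu].
  by exists (\pi u); rewrite -rmorphM zu rmorph1.
- exact: noetherian_surj (@quot_surj R I) nR.
Qed.

Section DirectSum.
Variables (R : comNzRingType) (k : fieldType) (rho : {rmorphism R -> k}) (I J : idealr R).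
Hypothesis m_sum : forall z, max_ideal rho z <-> exists a b, [/\ a \in I, b \in J & z = a + b].
Hypothesis m_direct : forall z, z \in I -> z \in J -> z = 0.
Variables (t s : nat) (x1 : 'I_t -> R) (x2 : 'I_s -> R).
Hypothesis x1_gen : min_gen (fun z => z \in I) x1.
Hypothesis x2_gen : min_gen (fun z => z \in J) x2.

Let x1I i : x1 i \in I. Proof. exact: (gen_mem i x1_gen.1). Qed.
Let x2J j : x2 j \in J. Proof. exact: (gen_mem j x2_gen.1). Qed.

Lemma sum_mem (L : idealr R) n (c x : 'I_n -> R) :
  (forall i, x i \in L) -> \sum_i c i * x i \in L.
Proof. by move=> h; apply: rpred_sum => i _; exact: idealMr. Qed.

Definition concat (l : 'I_(t + s)) : R :=
  match split l with inl i => x1 i | inr j => x2 j end.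

Lemma concat_l i : concat (lshift s i) = x1 i.
Proof. by rewrite /concat (unsplitK (inl i)). Qed.
Lemma concat_r j : concat (rshift t j) = x2 j.
Proof. by rewrite /concat (unsplitK (inr j)). Qed.

Lemma sum_concat c : \sum_l c l * concat l =
  \sum_i c (lshift s i) * x1 i + \sum_j c (rshift t j) * x2 j.
Proof.
rewrite big_split_ord; congr (_ + _); apply: eq_bigr => i _.
  by rewrite concat_l.
by rewrite concat_r.
Qed.

(** An expression of one term through the others splits along the direct sum: the part in the other
    ideal must vanish, and what remains contradicts minimality of x1 or of x2. *)
Lemma concat_min_gen : min_gen (max_ideal rho) concat.
Proof.
split=> [z|l [c cl]].
  split=> [/m_sum[a [b [/x1_gen.1[c ->] /x2_gen.1[e ->] ->]]]|[c ->]].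
    exists (fun l => match split l with inl i => c i | inr j => e j end).
    rewrite sum_concat; congr (_ + _); apply: eq_bigr => i _.
      by rewrite (unsplitK (inl i)).
    by rewrite (unsplitK (inr i)).
  apply/m_sum; rewrite sum_concat; do 2!eexists; split; last by [].
    exact: sum_mem.
  exact: sum_mem.
elim/ord_split_ind: l cl => i ci; rewrite ?concat_l ?concat_r sum_concat => xE.
  apply: (x1_gen.2 i); exists (fun i => c (lshift s i)) => //.
  apply/eqP; rewrite -subr_eq0; apply/eqP; apply: m_direct.
    by rewrite rpredB ?sum_mem.
  by rewrite xE addrC addKr sum_mem.
apply: (x2_gen.2 i); exists (fun i => c (rshift t i)) => //.
apply/eqP; rewrite -subr_eq0; apply/eqP; apply: m_direct.
  by rewrite xE addrK sum_mem.
by rewrite rpredB ?sum_mem.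
Qed.

Lemma min_gen_quot_l (rhoI : {rmorphism {ideal_quot I} -> k}) :
  (forall z, rhoI (\pi_{ideal_quot I} z) = rho z) ->
  min_gen (max_ideal rhoI) (fun j => \pi_{ideal_quot I} (concat (rshift t j))).
Proof.
move=> rhoI_pi; split=> [z|j [c cj]].
  have [r <-] := quot_surj z; split=> [|[c ->]].
    rewrite /max_ideal rhoI_pi => /m_sum[a [b [aI /x2_gen.1[c ->] ->]]].
    rewrite rmorphD /= (quot_eq0 I a).2 // add0r rmorph_sum.
    by exists (fun j => \pi_{ideal_quot I} (c j)); apply: eq_bigr => j _; rewrite rmorphM concat_r.
  rewrite /max_ideal rmorph_sum big1 // => j _; rewrite rmorphM rhoI_pi.
  by rewrite (gen_mem (rshift t j) concat_min_gen.1 : rho _ = 0) mulr0.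
rewrite concat_r => xE; apply: (x2_gen.2 j).
have [e he] := choice (fun i => quot_surj (c i)).
(* A lift of [c j = 0] may be a nonzero element of I, so it is reset to 0. The two sides then differ
   by an element of both I and J, which is 0. *)
exists (fun i => if i == j then 0 else e i); first by rewrite eqxx.
apply/eqP; rewrite -subr_eq0; apply/eqP; apply: m_direct; last by rewrite rpredB ?sum_mem.
apply/quot_eq0; rewrite rmorphB /= xE rmorph_sum -sumrB big1 // => i _; rewrite concat_r rmorphM.
rewrite /=; case: eqP => [->|_]; first by rewrite cj rmorph0 !mul0r subrr.
by rewrite he subrr.
Qed.

Lemma min_gen_quot_r (rhoJ : {rmorphism {ideal_quot J} -> k}) :
  (forall z, rhoJ (\pi_{ideal_quot J} z) = rho z) ->
  min_gen (max_ideal rhoJ) (fun i => \pi_{ideal_quot J} (concat (lshift s i))).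
Proof.
move=> rhoJ_pi; split=> [z|j [c cj]].
  have [r <-] := quot_surj z; split=> [|[c ->]].
    rewrite /max_ideal rhoJ_pi => /m_sum[a [b [/x1_gen.1[c ->] bJ ->]]].
    rewrite rmorphD /= (quot_eq0 J b).2 // addr0 rmorph_sum.
    by exists (fun i => \pi_{ideal_quot J} (c i)); apply: eq_bigr => i _; rewrite rmorphM concat_l.
  rewrite /max_ideal rmorph_sum big1 // => i _; rewrite rmorphM rhoJ_pi.
  by rewrite (gen_mem (lshift s i) concat_min_gen.1 : rho _ = 0) mulr0.
rewrite concat_l => xE; apply: (x1_gen.2 j).
have [e he] := choice (fun i => quot_surj (c i)).
exists (fun i => if i == j then 0 else e i); first by rewrite eqxx.
apply/eqP; rewrite -subr_eq0; apply/eqP; apply: m_direct; first by rewrite rpredB ?sum_mem.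
apply/quot_eq0; rewrite rmorphB /= xE rmorph_sum -sumrB big1 // => i _; rewrite concat_l rmorphM.
rewrite /=; case: eqP => [->|_]; first by rewrite cj rmorph0 !mul0r subrr.
by rewrite he subrr.
Qed.
End DirectSum.

Theorem mainTheorem1 (R : comNzRingType) (k : fieldType)
  (rho : {rmorphism R -> k}) (R_local : noetherian_local rho)
  (I J : idealr R)
  (I_neq0 : exists2 a, a \in I & a != 0)
  (J_neq0 : exists2 b, b \in J & b != 0)
  (m_sum : forall z, max_ideal rho z <->
     exists a b, [/\ a \in I, b \in J & z = a + b])
  (m_direct : forall z, z \in I -> z \in J -> z = 0)
  (t s : nat) (x1 : 'I_t -> R) (x2 : 'I_s -> R)
  (x1_gen : min_gen (fun z => z \in I) x1)
  (x2_gen : min_gen (fun z => z \in J) x2)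
  (rhoI : {rmorphism {ideal_quot I} -> k})
  (rhoI_pi : forall z, rhoI (\pi_{ideal_quot I} z) = rho z)
  (rhoJ : {rmorphism {ideal_quot J} -> k})
  (rhoJ_pi : forall z, rhoJ (\pi_{ideal_quot J} z) = rho z)
  (A_R A_RI A_RJ : gralg k)
  (A_R_Tor : is_Tor_algebra rho A_R)
  (A_RI_Tor : is_Tor_algebra rhoI A_RI)
  (A_RJ_Tor : is_Tor_algebra rhoJ A_RJ) :
  gralg_iso (pos A_R)
    (trivext0 (gprod (gtens (exterior k t) (pos A_RI))
                     (gtens (pos A_RJ) (exterior k s)))
              (W k t s)) /\
  connected A_R.
Proof.
have unit_of (S : comNzRingType) (r : {rmorphism S -> k}) (rl : noetherian_local r) x :
  r x <> 0 -> exists y, x * y = 1 by case: rl => _ h _; exact: h.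
have locI := noetherian_local_quot rhoI_pi R_local.
have locJ := noetherian_local_quot rhoJ_pi R_local.
have gR := concat_min_gen m_sum m_direct x1_gen x2_gen.
have gI := min_gen_quot_l m_sum m_direct x1_gen x2_gen rhoI_pi.
have gJ := min_gen_quot_r m_sum m_direct x1_gen x2_gen rhoJ_pi.
have [cl clP] := Tor_algebra_koszul R_local gR A_R_Tor.
have [clI clIP] := Tor_algebra_koszul locI gI A_RI_Tor.
have [clJ clJP] := Tor_algebra_koszul locJ gJ A_RJ_Tor.
have rho_surj : forall c, exists x, rho x = c by case: R_local.
have indR := min_gen_independent (unit_of _ _ R_local) gR.
split; last exact: koszul_homology_connected gR.1 _ clP rho_surj.
apply: (fiber_product_iso rhoI_pi rhoJ_pi _ _ rho_surj _ _ _ gR.1 indR gI.1 _ gJ.1 _ clIP clJP clP).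
- exact: quot_surj.
- exact: quot_surj.
- by move=> i; apply/quot_eq0; rewrite concat_l; exact: (gen_mem i x1_gen.1).
- by move=> j; apply/quot_eq0; rewrite concat_r; exact: (gen_mem j x2_gen.1).
- by move=> z /quot_eq0 zI /quot_eq0; exact: m_direct.
- exact: min_gen_independent (unit_of _ _ locI) gI.
- exact: min_gen_independent (unit_of _ _ locJ) gJ.
Qed.
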